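(* Assume the setting and assumptions (i)–(ix) described in the context, and $\mathbb{E}(e^{2\imath j\eta_\sigma})\ne1$ for $j=1,2$. Then the Lyapunov exponent satisfies $$\gamma^{\epsilon,\delta}=\mathcal{C}\,\delta+\mathcal{D}\,\epsilon^2+\mathcal{O}(\epsilon^3,\epsilon\delta,\delta^2).$$
   Context: Notation: $J=\mathrm{diag}(1,-1)$; $\mathrm{SU}(1,1)=\{T\in\mathbb{C}^{2\times2}:T^*JT=J,\det T=1\}$; $\mathrm{SU}_{\le}(1,1)=\{T:T^*JT\le J,\det T=1\}$; $\mathfrak{su}(1,1)=\{A\in\mathbb{C}^{2\times2}:A^*J=-JA,\ \mathrm{Tr}A=0\}$ with real basis $B_1=\begin{pmatrix}0&1\\1&0\end{pmatrix}$, $B_2=\begin{pmatrix}0&\imath\\-\imath&0\end{pmatrix}$, $B_3=\begin{pmatrix}\imath&0\\0&-\imath\end{pmatrix}$; $R_\eta=\mathrm{diag}(e^{\imath\eta},e^{-\imath\eta})$; Möbius action $T\cdot z=\frac{az+b}{cz+d}$ on $\overline{\mathbb C}$ for $T=\begin{pmatrix}a&b\\c&d\end{pmatrix}$. Setting: $(\Sigma,\mathbb P)$ a probability space with expectation $\mathbb E$; for real $(\epsilon,\delta)$ near $(0,0)$, a random family $T^{\epsilon,\delta}_\sigma\in\mathrm{SL}(2,\mathbb C)$ with: (i) $(\epsilon,\delta)\mapsto T^{\epsilon,\delta}_\sigma$ is $C^2$ near $(0,0)$; (ii) $T^{0,0}_\sigma=R_{\eta_\sigma}$, $\eta_\sigma\in[0,2\pi)$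 random; (iii) $T^{\epsilon,0}_\sigma\in\mathrm{SU}(1,1)$; (iv) $T^{0,\imath\delta}_\sigma\in\mathrm{SU}(1,1)$; (v) $T^{\epsilon,\delta}_\sigma\in\mathrm{SU}_\le(1,1)$ for $\delta\ge0$; $T^{\epsilon,\delta}_\sigma=R_{\eta_\sigma}\exp[\epsilon P_\sigma+\epsilon^2P'_\sigma+\imath\delta Q_\sigma+\mathcal{O}(\epsilon^3,\epsilon\delta,\delta^2)]$ with random $P_\sigma,P'_\sigma,Q_\sigma\in\mathfrak{su}(1,1)$, (vi) uniformly bounded, (vii) the error term bounded by $C(\epsilon^3+\epsilon\delta+\delta^2)$ uniformly; for $(\epsilon,\delta)\ne(0,0)$: (viii) every finite $F\subset\overline{\mathbb C}$ satisfies $\mathrm{supp}(T^{\epsilon,\delta}_\sigma)\cdot F\not\subset F$, and (ix) the semigroup generated by $\mathrm{supp}(T^{\epsilon,\delta}_\sigma)$ is not relatively compact. Write $P_\sigma=\sum_jp_{j,\sigma}B_j$, $Q_\sigma=\sum_jq_{j,\sigma}B_j$ (real coefficients), $\beta_\sigma=p_{1,\sigma}-\imath p_{2,\sigma}$, $\mathcal{C}=\mathbb{E}(q_{3,\sigma})$, $\mathcal{D}=\frac12\mathbb{E}(|\beta_\sigma|^2)+\mathrm{Re}\Big(\frac{\mathbb{E}(\beta_\sigma)\mathbb{E}(e^{2\imath\eta_\sigma}\overline{\beta_\sigma})}{1-\mathbb{E}(e^{2\imath\eta_\sigma})}\Big)$. The Lyapunov exponent is $\gamma^{\epsilon,\delta}=\lim_{N\to\infty}\frac1N\log\|T_N\cdots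 T_1\|$ where $T_n$ are i.i.d. copies of $T^{\epsilon,\delta}_\sigma$. $\mathcal{O}(\cdot)$ denotes a bound by a constant (independent of $\epsilon,\delta$) times the sum of the listed quantities, for small $\epsilon$ and small $\delta\ge0$. *)

(* Defs.v *)
From HB Require Import structures.
From mathcomp Require Import all_boot all_order all_algebra.
From mathcomp Require Import all_classical all_reals all_analysis.
From mathcomp Require Import complex.
Import Order.TTheory GRing.Theory Num.Theory.
Import numFieldTopology.Exports numFieldNormedType.Exports.

Set Implicit Arguments.
Unset Strict Implicit.
Unset Printing Implicit Defensive.

Local Open Scope ring_scope.
Local Open Scope classical_set_scope.

(* The complex numbers R[i] over a realType R, seen as a numFieldType so that
   MathComp-Analysis equips it (and 2x2 matrices over it) with its usual
   (modulus) topology. *)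
Notation Cx R := ((complex R : numFieldType)) (only parsing).

Section Defs.
Variable R : realType.
Local Notation C := (Cx R).
Local Notation M2 := ('M[C]_2).

Definition cR (x : R) : C := Complex x 0.
Definition cI : C := Complex 0 1.
Definition reC (z : C) : R := complex.Re z.
Definition imC (z : C) : R := complex.Im z.
Definition modC (z : C) : R := Num.sqrt (reC z ^+ 2 + imC z ^+ 2).
Definition expi (x : R) : C := cR (cos x) + cI * cR (sin x).

Definition i0 : 'I_2 := ord0.
Definition i1 : 'I_2 := ord_max.

Definition mxnorm (A : M2) : R :=
  Num.max (Num.max (modC (A i0 i0)) (modC (A i0 i1)))
          (Num.max (modC (A i1 i0)) (modC (A i1 i1))).

Definition mxstar m n (A : 'M[C]_(m, n)) : 'M[C]_(n, m) := (map_mx Num.conj A)^T.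

Definition Jm : M2 :=
  \matrix_(i, j) (if i == j then (if i == i0 then 1 else -1) else 0).

Definition SL2 : set M2 := [set T | \det T = 1].
Definition SU11 : set M2 := [set T | mxstar T *m Jm *m T = Jm /\ \det T = 1].
(* Loewner order: A <= B iff B - A is positive semidefinite *)
Definition mx_psd (A : M2) : Prop :=
  forall v : 'cV[C]_2, 0 <= (mxstar v *m A *m v) ord0 ord0.
Definition SU11le : set M2 :=
  [set T | mx_psd (Jm - mxstar T *m Jm *m T) /\ \det T = 1].
Definition su11 : set M2 :=
  [set A | mxstar A *m Jm = - (Jm *m A) /\ \tr A = 0].

Definition B1 : M2 := \matrix_(i, j) (if i == j then 0 else 1).
Definition B2 : M2 :=
  \matrix_(i, j) (if i == j then 0 else if i == i0 then cI else - cI).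
Definition B3 : M2 :=
  \matrix_(i, j) (if i == j then (if i == i0 then cI else - cI) else 0).

Definition Rot (eta : R) : M2 :=
  \matrix_(i, j) (if i == j then (if i == i0 then expi eta else expi (- eta)) else 0).

Definition mexp (A : M2) : M2 :=
  lim (series (fun k : nat => (k`!%:R : C)^-1 *: A ^+ k) @ \oo).

(* Moebius action on the Riemann sphere, None standing for infinity *)
Definition mobius (T : M2) (z : option C) : option C :=
  let a := T i0 i0 in let b := T i0 i1 in
  let c := T i1 i0 in let d := T i1 i1 in
  match z with
  | None => if c == 0 then None else Some (a / c)
  | Some z => if c * z + d == 0 then None else Some ((a * z + b) / (c * z + d))
  end.

Definition mx_supp d (S : measurableType d) (P : probability S R) (X : S -> M2)
  : set M2 :=
  [set M | forall e : R, 0 < e -> (0 < P [set s | (mxnorm (X s - M) < e)%R])%E].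

Inductive semigen (A : set M2) : M2 -> Prop :=
| semigen_gen x : A x -> semigen A x
| semigen_mul x y : semigen A x -> A y -> semigen A (y *m x).

Definition Exp d (S : measurableType d) (P : probability S R) (f : S -> R) : R :=
  Rintegral P setT f.
Definition ExpC d (S : measurableType d) (P : probability S R) (f : S -> C) : C :=
  cR (Exp P (fun s => reC (f s))) + cI * cR (Exp P (fun s => imC (f s))).

Definition pderiv (v : R * R) (f : R * R -> R) : R * R -> R := fun x => 'D_v f x.
Definition coord_dir (u : R * R) : Prop := u = (1, 0) \/ u = (0, 1).
Definition C2_near0 (f : R * R -> R) : Prop :=
  \forall x \near (0 : R * R),
    [/\ {for x, continuous f},
        forall u, coord_dir u -> derivable f x u /\ {for x, continuous (pderiv u f)}
      & forall u w, coord_dir u -> coord_dir w ->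
          derivable (pderiv u f) x w /\ {for x, continuous (pderiv w (pderiv u f))}].

Definition iid_seq d d' (S : measurableType d) (Om : measurableType d')
  (P : probability S R) (Q : probability Om R) (s : nat -> Om -> S) : Prop :=
  [/\ forall n, measurable_fun setT (s n),
      forall n (A : set S), measurable A -> Q (s n @^-1` A) = P A
    & forall (I : seq nat) (A : nat -> set S), uniq I ->
        (forall i, measurable (A i)) ->
        Q (\bigcap_(i in [set` I]) (s i @^-1` A i))
        = (\prod_(i <- I) Q (s i @^-1` A i))%E ].

(* T_N ... T_1 with T_{n+1} = X n *)
Fixpoint prodmx (X : nat -> M2) (n : nat) : M2 :=
  match n with 0 => 1%:M | n.+1 => X n *m prodmx X n end.

Definition lyap_seq (X : nat -> M2) (N : nat) : R :=
  (N%:R)^-1 * ln (mxnorm (prodmx X N)).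

End Defs.
Arguments cI {R}.
Arguments B1 {R}.
Arguments B2 {R}.
Arguments B3 {R}.
Arguments Jm {R}.

(* Main.v *)
Require Import Defs.
From HB Require Import structures.
From mathcomp Require Import all_boot all_order all_algebra.
From mathcomp Require Import all_classical all_reals all_analysis.
From mathcomp Require Import measurable_realfun complex.
From mathcomp Require Import zify ring lra.
Import Order.TTheory GRing.Theory Num.Theory.
Import numFieldTopology.Exports numFieldNormedType.Exports.
Local Open Scope ring_scope.
Local Open Scope classical_set_scope.
Set Implicit Arguments.
Unset Strict Implicit.
Unset Printing Implicit Defensive.

(** The lower right entry d_N of a product of N matrices T with T^* J T <= J
    controls its norm up to a factor 2, and log |d_N| is the sum of the
    log |c z_n + d| along the orbit z_n of 0 under the Moebius action, which
    stays in the closed unit disc.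

    Existence of the limit: log |d_N| + log 2 is subadditive along the shift on
    the space of sequences, and the subadditive ergodic theorem for i.i.d.
    sequences follows from the zero-one law, a greedy covering and a strong law
    of large numbers for bounded finite range dependent variables.

    Value of the limit: for the corrector
    h(z) = Re (A z + eps^2 (B z + G z^2)), the mean of
    log |c z + d| + h(T.z) - h(z) is C delta + D eps^2 up to the error term,
    uniformly on the disc.  The coefficients of z and z^2 are cancelled by
    solving A (1 - m_1) = E(c), and likewise for B with 1 - m_1 and for G with
    1 - m_2, where m_j = E(e^{2 i j eta}).  The deviations from the means are
    bounded martingale differences, which average out almost surely. *)

(** The logarithm of the corner entry is preferred to that of the norm because it is exactly
    additive along the orbit. The price is a mean over random points z_n of unknown distribution, so
    the mean of one step must be made independent of z. At leading order T acts as z -> u z with u =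
    e^{2 i eta}; hence adding h(T.z) - h(z) changes the coefficient of z^k, in mean, by that of h
    times E(u^k) - 1. As log |c z + d| has degree 1 in z at order eps and degree 2 at order eps^2,
    exactly two nonresonance conditions appear.

    The constant D is what survives at z^0. Its first half comes from the square of P in the
    exponential; the p_3^2 of that square is cancelled by the quadratic term of the logarithm. The
    fraction in D is the response of the orbit: the linear corrector applied to the drift at z = 0.

    In the ergodic theorem the lower bound is built into the definition of the growth rate as a
    threshold; the covering is needed for the upper bound only. *)

Section bounded_measurable.
Context {R : realType} {d : measure_display} {X : measurableType d}.
Variable P : probability X R.

(** On a probability space this class is closed under ring operations and consists of integrable
    functions, so expectations below are linear without further side conditions. *)
Definition bmeas (f : X -> R) :=
  measurable_fun setT f /\ exists C : R, forall x, `|f x| <= C.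

Lemma bmeas_cst c : bmeas (fun=> c).
Proof. by split; [exact: measurable_cst|exists `|c|]. Qed.

Lemma bmeasD f g : bmeas f -> bmeas g -> bmeas (fun x => f x + g x).
Proof.
move=> [mf [C hC]] [mg [D hD]]; split; first exact: measurable_funD.
by exists (C + D) => x; rewrite (le_trans (ler_normD _ _))// lerD.
Qed.

Lemma bmeasN f : bmeas f -> bmeas (fun x => - f x).
Proof.
move=> [mf [C hC]]; split; first exact: measurableT_comp.
by exists C => x; rewrite normrN.
Qed.

Lemma bmeasB f g : bmeas f -> bmeas g -> bmeas (fun x => f x - g x).
Proof. by move=> hf hg; apply: bmeasD => //; exact: bmeasN. Qed.

Lemma bmeasM f g : bmeas f -> bmeas g -> bmeas (fun x => f x * g x).
Proof.
move=> [mf [C hC]] [mg [D hD]]; split; first exact: measurable_funM.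
by exists (C * D) => x; rewrite normrM ler_pM.
Qed.

Lemma bmeas_sum (n : nat) (f : nat -> X -> R) :
  (forall i, bmeas (f i)) -> bmeas (fun x => \sum_(i < n) f i x).
Proof.
move=> hf; elim: n => [|n IH].
  by under eq_fun do rewrite big_ord0; exact: bmeas_cst.
by under eq_fun do rewrite big_ord_recr/=; exact: bmeasD.
Qed.

Lemma bmeas_integrable f : bmeas f -> P.-integrable setT (EFin \o f).
Proof.
move=> [mf [C hC]]; apply: measurable_bounded_integrable => //.
  by rewrite (le_lt_trans (probability_le1 P _))// ltry.
exists C; split; first exact: num_real.
by move=> y Cy x _ /=; apply: le_trans (hC x) _; rewrite ltW.
Qed.

Lemma Exp_cst c : Exp P (fun=> c) = c.
Proof. by rewrite /Exp Rintegral_cst// [X in fine X](probability_setT P) mulr1. Qed.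

Lemma eq_Exp f g : (forall x, f x = g x) -> Exp P f = Exp P g.
Proof. by move=> /funext ->. Qed.

Lemma ExpD f g : bmeas f -> bmeas g ->
  Exp P (fun x => f x + g x) = Exp P f + Exp P g.
Proof. by move=> hf hg; rewrite /Exp RintegralD//; exact: bmeas_integrable. Qed.

Lemma ExpB f g : bmeas f -> bmeas g ->
  Exp P (fun x => f x - g x) = Exp P f - Exp P g.
Proof. by move=> hf hg; rewrite /Exp RintegralB//; exact: bmeas_integrable. Qed.

Lemma ExpZ c f : bmeas f -> Exp P (fun x => c * f x) = c * Exp P f.
Proof. by move=> hf; rewrite /Exp RintegralZl//; exact: bmeas_integrable. Qed.

Lemma Exp_sum (n : nat) (f : nat -> X -> R) : (forall i, bmeas (f i)) ->
  Exp P (fun x => \sum_(i < n) f i x) = \sum_(i < n) Exp P (f i).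
Proof.
move=> hf; elim: n => [|n IH].
  by rewrite big_ord0; under eq_fun do rewrite big_ord0; exact: Exp_cst.
rewrite big_ord_recr/= -IH -ExpD//; last exact: bmeas_sum.
by under eq_fun do rewrite big_ord_recr/=.
Qed.

Lemma Exp_ge0 f : (forall x, 0 <= f x) -> 0 <= Exp P f.
Proof. by move=> h; apply: Rintegral_ge0. Qed.

Lemma le_Exp f g : bmeas f -> bmeas g -> (forall x, f x <= g x) ->
  Exp P f <= Exp P g.
Proof.
move=> hf hg fg; rewrite -subr_ge0 -ExpB//.
by apply: Exp_ge0 => x; rewrite subr_ge0.
Qed.

Lemma Exp_le_norm f C : bmeas f -> (forall x, `|f x| <= C) -> `|Exp P f| <= C.
Proof.
move=> hf fC; rewrite ler_norml; apply/andP; split.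
  rewrite -(Exp_cst (- C)); apply: le_Exp => //; first exact: bmeas_cst.
  by move=> x; have := fC x; rewrite ler_norml => /andP[].
rewrite -(Exp_cst C); apply: le_Exp => //; first exact: bmeas_cst.
by move=> x; have := fC x; rewrite ler_norml => /andP[].
Qed.

Lemma Exp_EFin f : bmeas f -> (\int[P]_x (f x)%:E)%E = (Exp P f)%:E.
Proof.
move=> hf; rewrite /Exp /Rintegral fineK//.
by apply: integrable_fin_num => //; exact: bmeas_integrable.
Qed.

Lemma bmeas_indic (A : set X) : measurable A -> bmeas (\1_A : X -> R).
Proof.
move=> mA; split; first exact: measurable_indic.
by exists 1 => x; rewrite indicE ger0_norm//; case: (_ \in _).
Qed.

Lemma Exp_indic (A : set X) : measurable A -> Exp P (\1_A : X -> R) = fine (P A).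
Proof. by move=> mA; rewrite /Exp /Rintegral integral_indic// setIT. Qed.

End bounded_measurable.

(** * Product sigma-algebra on sequences, shift and gluing *)

Section sequence_space.
Context {R : realType} {d : measure_display} {X : measurableType d}.

Definition cyl (A : nat -> set X) (n : nat) : set (nat -> X) :=
  [set x | forall i, (i < n)%N -> A i (x i)].

Definition cylinders : set (set (nat -> X)) :=
  [set C | exists A n, (forall i, measurable (A i)) /\ C = cyl A n].

Definition seqs := g_sigma_algebraType cylinders.

Lemma measurable_cyl A n : (forall i, measurable (A i)) ->
  measurable (cyl A n : set seqs).
Proof. by move=> mA; apply: sub_sigma_algebra; exists A, n. Qed.

Lemma measurable_coord (i : nat) : measurable_fun setT (fun x : seqs => x i).
Proof.
move=> _ A mA; rewrite setTI.
rewrite (_ : _ @^-1` A = cyl (fun j => if j == i then A else setT) i.+1).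
  by apply: measurable_cyl => j; case: eqP.
apply/seteqP; split => x /=.
  by move=> Ax j _; case: eqP => [->|].
by move=> /(_ i (ltnSn i)); rewrite eqxx.
Qed.

Lemma measurable_fun_seqs d' (Y : measurableType d') (f : Y -> seqs) :
  (forall i, measurable_fun setT (fun y => f y i)) -> measurable_fun setT f.
Proof.
move=> mf; apply: (@measurability _ _ Y seqs setT f cylinders) => // _ [_ [A [n [mA ->]]] <-].
rewrite setTI (_ : f @^-1` _ =
    \bigcap_(i in [set i | (i < n)%N]) ((fun y => f y i) @^-1` A i)).
  by apply: bigcap_measurableType => i _; rewrite -[X in measurable X]setTI; exact: mf.
by apply/seteqP; split => y.
Qed.

(** Cylinders form a pi-system once the shorter one is padded with [setT], and a cylinder of length
    0 is the whole space. *)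
Lemma seqs_measure_unique (m1 m2 : {measure set seqs -> \bar R}) :
  (m1 setT < +oo)%E ->
  (forall A n, (forall i, measurable (A i)) -> m1 (cyl A n) = m2 (cyl A n)) ->
  forall A, measurable A -> m1 A = m2 A.
Proof.
move=> m1oo m12 A mA.
apply: (@measure_unique _ R seqs cylinders (fun=> setT)) => //.
- move=> _ _ [A1 [n1 [mA1 ->]]] [A2 [n2 [mA2 ->]]].
  exists (fun i => (if (i < n1)%N then A1 i else setT)
             `&` (if (i < n2)%N then A2 i else setT)), (maxn n1 n2); split.
    by move=> i; apply: measurableI; case: ifP.
  apply/seteqP; split=> [x [h1 h2] i _|x h].
    by split; case: ifP => // hi; [exact: h1|exact: h2].
  split=> i hi; have hm : (i < maxn n1 n2)%N by rewrite leq_max hi ?orbT.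
    by case: (h i hm) => /=; rewrite hi.
  by case: (h i hm) => /=; rewrite hi.
- move=> _; exists (fun=> setT), 0%N; split => //.
  by apply/seteqP; split.
- by apply/seteqP; split=> // x _; exists 0%N.
- by move=> _ [B [n [mB ->]]]; exact: m12.
Qed.

Definition shift (k : nat) (x : seqs) : seqs := fun i => x (k + i)%N.

(** Under two independent copies of the law this rebuilds one copy, which turns conditioning on the
    first [k] sites into Fubini's theorem. *)
Definition glue (k : nat) (xy : seqs * seqs) : seqs :=
  fun i => if (i < k)%N then xy.1 i else xy.2 (i - k)%N.

Lemma shift_glue k xy : shift k (glue k xy) = xy.2.
Proof. by apply/funext => i; rewrite /shift /glue ltnNge leq_addr/= addKn. Qed.

Lemma measurable_shift k : measurable_fun setT (shift k).
Proof. by apply: measurable_fun_seqs => i; exact: measurable_coord. Qed.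

Lemma measurable_glue k : measurable_fun setT (glue k).
Proof.
apply: measurable_fun_seqs => i; rewrite /glue; case: (i < k)%N.
  by apply: (measurableT_comp (measurable_coord i)); exact: measurable_fst.
by apply: (measurableT_comp (measurable_coord _)); exact: measurable_snd.
Qed.

End sequence_space.
Arguments seqs {d} X.

(** * Independence of past and shifted future, zero-one law *)

Section product_law.
Context {R : realType} {d : measure_display} {X : measurableType d}.
Variable P : probability X R.
Variable mu : probability (seqs X) R.
(** The i.i.d. law enters only through its values on cylinders; [mu] will be the image of the given
    probability space under the sample path. *)
Hypothesis hmu : forall A n, (forall i, measurable (A i)) ->
  mu (cyl A n) = (\prod_(i < n) P (A i))%E.

(** Both measures agree on cylinders: the preimage of a cylinder is a rectangle, with [minn n k]
    covering cylinders that stop before the cut. *)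
Lemma glue_law k (A : set (seqs X)) : measurable A ->
  ((mu \x mu) (glue k @^-1` A) = mu A)%E.
Proof.
move=> mA.
have mg := @measurable_glue _ X k.
rewrite -[LHS]/(pushforward (mu \x mu)%E (glue k) A).
apply: (seqs_measure_unique (m1 := [the measure _ _ of pushforward (mu \x mu)%E (glue k)])) => //=.
  rewrite /pushforward preimage_setT.
  rewrite -setXTT product_measure1E//= (_ : (_ * _)%E = 1%E) ?ltry//.
  by rewrite -[RHS]mule1; congr (_ * _)%E; exact: probability_setT.
move=> {mA}{}A n mA; rewrite /pushforward.
have -> : glue k @^-1` cyl A n =
    cyl A (minn n k) `*` cyl (fun i => A (k + i)%N) (n - k).
  apply/seteqP; split=> [[x y] h|[x y] [/= h1 h2] i ni].
    split=> i /= hi.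
      move: hi; rewrite leq_min => /andP[ni ki].
      by have := h i ni; rewrite /glue ki.
    have /h : (k + i < n)%N by rewrite -ltn_subRL.
    by rewrite /glue ltnNge leq_addr/= addKn.
  rewrite /glue/=; case: ltnP => ki; first by apply: h1; rewrite leq_min ni.
  have /h2 : (i - k < n - k)%N by rewrite ltn_sub2r// (leq_ltn_trans ki).
  by rewrite subnKC.
rewrite product_measure1E; [|exact: measurable_cyl|exact: measurable_cyl].
transitivity ((\prod_(i < minn n k) P (A i)) *
    (\prod_(i < n - k) P (A (k + i)%N)))%E.
  by congr (_ * _)%E; exact: hmu.
rewrite [RHS]hmu//; have [nk|kn] := leqP n k.
  by have /eqP -> : (n - k == 0)%N by []; rewrite big_ord0 mule1.
by rewrite -[in RHS](subnKC (ltnW kn)) big_split_ord.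
Qed.

(** Dependence on the first [k] coordinates, phrased pointwise so that sub-sigma-algebras do not
    appear. *)
Definition past_set k (C : set (seqs X)) :=
  forall x y : seqs X, (forall i, (i < k)%N -> x i = y i) -> C x -> C y.

Definition past_fun T k (F : seqs X -> T) :=
  forall x y : seqs X, (forall i, (i < k)%N -> x i = y i) -> F x = F y.

Lemma past_shift_indep k (C A : set (seqs X)) :
  measurable C -> measurable A -> past_set k C ->
  (mu (C `&` shift k @^-1` A) = mu C * mu A)%E.
Proof.
move=> mC mA pC.
have msA : measurable (shift k @^-1` A).
  by rewrite -[X in measurable X]setTI; exact: measurable_shift.
rewrite -(@glue_law k); last exact: measurableI.
rewrite -product_measure1E//; congr (_ _).
apply/seteqP; split=> [[x y] [/= Cg sg]|[x y] [/= Cx Ay]].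
  split => /=; last by move: sg; rewrite shift_glue.
  by apply: pC Cg => i ik; rewrite /glue ik.
split => /=; last by rewrite shift_glue.
by apply: pC Cx => i ik; rewrite /glue ik.
Qed.

(** Since [A] is its own preimage under [shift n], it is independent of every cylinder of length
    [n], hence of every measurable set, hence of itself: p = p^2. *)
Lemma zero_one_law (A : set (seqs X)) : measurable A ->
  (forall k, shift k @^-1` A = A) -> mu A = 0%E \/ mu A = 1%E.
Proof.
move=> mA sA.
have mAoo : mu A \is a fin_num.
  by apply: fin_num_measure.
have ind (B : set (seqs X)) : measurable B -> (mu (B `&` A) = mu A * mu B)%E.
  move=> mB; pose r := NngNum (fine_ge0 (measure_ge0 mu A)).
  transitivity (mscale r mu B); last by rewrite /mscale /= fineK.
  rewrite -[LHS]/(mrestr mu mA B).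
  apply: (seqs_measure_unique (m1 := [the measure _ _ of mrestr mu mA])) => //.
    by rewrite /= /mrestr setTI ltey_eq mAoo.
  move=> B' n mB'; rewrite /= /mrestr /mscale /= fineK//.
  rewrite -{1}(sA n) past_shift_indep//; [exact: muleC|exact: measurable_cyl|].
  by move=> x y xy h i ni; rewrite -xy//; exact: h.
have := ind A mA; rewrite setIid.
have -> : mu A = (fine (mu A))%:E by rewrite fineK.
rewrite -EFinM => -[h].
have : fine (mu A) * (fine (mu A) - 1) = 0 by rewrite mulrBr mulr1 -h subrr.
by move/eqP; rewrite mulf_eq0 subr_eq0 => /orP[] /eqP ->; [left|right].
Qed.

End product_law.

(** * Strong laws of large numbers for bounded variables *)

Lemma square_bracket (n : nat) : exists k, (k ^ 2 <= n < k.+1 ^ 2)%N.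
Proof.
elim: n => [|n [k /andP[h1 h2]]]; first by exists 0%N.
have [h|h] := ltnP n.+1 (k.+1 ^ 2); first by exists k; rewrite h ltnW.
exists k.+1; rewrite h/=; move: h1 h2 h; rewrite !expnS !expn0 !muln1 => h1 h2 h.
by nia.
Qed.

Section strong_law.
Context {R : realType}.

Lemma lipschitz_seq (a : nat -> R) (M : R) :
  (forall n, `|a n.+1 - a n| <= M) ->
  forall m n, (m <= n)%N -> `|a n - a m| <= M * (n - m)%:R.
Proof.
move=> aM m n mn; rewrite -(subnKC mn) addKn; elim: (n - m)%N => [|j IH].
  by rewrite addn0 subrr normr0 mulr0.
rewrite addnS -(subrKA (a (m + j)%N)) (le_trans (ler_normD _ _))//.
by rewrite -natr1 mulrDr mulr1 addrC lerD.
Qed.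

Definition tends0 (u : nat -> R) :=
  forall e : R, 0 < e -> exists N, forall n, (N <= n)%N -> `|u n| <= e.

Lemma tends0_cvg (u : nat -> R) : u @ \oo --> 0 -> tends0 u.
Proof.
move=> /cvgrPdist_le h e e0; have [N _ hN] := h e e0.
by exists N => n Nn; have := hN n Nn; rewrite /= sub0r normrN.
Qed.

Lemma cvg_tends0 (u : nat -> R) (l : R) :
  tends0 (fun n => u n - l) -> u @ \oo --> l.
Proof.
move=> h; apply/cvgrPdist_le => e e0; have [N hN] := h e e0.
by exists N => // n /= Nn; rewrite distrC; exact: hN.
Qed.

Lemma tends0_inv (c : R) : tends0 (fun n => c / n.+1%:R).
Proof.
apply: tends0_cvg; rewrite -(mulr0 c); apply: cvgMr; exact: cvg_harmonic.
Qed.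

(** Consecutive squares differ by O(k), negligible against k^2, and the increments of [a] are
    bounded by [M]. *)
Lemma tends0_subseq_square (a : nat -> R) (M : R) :
  (forall n, `|a n.+1 - a n| <= M) ->
  tends0 (fun k => a (k.+1 ^ 2)%N / (k.+1 ^ 2)%:R) ->
  tends0 (fun n => a n / n%:R).
Proof.
move=> aM h e e0.
have M0 : 0 <= M by exact: le_trans (normr_ge0 _) (aM 0%N).
have [N1 hN1] := h (e / 2) ltac:(lra).
have [N2 hN2] := tends0_inv (3 * M) (ltac:(lra) : 0 < e / 2).
exists ((maxn N1 N2).+1 ^ 2)%N => n hn.
have [[|k] /andP[k1 k2]] := square_bracket n.
  by exfalso; move: hn k2; rewrite !expnS !expn0 !muln1; nia.
have kN : (maxn N1 N2 <= k)%N.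
  by rewrite -ltnS -ltnS -(ltn_exp2r _ _ (e := 2))// (leq_ltn_trans hn).
move: (kN); rewrite geq_max => /andP[/hN1 {}hN1 /hN2 {}hN2].
set m := (k.+1 ^ 2)%N in k1 hN1.
have m0 : 0 < m%:R :> R by rewrite ltr0n expn_gt0.
have n0 : 0 < n%:R :> R by rewrite ltr0n (leq_trans _ k1)// expn_gt0.
have mn : m%:R <= n%:R :> R by rewrite ler_nat.
have k0 : 0 < k.+1%:R :> R by rewrite ltr0n.
(* The gap is below (k+2)^2 - (k+1)^2 = 2k + 3, hence at most 3 (k+1). *)
have hd : `|a n - a m| <= M * (3 * k.+1%:R).
  rewrite (le_trans (lipschitz_seq aM k1))// ler_wpM2l// -natrM ler_nat.
  by move: k2; rewrite /m !expnS !expn0 !muln1; nia.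
rewrite normrM normfV (gtr0_norm n0) ler_pdivrMr//.
have -> : a n = a m + (a n - a m) by rewrite addrC subrK.
rewrite (le_trans (ler_normD _ _))// [e](splitr) mulrDl lerD//.
  rewrite normrM normfV (gtr0_norm m0) ler_pdivrMr// in hN1.
  by rewrite (le_trans hN1)// ler_wpM2l//; lra.
rewrite (le_trans hd)//.
rewrite normrM normfV (gtr0_norm k0) ler_pdivrMr// ger0_norm ?mulr_ge0// in hN2.
have : 3 * M * k.+1%:R <= e / 2 * k.+1%:R * k.+1%:R by rewrite ler_wpM2r// ltW.
have : e / 2 * m%:R <= e / 2 * n%:R by rewrite ler_wpM2l//; lra.
rewrite /m natrX expr2 mulrA; lra.
Qed.

(** The correction -1/(n+1) is what closes the induction, by telescoping 1/(k+1)^2 <= 1/k -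
    1/(k+1). *)
Lemma sum_inv_square (n : nat) :
  \sum_(k < n.+1) (k.+1 ^ 2)%:R^-1 <= 2 - n.+1%:R^-1 :> R.
Proof.
elim: n => [|n IH]; first by rewrite big_ord_recr big_ord0/= invr1; lra.
rewrite big_ord_recr/= (le_trans (lerD IH (lexx _)))//.
rewrite natrX -(natr1 n.+1); set x : R := n.+1%:R.
have x0 : 0 < x by rewrite ltr0n.
rewrite -addrA lerD2l -subr_ge0.
have -> : - (x + 1)^-1 - (- x^-1 + (x + 1) ^- 2) = (x * (x + 1) ^+ 2)^-1.
  by field; rewrite !gt_eqF//; lra.
by rewrite invr_ge0 mulr_ge0 ?sqr_ge0// ltW.
Qed.

Context {d : measure_display} {X : measurableType d}.
Variable P : probability X R.

(** The sum of the [f k] has finite integral by monotone convergence, so it is finite almost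
    everywhere and its terms vanish; this takes the place of Borel-Cantelli. *)
Lemma ae_summable (f : nat -> X -> R) (c : R) :
  (forall k, bmeas (f k)) -> (forall k x, 0 <= f k x) ->
  (forall n, \sum_(k < n) Exp P (f k) <= c) ->
  {ae P, forall x, tends0 (f ^~ x)}.
Proof.
move=> bf f0 fc.
pose g x := (\sum_(k <oo) (f k x)%:E)%E.
have mf k : measurable_fun setT (fun x => (f k x)%:E).
  by apply/measurable_EFinP; have [] := bf k.
have mg : measurable_fun setT g.
  by apply: ge0_emeasurable_sum => // k x _ _; rewrite lee_fin.
have g0 x : (0 <= g x)%E by apply: nneseries_ge0 => k _ _; rewrite lee_fin.
have ig : P.-integrable setT g.
  apply/integrableP; split => //.
  under eq_integral do rewrite gee0_abs//.
  rewrite integral_nneseries//; last by move=> k x _; rewrite lee_fin.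
  apply: (@le_lt_trans _ _ c%:E); last exact: ltry.
  apply: lime_le.
    by apply: is_cvg_nneseries => k _ _; apply: integral_ge0 => x _; rewrite lee_fin.
  apply: nearW => n; rewrite big_mkord.
  under eq_bigr do rewrite Exp_EFin//.
  by rewrite sumEFin lee_fin.
apply: filterS (integrable_ae measurableT ig) => x /(_ I) gx.
apply: tends0_cvg; apply: cvg_series_cvg_0.
apply: nondecreasing_is_cvgn.
  apply/nondecreasing_seqP => n; rewrite /series/= big_nat_recr//=.
  by rewrite lerDl.
exists (fine (g x)) => _ [n _ <-]; rewrite /series/=.
rewrite -lee_fin fineK// -sumEFin.
by apply: nneseries_lim_ge => k _ _; rewrite lee_fin.
Qed.

(** Along N = (k+1)^2 the second moment of the average is at most C/(k+1)^2, which is summable;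
    between squares the bounded increments take over. *)
Lemma strong_law_of_variance (D : nat -> X -> R) (M C : R) :
  (forall n, measurable_fun setT (D n)) -> (forall n x, `|D n x| <= M) ->
  (forall N, Exp P (fun x => (\sum_(i < N) D i x) ^+ 2) <= C * N%:R) ->
  {ae P, forall x, tends0 (fun N => (\sum_(i < N) D i x) / N%:R)}.
Proof.
move=> mD DM hC.
have bD n : bmeas (D n) by split => //; exists M.
pose f k x := ((\sum_(i < k.+1 ^ 2) D i x) / (k.+1 ^ 2)%:R) ^+ 2.
have bS N : bmeas (fun x => \sum_(i < N) D i x) by exact: bmeas_sum.
have fE k x : f k x = ((k.+1 ^ 2)%:R ^+ 2)^-1 * (\sum_(i < k.+1 ^ 2) D i x) ^+ 2.
  by rewrite /f expr_div_n mulrC.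
have fEk k : f k = fun x => ((k.+1 ^ 2)%:R ^+ 2)^-1 * (\sum_(i < k.+1 ^ 2) D i x) ^+ 2.
  by apply/funext => x; exact: fE.
have bS2 N : bmeas (fun x => (\sum_(i < N) D i x) ^+ 2).
  by under eq_fun do rewrite expr2; exact: bmeasM.
have bf k : bmeas (f k).
  rewrite fEk.
  by apply: bmeasM => //; exact: bmeas_cst.
have C0 : 0 <= C.
  have := hC 1%N; rewrite mulr1; apply: le_trans.
  by apply: Exp_ge0 => x; exact: sqr_ge0.
have f0 k x : 0 <= f k x by exact: sqr_ge0.
have fc n : \sum_(k < n) Exp P (f k) <= C * 2.
  case: n => [|n]; first by rewrite big_ord0 mulr_ge0.
  apply: (@le_trans _ _ (C * \sum_(k < n.+1) (k.+1 ^ 2)%:R^-1)).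
    rewrite mulr_sumr; apply: ler_sum => k _.
    rewrite fEk.
    rewrite ExpZ//.
    have k0 : 0 < (k.+1 ^ 2)%:R :> R by rewrite ltr0n expn_gt0.
    rewrite mulrC ler_pdivrMr ?exprn_gt0// (le_trans (hC _))//.
    by rewrite expr2 mulrA divfK ?gt_eqF.
  by rewrite ler_wpM2l// (le_trans (sum_inv_square n))// gerBl// invr_ge0.
apply: filterS (ae_summable bf f0 fc) => x hx.
apply: (@tends0_subseq_square _ M).
  by move=> n; rewrite big_ord_recr/= addrAC subrr add0r.
(* [f k] is the square of the average, hence the threshold [e ^+ 2]. *)
move=> e e0; have [N hN] := hx (e ^+ 2) ltac:(by rewrite exprn_gt0).
exists N => n Nn; have := hN n Nn.
by rewrite /f normrX ler_sqr// nnegrE ltW.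
Qed.

(** For n = N this counts the earlier indices at distance less than [L] from [N]; a general [n]
    serves the induction. *)
Lemma window_count (N L n : nat) : (n <= N)%N ->
  (\sum_(i < n) (N < i + L) <= n + L - N)%N.
Proof.
elim: n => [|n IH] h; first by rewrite big_ord0.
rewrite big_ord_recr/=; have := IH (ltnW h).
move: (\sum_(i < n) (N < i + L))%N => s.
by case: (ltnP N (n + L)) => /=; lia.
Qed.

(** From N to N+1 the second moment grows by one diagonal term and twice at most [L] correlations,
    each bounded by M^2: hence the constant (2L+1) M^2. The condition [i < j] excludes the diagonal
    when L = 0. *)
Lemma strong_law_weak_dependence (D : nat -> X -> R) (M : R) (L : nat) :
  (forall n, measurable_fun setT (D n)) -> (forall n x, `|D n x| <= M) ->
  (forall i j, (i + L <= j)%N -> (i < j)%N ->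
     Exp P (fun x => D i x * D j x) = 0) ->
  {ae P, forall x, tends0 (fun N => (\sum_(i < N) D i x) / N%:R)}.
Proof.
move=> mD DM h.
have bD n : bmeas (D n) by split => //; exists M.
have bS N : bmeas (fun x => \sum_(i < N) D i x) by exact: bmeas_sum.
have DM2 i j x : `|D i x * D j x| <= M ^+ 2.
  by rewrite normrM expr2 ler_pM.
have M20 : 0 <= M ^+ 2 by exact: sqr_ge0.
apply: (strong_law_of_variance mD DM (C := (2 * L%:R + 1) * M ^+ 2)).
elim=> [|N IH].
  rewrite mulr0; under eq_fun do rewrite big_ord0 expr0n/=.
  by rewrite Exp_cst.
have -> : (fun x => (\sum_(i < N.+1) D i x) ^+ 2) = (fun x =>
    (\sum_(i < N) D i x) ^+ 2 +
    (2 * \sum_(i < N) (D i x * D N x) + D N x * D N x)).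
  by apply/funext => x; rewrite big_ord_recr/= -mulr_suml; ring.
have b1 : bmeas (fun x => (\sum_(i < N) D i x) ^+ 2).
  by under eq_fun do rewrite expr2; exact: bmeasM.
have b2 i : bmeas (fun x => D i x * D N x) by exact: bmeasM.
have b3 : bmeas (fun x => \sum_(i < N) (D i x * D N x)).
  exact: (bmeas_sum N b2).
rewrite ExpD//; last first.
  by apply: bmeasD => //; apply: bmeasM => //; exact: bmeas_cst.
rewrite ExpD//; last by apply: bmeasM => //; exact: bmeas_cst.
rewrite ExpZ// (Exp_sum _ _ b2).
have hN : Exp P (fun x => D N x * D N x) <= M ^+ 2.
  by rewrite (le_trans (ler_norm _))//; exact: Exp_le_norm.
have hs : \sum_(i < N) Exp P (fun x => D i x * D N x) <= L%:R * M ^+ 2.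
  apply: (@le_trans _ _ (\sum_(i < N) (N < i + L)%:R * M ^+ 2)).
    apply: ler_sum => i _; case: ltnP => iN.
      by rewrite mul1r (le_trans (ler_norm _))//; exact: Exp_le_norm.
    by rewrite h// mul0r.
  rewrite -mulr_suml ler_wpM2r// -natr_sum ler_nat.
  by rewrite (leq_trans (window_count L (leqnn N)))// addKn.
have -> : N.+1%:R = N%:R + 1 :> R by rewrite natr1.
by rewrite [leRHS]mulrDr mulr1; lra.
Qed.

End strong_law.

(** * Expectations under the sequence law *)

Lemma integral_image_law {R : realType} d1 d2 (Y : measurableType d1)
    (Z : measurableType d2) (m1 : {measure set Y -> \bar R})
    (m2 : probability Z R) (phi : Y -> Z) (f : Z -> R) :
  measurable_fun setT phi ->
  (forall A, measurable A -> m1 (phi @^-1` A) = m2 A) -> bmeas f ->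
  (m1.-integrable setT (EFin \o (f \o phi)) /\
  \int[m1]_y (f (phi y))%:E = (Exp m2 f)%:E)%E.
Proof.
move=> mphi h bf.
have mf : measurable_fun setT (EFin \o f) by apply/measurable_EFinP; case: bf.
have ip : m1.-integrable setT (EFin \o (f \o phi)).
  apply: measurable_bounded_integrable => //.
  - by rewrite -[setT](preimage_setT phi) h// probability_setT ltry.
  - by apply: measurableT_comp => //; case: bf.
  case: bf => _ [C hC]; exists C; split; first exact: num_real.
  by move=> y Cy x _ /=; apply: le_trans (hC _) _; rewrite ltW.
split=> //; rewrite -Exp_EFin//.
transitivity (\int[pushforward m1 phi]_z (f z)%:E)%E.
  by rewrite (@integral_pushforward _ _ _ _ _ phi mphi m1 setT (EFin \o f)).
apply: eq_measure_integral => A mA _; exact: h.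
Qed.

Section independence.
Context {R : realType} {d : measure_display} {X : measurableType d}.
Variable P : probability X R.
Variable mu : probability (seqs X) R.
Hypothesis hmu : forall A n, (forall i, measurable (A i)) ->
  mu (cyl A n) = (\prod_(i < n) P (A i))%E.

Lemma Exp_glue k (f : seqs X -> R) : bmeas f ->
  Exp mu f = Exp mu (fun x => Exp mu (fun y => f (glue k (x, y)))).
Proof.
move=> bf.
have [ig eg] := @integral_image_law _ _ _ _ _ (mu \x mu)%E mu (glue k) f
  (measurable_glue k) (glue_law hmu k) bf.
have := integral12_prod_meas1 ig; rewrite eg => /(congr1 fine) /= <-.
rewrite /Exp /Rintegral; congr fine; apply: eq_integral => x _.
rewrite /fubini_F -Exp_EFin//; split.
  apply: (measurableT_comp (f := f)); first by case: bf.
  apply: measurableT_comp; first exact: measurable_glue.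
  exact: measurable_pair1.
by case: bf => _ [C hC]; exists C => y; exact: hC.
Qed.

Lemma Exp_coord0 (g : X -> R) : bmeas g ->
  Exp mu (fun y : seqs X => g (y 0%N)) = Exp P g.
Proof.
move=> bg.
have [] := @integral_image_law _ _ _ _ _ mu P (fun y : seqs X => y 0%N) g
  (measurable_coord 0) _ bg.
  move=> A mA; have := @hmu (fun=> A) 1%N (fun=> mA).
  rewrite big_ord_recr big_ord0/= mul1e => <-.
  congr (mu _); apply/seteqP; split => y /=; last exact.
  by move=> h [].
by move=> _ h; rewrite /Exp /Rintegral h.
Qed.

Lemma Exp_past_shift k (F G : seqs X -> R) : bmeas F -> bmeas G ->
  past_fun k F -> Exp mu (fun x => F x * G (shift k x)) = Exp mu F * Exp mu G.
Proof.
move=> bF bG pF.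
rewrite (@Exp_glue k); last first.
  apply: bmeasM => //; split; last by case: bG => _ [C hC]; exists C.
  by apply: measurableT_comp; [case: bG|exact: measurable_shift].
transitivity (Exp mu (fun x => Exp mu G * F x)); last by rewrite ExpZ// mulrC.
apply: eq_Exp => x; rewrite mulrC -ExpZ//; apply: eq_Exp => y.
by rewrite shift_glue (pF _ x)// => i ik; rewrite /glue ik.
Qed.

Lemma bmeas_shift k (F : seqs X -> R) : bmeas F -> bmeas (fun x => F (shift k x)).
Proof.
move=> [mF [C hC]]; split; last by exists C.
by apply: measurableT_comp => //; exact: measurable_shift.
Qed.

Section martingale.
(** [phi n (x, s)] is the increment produced by a fresh letter [s] after the past [x]: taking [x n]
    for [s] gives the actual increment, integrating over [s] its conditional mean. *)
Variables (phi : nat -> seqs X * X -> R) (M : R).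
Hypothesis mphi : forall n, measurable_fun setT (phi n).
Hypothesis phiM : forall n xs, `|phi n xs| <= M.
Hypothesis phi_past : forall n s, past_fun n (fun x => phi n (x, s)).

Lemma bmeas_section n x : bmeas (fun s => phi n (x, s)).
Proof.
split; last by exists M.
by apply: measurableT_comp => //; exact: measurable_pair1.
Qed.

Lemma bmeas_mean n : bmeas (fun x => Exp P (fun s => phi n (x, s))).
Proof.
split; last by exists M => x; apply: Exp_le_norm => //; exact: bmeas_section.
have ii : ((mu \x P)%E).-integrable setT (EFin \o phi n).
  apply: measurable_bounded_integrable => //.
    rewrite /= -setXTT product_measure1E// (_ : (_ * _)%E = 1%E) ?ltry//.
    by rewrite -[RHS]mule1; congr (_ * _)%E; exact: probability_setT.
  exists M; split; first exact: num_real.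
  by move=> y My x _ /=; apply: le_trans (phiM _ _) _; rewrite ltW.
have := measurable_fubini_F ii.
rewrite (_ : fubini_F _ _ = EFin \o (fun x => Exp P (fun s => phi n (x, s)))).
  by move/measurable_EFinP.
by apply/funext => x; rewrite /fubini_F/= Exp_EFin//; exact: bmeas_section.
Qed.

(** Martingale differences are orthogonal: gluing at the later index [j] freezes the factor [D i],
    and integrating the letter at site [j] gives zero. This is weak dependence with L = 1. *)
Lemma strong_law_martingale :
  {ae mu, forall x : seqs X, tends0 (fun N =>
    (\sum_(i < N) (phi i (x, x i) - Exp P (fun s => phi i (x, s)))) / N%:R)}.
Proof.
pose D n (x : seqs X) := phi n (x, x n) - Exp P (fun s => phi n (x, s)).
have bc n : bmeas (fun x : seqs X => phi n (x, x n)).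
  split; last by exists M.
  apply: measurableT_comp => //; apply: measurable_fun_pair => //.
  exact: measurable_coord.
have bD n : bmeas (D n) by apply: bmeasB => //; exact: bmeas_mean.
apply: (@strong_law_weak_dependence _ _ _ mu D (M + M) 1) => [n|n x|i j _ ij].
- by case: (bD n).
- rewrite (le_trans (ler_normB _ _))// lerD//.
  by apply: Exp_le_norm => //; exact: bmeas_section.
rewrite (@Exp_glue j); last exact: bmeasM.
rewrite -[RHS](Exp_cst mu 0); apply: eq_Exp => x.
have agree y l : (l < j)%N -> glue j (x, y) l = x l.
  by move=> lj; rewrite /glue lj.
have -> : (fun y => D i (glue j (x, y)) * D j (glue j (x, y))) =
  (fun y : seqs X => D i x * (phi j (x, y 0%N) - Exp P (fun s => phi j (x, s)))).
  apply/funext => y; congr (_ * _); rewrite /D.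
    congr (_ - _).
      rewrite agree//; apply: (@phi_past i (x i)) => l li.
      by rewrite agree// (ltn_trans li).
    apply: eq_Exp => s; apply: phi_past => l li.
    by rewrite agree// (ltn_trans li).
  congr (_ - _).
    (* Site [j] is the first one taken from [y]. *)
    rewrite {2}/glue ltnn subnn/=.
    by apply: (@phi_past j (y 0%N)) => l lj; rewrite agree.
  by apply: eq_Exp => s; apply: phi_past => l li; rewrite agree.
have b0 : bmeas (fun y : seqs X => phi j (x, y 0%N)).
  split; last by exists M.
  apply: (measurableT_comp (f := fun s => phi j (x, s))); first by case: (bmeas_section j x).
  exact: measurable_coord.
rewrite ExpZ; last by apply: bmeasB => //; exact: bmeas_cst.
rewrite ExpB//; last exact: bmeas_cst.
rewrite Exp_cst (Exp_coord0 (bmeas_section j x)).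
by rewrite subrr mulr0.
Qed.

End martingale.
End independence.

(** * Subadditive ergodic theorem for i.i.d. sequences *)

Lemma shift0 d (X : measurableType d) (x : seqs X) : shift 0 x = x.
Proof. by apply/funext => i; rewrite /shift add0n. Qed.

Lemma shiftD d (X : measurableType d) i j (x : seqs X) :
  shift i (shift j x) = shift (j + i) x.
Proof. by apply/funext => l; rewrite /shift addnA. Qed.

Section kingman.
Context {R : realType} {d : measure_display} {X : measurableType d}.
Variable P : probability X R.
Variable mu : probability (seqs X) R.
Hypothesis hmu : forall A n, (forall i, measurable (A i)) ->
  mu (cyl A n) = (\prod_(i < n) P (A i))%E.
Variables (v : nat -> seqs X -> R) (M : R).
Hypothesis mv : forall n, measurable_fun setT (v n).
Hypothesis v_past : forall n, past_fun n (v n).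
Hypothesis v_ge0 : forall n x, 0 <= v n x.
Hypothesis v0M : forall x, v 0%N x <= M.
Hypothesis v1M : forall x, v 1%N x <= M.
Hypothesis vD : forall m n x, v (m + n)%N x <= v m x + v n (shift m x).
(** A partial converse of subadditivity: dropping the first letter raises [v] by at most [M]. For
    matrix products it holds because the first factor has a bounded inverse, and it makes [low_set]
    invariant. *)
Hypothesis v_shift : forall n x, v n (shift 1 x) <= v n.+1 x + M.

Let M0 : 0 <= M.
Proof. exact: le_trans (v_ge0 0%N point) (v0M point). Qed.

Lemma kingman_linear n x : v n x <= n%:R * M + M.
Proof.
elim: n x => [|n IH] x; first by rewrite mul0r add0r.
rewrite -add1n (le_trans (vD _ _ _))// natrD mulrDl mul1r -addrA lerD//.
Qed.

Lemma sum_shift_split (b : seqs X -> R) m n x :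
  \sum_(i < m + n) b (shift i x) =
  \sum_(i < m) b (shift i x) + \sum_(i < n) b (shift i (shift m x)).
Proof.
rewrite big_split_ord/=; congr (_ + _).
by apply: eq_bigr => i _; rewrite shiftD.
Qed.

(* Cut [0, N) greedily into blocks along which [v] grows at rate at most [t];
   only the sites counted by [b] escape. *)
Lemma greedy_cover (b : seqs X -> R) (t : R) (K : nat) : 0 <= t ->
  (forall x, 0 <= b x) ->
  (forall x, 1 <= b x \/ exists k, (0 < k <= K)%N /\ v k x <= k%:R * t) ->
  forall N x, v N x <= N%:R * t + M * (\sum_(i < N) b (shift i x)) + (K%:R * M + M).
Proof.
move=> t0 b0 hb N; elim/ltn_ind: N => N IH x.
have bs0 n (y : seqs X) : 0 <= \sum_(i < n) b (shift i y) by exact: sumr_ge0.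
have K0 : 0 <= K%:R * M + M by rewrite addr_ge0// mulr_ge0.
have N0 n : 0 <= n%:R * t by rewrite mulr_ge0.
case: N IH => [|N] IH.
  rewrite mul0r big_ord0 mulr0 !add0r (le_trans (v0M _))// lerDr.
  by rewrite mulr_ge0.
(* A bad site is crossed alone: its cost [v 1 x <= M] is paid by [M * b x]. *)
have [b1|[k [/andP[k0 kK] hk]]] := hb x.
  rewrite -add1n (le_trans (vD _ _ _))//.
  have := IH N (ltnSn N) (shift 1 x).
  rewrite add1n big_ord_recl/= shift0 -natr1.
  under [in leRHS]eq_bigr do rewrite shiftD.
  under [X in _ -> _ <= _ + M * (_ + X) + _]eq_bigr do rewrite /bump leq0n.
  have : M * 1 <= M * b x by rewrite ler_wpM2l.
  have := v1M x; move: (\sum_(i < N) _) => S.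
  by rewrite mulrDl mul1r; lra.
(* If the block overshoots the end, fewer than [K] sites remain, and the linear bound on them is the
   additive term K M + M. *)
have [kN|Nk] := leqP k N.+1; last first.
  rewrite (le_trans (kingman_linear _ _))//.
  have : N.+1%:R * M <= K%:R * M by rewrite ler_wpM2r// ler_nat (leq_trans (ltnW Nk)).
  have := N0 N.+1; have := mulr_ge0 M0 (bs0 N.+1 x); lra.
have := vD k (N.+1 - k) x; rewrite subnKC// => /le_trans; apply.
have hlt : (N.+1 - k < N.+1)%N by rewrite ltn_subrL k0.
have := IH _ hlt (shift k x).
have -> : \sum_(i < N.+1) b (shift i x) = \sum_(i < k) b (shift i x) +
    \sum_(i < N.+1 - k) b (shift i (shift k x)).
  by rewrite -sum_shift_split subnKC.
rewrite natrB// mulrBl mulrDr; have := mulr_ge0 M0 (bs0 k x); lra.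
Qed.

(* Unlike [liminf v n / n < t], this condition is invariant under the shift on
   the nose, because the shift changes [v] by a bounded amount only. *)
Definition low_set (t : R) : set (seqs X) :=
  [set x | forall K : nat, exists n, v n x < n%:R * t - K%:R].

Lemma measurable_low_set t : measurable (low_set t).
Proof.
have -> : low_set t = \bigcap_K \bigcup_n [set x | v n x < n%:R * t - K%:R].
  apply/seteqP; split => x h.
    by move=> K _; have [n hn] := h K; exists n.
  by move=> K; have [n _ hn] := h K I; exists n.
apply: bigcap_measurableType => K _; apply: bigcup_measurable => n _.
rewrite -[X in measurable X]setTI.
exact: (measurable_fun_ltr (mv n) (measurable_cst _)).
Qed.

Lemma low_set_shift1 t x : low_set t (shift 1 x) <-> low_set t x.
Proof.
split => h K.
  (* The extra slack pays for the first letter ([M]) and for replacing n by n + 1 (the absolute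
     value of [t]). *)
  have [n hn] := h (K + Num.bound (M + `|t|))%N; exists n.+1.
  rewrite -add1n (le_lt_trans (vD _ _ _))// add1n.
  have := archi_boundP (addr_ge0 M0 (normr_ge0 t)).
  have := v1M x; move: hn; rewrite natrD -natr1 mulrDl mul1r.
  by have := ler_norm (- t); rewrite normrN; lra.
have [n hn] := h (K + Num.bound (M + `|t|))%N.
have hB := archi_boundP (addr_ge0 M0 (normr_ge0 t)).
case: n hn => [|n].
  rewrite mul0r sub0r => hn; exfalso.
  have := v_ge0 0%N x; have := ler0n R (K + Num.bound (M + `|t|)); lra.
rewrite natrD -natr1 mulrDl mul1r => hn; exists n.
by have := v_shift n x; have := ler_norm t; lra.
Qed.

Lemma low_set_shift t k : shift k @^-1` low_set t = low_set t.
Proof.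
elim: k => [|k IH]; first by apply/seteqP; split=> x; rewrite /= shift0.
rewrite -[RHS]IH; apply/seteqP; split=> x /=; rewrite -addn1 -shiftD;
by rewrite low_set_shift1.
Qed.

Lemma low_set_mono t t' : t <= t' -> low_set t `<=` low_set t'.
Proof.
move=> tt x h K; have [n hn] := h K; exists n; apply: (lt_le_trans hn).
by rewrite lerD2r ler_wpM2l.
Qed.

Lemma low_set_negative t : t < 0 -> low_set t = set0.
Proof.
move=> t0; apply/seteqP; split=> // x /(_ 0%N) [n]; rewrite subr0 => h.
suff : False by [].
have := v_ge0 n x; have : n%:R * t <= 0 by rewrite mulr_ge0_le0// ltW.
by lra.
Qed.

(** By the zero-one law each [low_set t] has measure 0 or 1, and it grows with [t]; the infimum is
    the threshold rate. *)
Definition growth : R := inf [set t | mu (low_set t) = 1%E].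

Lemma growth_set_has_inf : has_inf [set t | mu (low_set t) = 1%E].
Proof.
split.
  (* At rate [M] the linear bound on [v] misses the level -K by a constant; the extra 1 supplies the
     slack n. *)
  exists (M + 1) => /=; rewrite (_ : low_set _ = setT) ?probability_setT//.
  apply/seteqP; split=> // x _ K.
  have hB := archi_boundP M0.
  exists (K + Num.bound M).+1; apply: (le_lt_trans (kingman_linear _ _)).
  by rewrite mulrDr mulr1 -[in ltRHS]natr1 natrD; lra.
exists 0 => t /= ht; rewrite leNgt; apply/negP => t0.
by move: ht; rewrite low_set_negative// measure0 => -[] /esym/eqP; rewrite oner_eq0.
Qed.

Lemma growth_ge0 : 0 <= growth.
Proof.
apply: lb_le_inf; first by case: growth_set_has_inf.
move=> t /= ht; rewrite leNgt; apply/negP => t0.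
by move: ht; rewrite low_set_negative// measure0 => -[] /esym/eqP; rewrite oner_eq0.
Qed.

Lemma low_set_full t : growth < t -> mu (low_set t) = 1%E.
Proof.
move=> gt; have [s /= hs st] := inf_lt (proj1 growth_set_has_inf) gt.
apply/eqP; rewrite eq_le probability_le1; last exact: measurable_low_set.
rewrite -hs le_measure// ?inE; try exact: measurable_low_set.
exact/low_set_mono/ltW.
Qed.

Lemma low_set_null t : t < growth -> mu (low_set t) = 0%E.
Proof.
move=> tg; have [//|h] := zero_one_law hmu (measurable_low_set t) (low_set_shift t).
have : growth <= t by apply: ge_inf => //; case: growth_set_has_inf.
by rewrite leNgt tg.
Qed.

(** Outside the null set [low_set (growth - e / 2)], [v n x] stays above the line n (growth - e/2) -
    K for some K, and K/n dies out. *)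
Lemma kingman_lower (e : R) : 0 < e ->
  {ae mu, forall x, exists N, forall n, (N <= n)%N -> growth - e <= v n x / n%:R}.
Proof.
move=> e0; exists (low_set (growth - e / 2)); split.
- exact: measurable_low_set.
- by apply: low_set_null; lra.
move=> x /= h; apply: contrapT => nl; apply: h.
have [K hK] : exists K : nat, forall n, n%:R * (growth - e / 2) - K%:R <= v n x.
  apply: contrapT => hn; apply: nl => K; apply: contrapT => hK; apply: hn.
  exists K => n; rewrite leNgt; apply/negP => hlt; apply: hK; by exists n.
have [N hN] := tends0_inv (K%:R) (ltac:(lra) : 0 < e / 2).
exists N.+1 => -[//|n] Nn.
have n0 : 0 < n.+1%:R :> R by rewrite ltr0n.
rewrite ler_pdivlMr// (le_trans _ (hK n.+1))//.
have := hN n Nn; rewrite ger0_norm ?divr_ge0//.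
by rewrite ler_pdivrMr//; lra.
Qed.

(** The points without a block of length at most [K] and rate [t] form sets decreasing in [K] whose
    intersection misses [low_set t], a set of full measure. Membership is decided by the first [K]
    letters, as a finite range strong law requires. *)
Lemma bad_set_small (t e : R) : growth < t -> 0 < e -> exists K : nat, exists B : set (seqs X),
  [/\ measurable B, fine (mu B) <= e, past_fun K (\1_B : seqs X -> R) &
   forall x, B x \/ exists k, (0 < k <= K)%N /\ v k x <= k%:R * t].
Proof.
move=> gt e0.
pose B K : set (seqs X) := [set x | forall k, (0 < k <= K)%N -> k%:R * t < v k x].
have mB K : measurable (B K).
  have -> : B K = \bigcap_(k in [set k | (0 < k <= K)%N]) [set x | k%:R * t < v k x].
    by apply/seteqP; split.
  apply: bigcap_measurableType => k _; rewrite -[X in measurable X]setTI.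
  exact: (measurable_fun_ltr (measurable_cst _) (mv k)).
have dB : nonincreasing_seq B.
  move=> m n mn; apply/subsetPset => x h k /andP[k0 km].
  by apply: h; rewrite k0 (leq_trans km).
have cB : mu \o B @ \oo --> mu (\bigcap_n B n).
  apply: nonincreasing_cvg_mu => //; last exact: bigcapT_measurable.
  by rewrite (le_lt_trans (probability_le1 mu (mB _)))// ltry.
have B0 : mu (\bigcap_n B n) = 0%E.
  apply/eqP; rewrite eq_le measure_ge0 andbT.
  have <- : mu (~` low_set t) = 0%E.
    rewrite probability_setC ?low_set_full ?subee//; exact: measurable_low_set.
  apply: le_measure; rewrite ?inE.
  - exact: bigcapT_measurable.
  - by apply: measurableC; exact: measurable_low_set.
  (* Level 0 of [low_set] supplies some n with v n x < n t, and nonnegativity of [v] excludes n =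
     0. *)
  move=> x hx /(_ 0%N) [[|n]]; rewrite subr0.
    by rewrite mul0r ltNge v_ge0.
  by have := hx n.+1 I n.+1; rewrite leqnn => /(_ isT) h1 h2; lra.
rewrite B0 in cB.
have /fine_cvgP[_ /cvgrPdist_le /(_ e e0) [K _ hK]] := cB.
exists K, (B K); split => //.
- have := hK K (leqnn K); rewrite /= sub0r normrN ger0_norm//.
  by rewrite fine_ge0.
- move=> x y xy; rewrite !indicE; congr (nat_of_bool _)%:R.
  have vE k : (k <= K)%N -> v k x = v k y.
    by move=> kK; apply: v_past => i ik; apply: xy; rewrite (leq_trans ik).
  apply/idP/idP; rewrite !inE => h k /[dup] /andP[_ kK] /h; by rewrite vE.
move=> x; have [?|nB] := pselect (B K x); [by left|right].
apply: contrapT => h; apply: nB => k kK.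
by rewrite ltNge; apply/negP => hle; apply: h; exists k.
Qed.

(** The greedy covering loses [M] per bad site, and by the strong law bad sites have asymptotic
    frequency [mu B]. *)
Lemma kingman_upper (e : R) : 0 < e ->
  {ae mu, forall x, exists N, forall n, (N <= n)%N -> v n x / n%:R <= growth + e}.
Proof.
move=> e0; pose t := growth + e / 4.
have t0 : 0 <= t by rewrite /t; have := growth_ge0; lra.
(* Budget: e/4 from [t], e/2 from bad sites, e/4 from the boundary term. The bad frequency may reach
   twice this constant, half for [mu B] and half for its fluctuation; [M + 1] avoids dividing by
   0. *)
have e'0 : 0 < e / (4 * (M + 1)) by rewrite divr_gt0// mulr_gt0//; have := M0; lra.
have [K [B [mB muB pB hB]]] := bad_set_small (ltac:(rewrite /t; lra) : growth < t) e'0.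
pose p := fine (mu B).
pose f (x : seqs X) : R := \1_B x - p.
have bf : bmeas f by apply: bmeasB; [exact: bmeas_indic|exact: bmeas_cst].
have Ef : Exp mu f = 0.
  by rewrite ExpB ?Exp_indic ?Exp_cst ?subrr//; [exact: bmeas_indic|exact: bmeas_cst].
have p0 : 0 <= p by exact: fine_ge0.
have I0 x : 0 <= \1_B x :> R by rewrite indicE.
have I1 x : \1_B x <= 1 :> R by rewrite indicE; case: (_ \in _).
have p1 : p <= 1.
  by rewrite /p -Exp_indic// -(Exp_cst mu 1); apply: le_Exp => //; [exact: bmeas_indic|exact: bmeas_cst].
have fM x : `|f x| <= 1.
  by rewrite ler_norml /f; have := I0 x; have := I1 x; move=> *; apply/andP; split; lra.
have pf : past_fun K f by move=> x y xy; rewrite /f (pB x y xy).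
have hSL : {ae mu, forall x : seqs X, tends0 (fun N => (\sum_(i < N) f (shift i x)) / N%:R)}.
  apply: (@strong_law_weak_dependence _ _ _ mu (fun i x => f (shift i x)) 1 K) => [n|n x|i j ij _].
  - by case: (bmeas_shift n bf).
  - exact: fM.
  have -> : (fun x => f (shift i x) * f (shift j x)) =
     (fun x => (fun y => f (shift i y)) x * f (shift j x)) by [].
  rewrite (Exp_past_shift hmu (k := j)) ?Ef ?mulr0//; first exact: bmeas_shift.
  move=> x y xy; apply: pf => l lK; rewrite /shift xy//.
  by rewrite (leq_trans _ ij)// ltn_add2l.
apply: filterS hSL => x hx.
have e4 : 0 < e / (4 * (M + 1)) by [].
have [N1 hN1] := hx _ e4.
have [N2 hN2] := tends0_inv (K%:R * M + M) (ltac:(lra) : 0 < e / 4).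
exists (maxn N1 N2).+1 => -[//|n] Nn.
have n0 : 0 < n.+1%:R :> R by rewrite ltr0n.
rewrite ler_pdivrMr//.
have hb (y : seqs X) : 1 <= \1_B y :> R \/ exists k, (0 < k <= K)%N /\ v k y <= k%:R * t.
  by case: (hB y) => [By|?]; [left; rewrite indicE mem_set|right].
apply: (le_trans (greedy_cover t0 I0 hb n.+1 x)).
move: Nn; rewrite ltnS geq_max => /andP[/leqW/hN1 h1 /hN2 h2].
move: h2; rewrite normrM normfV ger0_norm; last by rewrite addr_ge0// mulr_ge0// M0.
rewrite ger0_norm ?ler_pdivrMr//.
move: h1; rewrite normrM normfV [X in _ / X]ger0_norm ?ler_pdivrMr//.
move=> /(le_trans (ler_norm _)).
rewrite big_split/= sumr_const card_ord => h1 h2.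
set S := \sum_(i < n.+1) \1_B (shift i x) in h1 *.
have hS : S <= (e / (4 * (M + 1)) + p) * n.+1%:R.
  by rewrite mulrDl; move: h1; rewrite -mulr_natr; lra.
have hM : M * (e / (4 * (M + 1)) + p) <= e / 2.
  apply: (@le_trans _ _ ((M + 1) * (e / (4 * (M + 1)) + e / (4 * (M + 1))))).
    by apply: ler_pM; [exact: M0|rewrite addr_ge0// ltW|rewrite lerDl|rewrite lerD].
  have := M0 => M0'.
  have -> : (M + 1) * (e / (4 * (M + 1)) + e / (4 * (M + 1))) = e / 2.
    by field; lra.
  exact: lexx.
have h3 : M * S <= e / 2 * n.+1%:R.
  apply: (@le_trans _ _ (M * ((e / (4 * (M + 1)) + p) * n.+1%:R))).
    by rewrite ler_wpM2l// M0.
  by rewrite mulrA ler_wpM2r// ltW.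
by rewrite /t; lra.
Qed.

Theorem kingman : exists t : R, {ae mu, forall x, v n x / n%:R @[n --> \oo] --> t}.
Proof.
exists growth.
(* Countably many tolerances 1/(m+1) keep the union of the exceptional sets null. *)
have hl : {ae mu, forall x, forall m : nat, exists N, forall n, (N <= n)%N ->
    growth - m.+1%:R^-1 <= v n x / n%:R}.
  by apply: ae_foralln => m; apply: kingman_lower; rewrite invr_gt0.
have hu : {ae mu, forall x, forall m : nat, exists N, forall n, (N <= n)%N ->
    v n x / n%:R <= growth + m.+1%:R^-1}.
  by apply: ae_foralln => m; apply: kingman_upper; rewrite invr_gt0.
apply: filterS2 hl hu => x hl hu; apply: cvg_tends0 => e e0.
have [m hm] := tends0_inv 1 e0.
have := hm m (leqnn m); rewrite div1r ger0_norm ?invr_ge0// => me.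
have [N1 h1] := hl m; have [N2 h2] := hu m.
exists (maxn N1 N2) => n; rewrite geq_max => /andP[/h1 {}h1 /h2 {}h2].
move: h1 h2 me; move: (v n x / _) (m.+1%:R^-1) => a c *.
by rewrite ler_norml; apply/andP; split; lra.
Qed.

End kingman.

(** * Complex modulus and phases *)

Section modulus.
Context {R : realType}.
Local Notation C := (Cx R).
Implicit Types z w : C.

Lemma modCE z : modC z = Normc.normc z.
Proof. by case: z. Qed.

Lemma modC_ge0 z : 0 <= modC z.
Proof. exact: sqrtr_ge0. Qed.

Lemma modC_sq z : modC z ^+ 2 = reC z ^+ 2 + imC z ^+ 2.
Proof. by rewrite sqr_sqrtr// addr_ge0// sqr_ge0. Qed.

Lemma modCM z w : modC (z * w) = modC z * modC w.
Proof. by rewrite !modCE Normc.normcM. Qed.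

Lemma modCD z w : modC (z + w) <= modC z + modC w.
Proof. by rewrite !modCE le_normcD. Qed.

Lemma modCN z : modC (- z) = modC z.
Proof. by rewrite !modCE normcN. Qed.

Lemma modCB z w : modC (z - w) <= modC z + modC w.
Proof. by rewrite -(modCN w) modCD. Qed.

Lemma modC_dist z w : modC (z - w) = modC (w - z).
Proof. by rewrite -modCN opprB. Qed.

Lemma modCV z : modC z^-1 = (modC z)^-1.
Proof. by rewrite !modCE Normc.normcV. Qed.

Lemma modC0 : modC (0 : C) = 0.
Proof. by rewrite modCE Normc.normc0. Qed.

Lemma modC1 : modC (1 : C) = 1.
Proof. by rewrite modCE Normc.normc1. Qed.

Lemma modC_eq0 z : modC z = 0 -> z = 0.
Proof. by rewrite modCE; exact: Normc.eq0_normc. Qed.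

Lemma modC_gt0 z : (0 < modC z) = (z != 0).
Proof.
rewrite lt_def modC_ge0 andbT; congr (~~ _).
by apply/eqP/eqP => [/modC_eq0|->] //; exact: modC0.
Qed.

Lemma modC_cR (x : R) : modC (cR x) = `|x|.
Proof. by rewrite /modC /= expr0n/= addr0 sqrtr_sqr. Qed.

Lemma modC_cI : modC (cI : C) = 1.
Proof. by rewrite /modC /= expr0n/= add0r expr1n sqrtr1. Qed.

Lemma modC_conj z : modC (Num.conj z) = modC z.
Proof. by case: z => a b; rewrite /modC /= sqrrN. Qed.

Lemma re_le_modC z : `|reC z| <= modC z.
Proof. by rewrite -sqrtr_sqr ler_sqrt ?addr_ge0 ?sqr_ge0// lerDl sqr_ge0. Qed.

Lemma im_le_modC z : `|imC z| <= modC z.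
Proof. by rewrite -sqrtr_sqr ler_sqrt ?addr_ge0 ?sqr_ge0// lerDr sqr_ge0. Qed.

Lemma modC_le_reim z : modC z <= `|reC z| + `|imC z|.
Proof.
rewrite -ler_sqr ?nnegrE ?modC_ge0 ?addr_ge0// modC_sq.
rewrite sqrrD !real_normK ?num_real// lerD2r lerDl.
by rewrite mulrn_wge0// mulr_ge0.
Qed.

Lemma reCD z w : reC (z + w) = reC z + reC w. Proof. by case: z; case: w. Qed.
Lemma imCD z w : imC (z + w) = imC z + imC w. Proof. by case: z; case: w. Qed.
Lemma reCN z : reC (- z) = - reC z. Proof. by case: z. Qed.
Lemma imCN z : imC (- z) = - imC z. Proof. by case: z. Qed.
Lemma reCM z w : reC (z * w) = reC z * reC w - imC z * imC w.
Proof. by case: z; case: w. Qed.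
Lemma imCM z w : imC (z * w) = reC z * imC w + imC z * reC w.
Proof. by case: z => a b; case: w. Qed.
Lemma reC_cR (x : R) : reC (cR x) = x. Proof. by []. Qed.
Lemma imC_cR (x : R) : imC (cR x) = 0. Proof. by []. Qed.
Lemma reC_conj z : reC (Num.conj z) = reC z. Proof. by case: z. Qed.
Lemma imC_conj z : imC (Num.conj z) = - imC z. Proof. by case: z. Qed.

Lemma complex_ext z w : reC z = reC w -> imC z = imC w -> z = w.
Proof. by case: z => a b; case: w => a' b' /= -> ->. Qed.

Lemma cRD (x y : R) : cR (x + y) = cR x + cR y.
Proof. by apply: complex_ext; rewrite ?reCD ?imCD /= ?addr0. Qed.
Lemma cRM (x y : R) : cR (x * y) = cR x * cR y.
Proof. by apply: complex_ext; rewrite ?reCM ?imCM /= ?mulr0 ?mul0r ?subr0 ?addr0. Qed.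
Lemma cRN (x : R) : cR (- x) = - cR x.
Proof. by apply: complex_ext; rewrite ?reCN ?imCN /= ?oppr0. Qed.
Lemma modC_expi (x : R) : modC (expi x) = 1.
Proof.
rewrite /modC (_ : _ + _ = 1) ?sqrtr1//.
rewrite /expi reCD imCD !reCM !imCM /=.
by rewrite !mul0r !mulr0 mul1r subr0 !add0r addr0 cos2Dsin2.
Qed.

Lemma expiD (x y : R) : expi (x + y) = expi x * expi y.
Proof.
apply: complex_ext; rewrite /expi ?(reCM, imCM, reCD, imCD) /= ?cosD ?sinD; ring.
Qed.

Lemma expi0 : expi 0 = 1 :> C.
Proof. by apply: complex_ext; rewrite /expi ?(reCM, imCM, reCD, imCD) /= ?cos0 ?sin0; ring. Qed.

Lemma expiN (x : R) : expi x * expi (- x) = 1.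
Proof. by rewrite -expiD subrr expi0. Qed.

End modulus.

(* Weighted asymptotic scale: [e] has weight 1 and [dl] has weight 2, and
   everything of weight at least 3 is absorbed in the error term. *)
Section weights.
Context {R : realType}.
Local Notation C := (Cx R).

Definition weight (e dl : R) (k : nat) : R :=
  match k with
  | 0 => 1
  | 1 => `|e| + dl
  | 2 => e ^+ 2 + dl
  | _ => `|e| ^+ 3 + `|e| * dl + dl ^+ 2
  end.

Definition unit_range (e dl : R) := `|e| <= 1 /\ 0 <= dl <= 1.

Variables e dl : R.
Hypothesis ed : unit_range e dl.

Let a : R := `|e|.
Let ad : [/\ 0 <= a, a <= 1, 0 <= dl & dl <= 1].
Proof. by case: ed => a1 /andP[d0 d1]; split=> //; exact: normr_ge0. Qed.
Let e2 : e ^+ 2 = a ^+ 2. Proof. by rewrite /a real_normK ?num_real. Qed.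

Let powers : [/\ [/\ 0 <= a ^+ 2, 0 <= a ^+ 3, 0 <= dl ^+ 2 & 0 <= a * dl],
  [/\ a ^+ 2 <= a, a ^+ 3 <= a ^+ 2 & a ^+ 4 <= a ^+ 3] &
  [/\ dl ^+ 2 <= dl, a * dl <= dl & a ^+ 2 * dl <= a * dl]].
Proof.
have [a0 a1 d0 d1] := ad; have aa : a ^+ 2 <= a by rewrite expr2 ler_piMl.
split; split; rewrite ?sqr_ge0 ?exprn_ge0 ?mulr_ge0//.
- by rewrite exprS ler_piMl ?sqr_ge0.
- by rewrite exprS ler_piMl ?exprn_ge0.
- by rewrite expr2 ler_piMl.
- by rewrite ler_piMl.
- by rewrite ler_wpM2r.
Qed.

Lemma weight_ge0 k : 0 <= weight e dl k.
Proof.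
have [a0 a1 d0 d1] := ad.
by case: k => [|[|[|k]]] //=; rewrite ?addr_ge0 ?sqr_ge0 ?exprn_ge0 ?mulr_ge0.
Qed.

Lemma weight_step k : weight e dl k.+1 <= 2 * weight e dl k.
Proof.
have [a0 a1 d0 d1] := ad; have [[p1 p2 p3 p4] [p5 p6 p7] [p8 p9 p10]] := powers.
case: k => [|[|[|k]]] /=; rewrite ?e2 -/a.
- by lra.
- by lra.
- by lra.
have := weight_ge0 3; rewrite /= -/a; lra.
Qed.

Lemma weight_le j k : (j <= k)%N -> weight e dl k <= 8 * weight e dl j.
Proof.
have w k' : 0 <= weight e dl k' by exact: weight_ge0.
have s := weight_step.
move=> jk; have w3 k' : weight e dl k'.+3 = weight e dl 3 by [].
have := w 0%N; have := w 1%N; have := w 2%N; have := w 3%N.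
have := s 0%N; have := s 1%N; have := s 2%N.
case: j jk => [|[|[|j]]]; case: k => [|[|[|k]]] // _;
  rewrite ?(w3 k) ?(w3 j); lra.
Qed.

Let weightM_le j k : (j <= k)%N ->
  weight e dl j * weight e dl k <= 4 * weight e dl (j + k).
Proof.
have w k' : 0 <= weight e dl k' by exact: weight_ge0.
have [a0 a1 d0 d1] := ad; have [[p1 p2 p3 p4] [p5 p6 p7] [p8 p9 p10]] := powers.
case: j => [|[|[|j]]].
- by move=> _; rewrite add0n mul1r ler_peMl// ler1n.
- case: k => [|[|[|k]]] // _.
  + rewrite /= e2 -/a (_ : (a + dl) * (a + dl) = a ^+ 2 + 2 * (a * dl) + dl ^+ 2); last by ring.
    by lra.
  + rewrite /= e2 -/a (_ : (a + dl) * (a ^+ 2 + dl) = a ^+ 3 + a * dl + a ^+ 2 * dl + dl ^+ 2); last by ring.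
    by lra.
  + have := w 3%N; rewrite /= -/a; set W := (_ + _ + _) => W0.
    by rewrite ler_wpM2r//; lra.
- case: k => [|[|[|k]]] // _.
  + rewrite /= e2 -/a (_ : (a ^+ 2 + dl) * (a ^+ 2 + dl) = a ^+ 4 + 2 * (a ^+ 2 * dl) + dl ^+ 2); last by ring.
    by lra.
  + have := w 3%N; rewrite /= e2 -/a; set W := (_ + _ + _) => W0.
    by rewrite ler_wpM2r//; lra.
case: k => [|[|[|k]]] // _.
have := w 3%N; rewrite /= -/a; set W := (_ + _ + _) => W0.
by rewrite ler_wpM2r// /W; lra.
Qed.

(** Multiplying costs a factor 4, and lowering the total weight j + k to l costs at most 2^3. *)
Lemma weightM j k l : (l <= j + k)%N ->
  weight e dl j * weight e dl k <= 32 * weight e dl l.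
Proof.
move=> ljk; have := weight_le ljk.
have [jk|/ltnW kj] := leqP j k; first by have := weightM_le jk; lra.
by rewrite mulrC; have := weightM_le kj; rewrite addnC; lra.
Qed.

End weights.

(** * Uniform error terms on the weighted scale *)

Section bigO.
Context {R : realType} {I : Type}.
Local Notation C := (Cx R).
Variables (D : set I) (e dl : I -> R).
Implicit Types f g : I -> C.

(** One constant serves all of [D]. Since the index will contain eps, delta, sigma and z at once,
    every estimate is automatically uniform in the random data and in the point of the disc. *)
Definition wO (k : nat) f :=
  exists K : R, 0 <= K /\ forall i, D i -> modC (f i) <= K * weight (e i) (dl i) k.

Lemma wO_eq k f g : (forall i, D i -> f i = g i) -> wO k f -> wO k g.
Proof.
by move=> fg [K [K0 h]]; exists K; split=> // i Di; rewrite -fg// h.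
Qed.

Lemma wO_le k f g : wO k g -> (forall i, D i -> modC (f i) <= modC (g i)) -> wO k f.
Proof.
by move=> [K [K0 h]] fg; exists K; split=> // i Di; exact: le_trans (fg _ Di) (h _ Di).
Qed.

Lemma wOD k f g : wO k f -> wO k g -> wO k (fun i => f i + g i).
Proof.
move=> [K [K0 hK]] [L [L0 hL]]; exists (K + L); split; first exact: addr_ge0.
by move=> i Di; rewrite (le_trans (modCD _ _))// mulrDl lerD ?hK ?hL.
Qed.

Lemma wON k f : wO k f -> wO k (fun i => - f i).
Proof. by move=> h; apply: wO_le h _ => i _; rewrite modCN. Qed.

Lemma wOB k f g : wO k f -> wO k g -> wO k (fun i => f i - g i).
Proof. by move=> hf hg; apply: wOD => //; exact: wON. Qed.

Lemma wO_bounded f (K : R) : (forall i, D i -> modC (f i) <= K) -> wO 0 f.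
Proof.
move=> h; exists `|K|; split=> // i Di; rewrite mulr1.
exact: le_trans (h i Di) (ler_norm K).
Qed.

Lemma wO_cst (c : C) : wO 0 (fun=> c).
Proof. exact: (@wO_bounded _ (modC c)). Qed.

Hypothesis small : forall i, D i -> unit_range (e i) (dl i).

Lemma wO_weaken j k f : (j <= k)%N -> wO k f -> wO j f.
Proof.
move=> jk [K [K0 h]]; exists (K * 8); split; first exact: mulr_ge0.
move=> i Di; rewrite (le_trans (h i Di))// -mulrA ler_wpM2l//.
exact: weight_le (small Di) _ _ jk.
Qed.

Lemma wOM j k l f g : (l <= j + k)%N -> wO j f -> wO k g ->
  wO l (fun i => f i * g i).
Proof.
move=> ljk [K [K0 hK]] [L [L0 hL]]; exists (K * L * 32).
split; first by rewrite !mulr_ge0.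
move=> i Di; rewrite modCM.
apply: (@le_trans _ _ ((K * weight (e i) (dl i) j) * (L * weight (e i) (dl i) k))).
  by rewrite ler_pM ?modC_ge0 ?hK ?hL.
rewrite mulrACA -[in leRHS]mulrA ler_wpM2l ?mulr_ge0//.
exact: weightM (small Di) _ _ _ ljk.
Qed.

Lemma wO_e : wO 1 (fun i => cR (e i)).
Proof.
exists 1; split=> // i /small[_ /andP[d0 _]]; rewrite modC_cR mul1r /=.
by rewrite lerDl.
Qed.

Lemma wO_dl : wO 2 (fun i => cR (dl i)).
Proof.
exists 1; split=> // i /small[_ /andP[d0 _]]; rewrite modC_cR mul1r /=.
by rewrite ger0_norm// lerDr sqr_ge0.
Qed.

End bigO.

Lemma wO_sub {R : realType} (I : Type) (D D' : set I) (e dl : I -> R) k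
    (f : I -> Cx R) : D' `<=` D -> wO D e dl k f -> wO D' e dl k f.
Proof. by move=> DD [K [K0 h]]; exists K; split=> // i /DD; exact: h. Qed.

(** * Matrix exponential to second order *)

Section matrix_exponential.
Context {R : realType}.
Local Notation C := (Cx R).
Local Notation M2 := ('M[C]_2).
Implicit Types A L : M2.

Lemma ord2P (P : 'I_2 -> Prop) : P i0 -> P i1 -> forall i, P i.
Proof.
move=> h0 h1 [[|[|//]]] h.
  by rewrite (_ : Ordinal h = i0)//; exact: val_inj.
by rewrite (_ : Ordinal h = i1)//; exact: val_inj.
Qed.

Lemma mulmx2E m n (A : 'M[C]_(m, 2)) (B : 'M[C]_(2, n)) i j : (A *m B) i j = A i i0 * B i0 j + A i i1 * B i1 j.
Proof.
by rewrite mxE !big_ord_recl big_ord0 addr0; congr (_ * _ + A i _ * B _ j); exact: val_inj.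
Qed.

Lemma mxnorm_entry A i j : modC (A i j) <= mxnorm A.
Proof.
by move: i j; apply: ord2P => j; move: j; apply: ord2P;
  rewrite /mxnorm !le_max lexx ?orbT.
Qed.

Lemma mxnorm_le A (K : R) : (forall i j, modC (A i j) <= K) -> mxnorm A <= K.
Proof. by move=> h; rewrite /mxnorm !ge_max !h. Qed.

Lemma mxnorm_ge0 A : 0 <= mxnorm A.
Proof. exact: le_trans (modC_ge0 _) (mxnorm_entry A i0 i0). Qed.

Lemma cvg_mx2 (u : nat -> M2) L :
  (forall i j, tends0 (fun n => modC (u n i j - L i j))) -> u @ \oo --> L.
Proof.
move=> h; apply/cvg_ballP => e e0.
(* The radius is a complex number: positivity forces it to be real, and half its real part is a real
   radius below it. *)
have [er er0] : exists er : R, 0 < er /\ cR er < e.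
  exists (reC e / 2); move: e0; rewrite !ltcE/= => /andP[/eqP im re].
  by rewrite im eqxx/= (_ : complex.Re e = reC e)//; split; rewrite /reC in re *; lra.
case: er0 => er0 ere.
have [N hN] : exists N, forall n, (N <= n)%N -> forall i j, modC (u n i j - L i j) <= er.
  have [N0 h0] := h i0 i0 _ er0; have [N1 h1] := h i0 i1 _ er0.
  have [N2 h2] := h i1 i0 _ er0; have [N3 h3] := h i1 i1 _ er0.
  exists (maxn (maxn N0 N1) (maxn N2 N3)) => n; rewrite !geq_max.
  move=> /andP[/andP[/h0 {}h0 /h1 {}h1] /andP[/h2 {}h2 /h3 {}h3]].
  rewrite !(ger0_norm (modC_ge0 _)) in h0 h1 h2 h3.
  by apply: ord2P; apply: ord2P.
exists N => // n /= Nn; split=> // i j; rewrite /ball/= /ball_.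
rewrite -normrN opprB; apply: le_lt_trans ere.
by rewrite normc_def lecE/= eqxx/=; exact: hN.
Qed.

Lemma modC_natV (n : nat) : modC ((n%:R : C)^-1) = (n%:R)^-1.
Proof.
rewrite modCV; congr (_^-1).
have -> : n%:R = cR n%:R :> C.
  by elim: n => [|n IH] //; rewrite -!natr1 cRD -IH.
by rewrite modC_cR ger0_norm.
Qed.

(** The maximum norm of 2x2 matrices is submultiplicative only up to the factor 2. *)
Lemma expmx_entry A k i j : modC ((A ^+ k) i j) <= (2 * mxnorm A) ^+ k.
Proof.
elim: k i j => [|k IH] i j.
  by rewrite !expr0 mxE; case: eqP => _; rewrite ?modC1 ?modC0.
rewrite exprS mulmx2E (le_trans (modCD _ _))// !modCM exprS.
rewrite -mulrA mulr_natl mulr2n lerD//.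
  by rewrite ler_pM ?modC_ge0 ?mxnorm_entry.
by rewrite ler_pM ?modC_ge0 ?mxnorm_entry.
Qed.

Lemma cvg_series_tends0 (u : nat -> R) (x : R) : 0 <= x ->
  (forall k, `|u k| <= exp_coeff x k) ->
  tends0 (fun n => series u n - limn (series u)).
Proof.
move=> x0 h; apply: tends0_cvg.
have hc : cvgn (series u).
  apply: normed_cvg; apply: series_le_cvg (is_cvg_series_exp_coeff x) => // k;
    [exact: normr_ge0|exact: exp_coeff_ge0].
rewrite -(subrr (limn (series u))); apply: cvgB => //; exact: cvg_cst.
Qed.

(** Since (m+3)! >= 2^(m+1), the tail of the exponential series is dominated by a geometric series
    with sum x^3. *)
Lemma exp_tail (x : R) m : 0 <= x -> x <= 1 ->
  \sum_(i < m) x ^+ (i + 3) / ((i + 3)`!)%:R <= x ^+ 3 * (1 - 2^-1 ^+ m).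
Proof.
move=> x0 x1; elim: m => [|m IH]; first by rewrite big_ord0 expr0 subrr mulr0.
rewrite big_ord_recr/= (le_trans (lerD IH (lexx _)))//.
have hf : (2 ^ m.+1 <= (m + 3)`!)%N.
  elim: m {IH} => [|m IH] //.
  by rewrite expnS addSn factS leq_mul// addnS.
have -> : x ^+ 3 * (1 - 2^-1 ^+ m.+1) = x ^+ 3 * (1 - 2^-1 ^+ m) + x ^+ 3 * 2^-1 ^+ m.+1.
  by rewrite [2^-1 ^+ m.+1]exprS; move: (2^-1 ^+ m) => y; field.
rewrite lerD2l addnC exprD -mulrA ler_wpM2l ?exprn_ge0//.
rewrite exprVn -natrX -[leRHS]mul1r ler_pM ?exprn_ge0// ?invr_ge0//.
  exact: exprn_ile1.
by rewrite lef_pV2 ?posrE ?ltr0n ?fact_gt0 ?expn_gt0// ler_nat addnC.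
Qed.

(** The tail is bounded by x^3 for x = 2 [mxnorm A], whence the 8. *)
Lemma mexp_order2 A i j : 2 * mxnorm A <= 1 ->
  modC (mexp A i j - (1%:M i j + A i j + 2^-1 * (A *m A) i j)) <= 8 * mxnorm A ^+ 3.
Proof.
move=> A1; have A0 := mxnorm_ge0 A; set x := 2 * mxnorm A in A1 *.
have x0 : 0 <= x by rewrite mulr_ge0.
pose t k : M2 := (k`!%:R : C)^-1 *: A ^+ k.
have tE k p q : modC (t k p q) <= exp_coeff x k.
  rewrite /t mxE modCM modC_natV /exp_coeff mulrC ler_wpM2r ?invr_ge0//.
  exact: expmx_entry.
have serE n p q : series t n p q = \sum_(0 <= k < n) t k p q.
  by rewrite /series/= summxE.
(* Real and imaginary parts of each entry converge separately, dominated by the real exponential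
   series at [x]. *)
pose L : M2 := \matrix_(p, q) Complex (limn (series (fun k => reC (t k p q))))
                                    (limn (series (fun k => imC (t k p q)))).
have tL p q : tends0 (fun n => modC (series t n p q - L p q)).
  have hr := @cvg_series_tends0 (fun k => reC (t k p q)) x x0
    (fun k => le_trans (re_le_modC _) (tE k p q)).
  have hi := @cvg_series_tends0 (fun k => imC (t k p q)) x x0
    (fun k => le_trans (im_le_modC _) (tE k p q)).
  move=> e e0; have [N1 h1] := hr (e / 2) ltac:(lra).
  have [N2 h2] := hi (e / 2) ltac:(lra).
  exists (maxn N1 N2) => n; rewrite geq_max => /andP[/h1 {}h1 /h2 {}h2].
  rewrite ger0_norm ?modC_ge0// (le_trans (modC_le_reim _))//.
  rewrite [e]splitr; apply: lerD.
    apply: le_trans h1; rewrite reCD reCN serE /L mxE /=.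
    by rewrite /series/= (big_morph (@reC R) (@reCD R) (erefl : reC 0 = 0)).
  apply: le_trans h2; rewrite imCD imCN serE /L mxE /=.
  by rewrite /series/= (big_morph (@imC R) (@imCD R) (erefl : imC 0 = 0)).
have -> : mexp A = L.
  by apply: cvg_lim; [exact: norm_hausdorff|exact: cvg_mx2].
have tijE k : t k i j = (k`!%:R)^-1 * (A ^+ k) i j by rewrite /t mxE.
have S3 : series t 3 i j = 1%:M i j + A i j + 2^-1 * (A *m A) i j.
  rewrite serE !big_nat_recr//= big_geq// add0r !tijE.
  by rewrite expr0 expr1 expr2 !factS fact0 !muln1 invr1 !mul1r.
rewrite -S3; apply/ler_addgt0Pr => e e0.
have [N hN] := tL i j e e0.
have hm := hN (N + 3)%N (leq_addr _ _).
rewrite ger0_norm ?modC_ge0// modC_dist in hm.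
rewrite -(subrKA (series t (N + 3)%N i j)) (le_trans (modCD _ _))// addrC lerD//.
apply: (@le_trans _ _ (x ^+ 3)); last by rewrite /x exprMn; lra.
rewrite !serE (@big_cat_nat _ _ _ 3%N)//=; last by rewrite leq_addl.
rewrite addrAC subrr add0r.
apply: (@le_trans _ _ (\sum_(3 <= k < N + 3) exp_coeff x k)).
  elim/big_ind2: _ => //; first by rewrite modC0.
  by move=> z a w b za wb; rewrite (le_trans (modCD _ _))// lerD.
rewrite -{1}[3%N]add0n big_addn addnK big_mkord.
apply: (le_trans (exp_tail N x0 A1)).
by rewrite ler_piMr ?exprn_ge0// gerBl exprn_ge0// invr_ge0.
Qed.

End matrix_exponential.

(** * Logarithm of the modulus near 1 *)

Section logarithm.
Context {R : realType}.
Local Notation C := (Cx R).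

(** The remainder vanishes at 0 and has derivative t^2/(1+t), at most 2 t^2 for t >= -1/2; the mean
    value theorem concludes. *)
Lemma ln1_order2 (u : R) : `|u| <= 2^-1 ->
  `|ln (1 + u) - (u - u ^+ 2 / 2)| <= 2 * `|u| ^+ 3.
Proof.
move=> hu; rewrite -[X in _ - (_ - X)]mulrC.
pose f (t : R) := ln (1 + t) - (t - 2^-1 * t ^+ 2).
have f0 : f 0 = 0 by rewrite /f addr0 ln1 expr0n/= mulr0 !subr0.
have df (t : R) : - 2^-1 <= t -> is_derive t 1 f (t ^+ 2 / (1 + t)).
  move=> ht; have t0 : 0 < 1 + t by lra.
  have h1 : is_derive t (1 : R) (cst 1 + id : R -> R) 1.
    by have := is_deriveD (is_derive_cst (1 : R) t (1 : R)) (is_derive_id t (1 : R)); rewrite add0r.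
  have h2 : is_derive ((cst 1 + id : R -> R) t) 1 (@ln R) (1 + t)^-1 by exact: is_derive1_ln.
  have h3 := @is_derive1_comp _ _ _ _ _ _ h2 h1.
  have h4 := is_deriveB (is_derive_id t (1 : R))
    (is_deriveZ 2^-1 (is_deriveX 2 (is_derive_id t (1 : R)))).
  have h5 := is_deriveB h3 h4; rewrite (_ : t ^+ 2 / (1 + t) =
    (1 + t)^-1 * 1 - (1 - 2^-1 *: (2 * t ^+ 2.-1)%:A)); first exact: h5.
  rewrite /GRing.scale/= ?mulr1 ?expr1; field; lra.
have cf (a b : R) : - 2^-1 <= a -> {within `[a, b], continuous f}.
  move=> ha; apply: derivable_within_continuous => x.
  rewrite in_itv/= => /andP[ax _]; apply: (@ex_derive _ _ _ _ _ _ _ (df x _)); lra.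
have main (c : R) : - 2^-1 <= c -> `|c| <= `|u| -> `|c ^+ 2 / (1 + c) * u| <= 2 * `|u| ^+ 3.
  move=> hc cu; have c0 : 0 < 1 + c by lra.
  rewrite normrM normf_div normrX [`|u| ^+ 3]exprSr mulrA ler_wpM2r//.
  rewrite (ger0_norm (ltW c0)) ler_pdivrMr//.
  have h1 : `|c| ^+ 2 <= `|u| ^+ 2 by rewrite ler_sqr ?nnegrE.
  have h2 : 0 <= `|u| ^+ 2 by exact: sqr_ge0.
  by nra.
rewrite -/(f u) -[f u]subr0 -f0.
move: (hu); rewrite ler_norml => /andP[u1 u2].
have [u0|u0] := leP 0 u.
  have [c|c|c hc ->] := @MVT_segment _ f (fun t => t ^+ 2 / (1 + t)) 0 u u0.
  - by rewrite in_itv/= => /andP[c0 cu]; apply: df; lra.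
  - by apply: cf; lra.
  move: hc; rewrite in_itv/= => /andP[c0 cu]; rewrite subr0; apply: main; first lra.
  by rewrite !ger0_norm.
have [c|c|c hc e] := @MVT_segment _ f (fun t => t ^+ 2 / (1 + t)) u 0 (ltW u0).
- by rewrite in_itv/= => /andP[c0 cu]; apply: df; lra.
- by apply: cf; lra.
move: hc; rewrite in_itv/= => /andP[c0 cu].
rewrite -opprB e normrN sub0r mulrN normrN; apply: main; first lra.
by rewrite !ler0_norm ?lerN2//; exact: ltW.
Qed.

(** Uses ln |1+w| = (1/2) ln (1+u) with u = 2 Re w + |w|^2. The terms left over are Re w |w|^2 +
    |w|^4/4, and with |u| <= 3 |w| the total constant is 27 + 1 + 1/4 <= 30. *)
Lemma ln_modC_order2 (w : C) : modC w <= 8^-1 ->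
  `|ln (modC (1 + w)) - reC (w - w ^+ 2 / 2)| <= 30 * modC w ^+ 3.
Proof.
move=> hw; set m := modC w in hw *; have m0 : 0 <= m by exact: modC_ge0.
set x := reC w; set y := imC w.
have m2 : m ^+ 2 = x ^+ 2 + y ^+ 2 by exact: modC_sq.
have xm : `|x| <= m by exact: re_le_modC.
pose u := 2 * x + m ^+ 2.
have uE : modC (1 + w) ^+ 2 = 1 + u.
  by rewrite modC_sq reCD imCD /u m2 /= -/x -/y; ring.
have mm : m ^+ 2 <= m by rewrite expr2 ler_piMl//; lra.
have u3 : `|u| <= 3 * m.
  rewrite (le_trans (ler_normD _ _))// normrM [`|2|]ger0_norm// [`|m ^+ 2|]ger0_norm ?sqr_ge0//.
  by lra.
have hln : ln (modC (1 + w)) = 2^-1 * ln (1 + u).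
  rewrite -uE lnXn; first by rewrite -[X in 2^-1 * X]mulr_natl mulrA mulVf ?mul1r.
  rewrite lt_def modC_ge0 andbT; apply/eqP => h0.
  move: uE; rewrite h0 expr0n/= => h1.
  have : u = -1 by lra.
  by move=> h2; move: u3; rewrite h2 normrN normr1; lra.
have hu : `|u| <= 2^-1 by rewrite (le_trans u3)//; lra.
have := ln1_order2 hu; rewrite hln.
set l := ln (1 + u).
have -> : reC (w - w ^+ 2 / 2) = x - (x ^+ 2 - y ^+ 2) / 2.
  rewrite reCD reCN expr2 (_ : w * w / 2 = w * w * cR (2^-1)).
    by rewrite !reCM imCM /= -/x -/y; ring.
  congr (_ * _); apply: (@mulfI _ 2) => //; rewrite mulfV//.
  by apply: complex_ext; rewrite ?reCM ?imCM /=; field.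
move=> hl.
have -> : 2^-1 * l - (x - (x ^+ 2 - y ^+ 2) / 2) =
  2^-1 * (l - (u - u ^+ 2 / 2)) - (x * m ^+ 2 + m ^+ 4 / 4).
  have m4 : m ^+ 4 = (x ^+ 2 + y ^+ 2) ^+ 2 by rewrite -m2 -exprM.
  by rewrite m4 /u m2; field.
have m3 : 0 <= m ^+ 3 by rewrite exprn_ge0.
have h1 : `|u| ^+ 3 <= 27 * m ^+ 3.
  rewrite (_ : 27 * m ^+ 3 = (3 * m) ^+ 3); last by ring.
  by rewrite lerXn2r ?nnegrE// mulr_ge0.
have h2 : `|x * m ^+ 2| <= m ^+ 3.
  by rewrite normrM [`|m ^+ 2|]ger0_norm ?sqr_ge0// [leRHS]exprS ler_wpM2r ?sqr_ge0.
have h3 : m ^+ 4 <= m ^+ 3 by rewrite exprS ler_piMl//; lra.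
have h4 : 0 <= m ^+ 4 by rewrite exprn_ge0.
rewrite (le_trans (ler_normB _ _))// (le_trans (lerD (lexx _) (ler_normD _ _)))//.
rewrite normrM [`|2^-1|]ger0_norm ?invr_ge0// [`|m ^+ 4 / 4|]ger0_norm ?divr_ge0//.
by lra.
Qed.

End logarithm.

(** * Expansion of the exponential factor *)

Section generator_expansion.
Context {R : realType}.
Local Notation C := (Cx R).
Local Notation M2 := ('M[C]_2).

Let mxDE (A B : M2) j k : (A + B) j k = A j k + B j k.
Proof. by rewrite mxE. Qed.
Let mxZE (c : C) (A : M2) j k : (c *: A) j k = c * A j k.
Proof. by rewrite mxE. Qed.

Definition su11_coord (A : M2) (x y z : R) :=
  [/\ A i0 i0 = cI * cR z, A i0 i1 = cR x + cI * cR y,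
      A i1 i0 = cR x - cI * cR y & A i1 i1 = - (cI * cR z)].

Lemma su11_coordP x y z : su11_coord (cR x *: B1 + cR y *: B2 + cR z *: B3) x y z.
Proof. by split; rewrite !mxE /=; ring. Qed.

(** An imaginary diagonal is what keeps eps^2 P' out of the real part of the lower right entry,
    hence out of D. *)
Lemma su11_re_diag (A : M2) : su11 A -> reC (A i1 i1) = 0.
Proof.
move=> [/matrixP/(_ i1 i1) + _].
rewrite mulmx2E [RHS]mxE mulmx2E !mxE /= => /(congr1 (@reC R)).
rewrite !(reCD, reCN, reCM, imCM, imCN) ?reC_conj ?imC_conj /=.
lra.
Qed.

Context {I : Type}.
Variables (D : set I) (e dl : I -> R).
Hypothesis small : forall i, D i -> unit_range (e i) (dl i).
Variables (p1 p2 p3 q1 q2 q3 : I -> R) (PP QQ P' Er : I -> M2).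
Local Notation O := (wO D e dl).
Hypothesis hPP : forall i, su11_coord (PP i) (p1 i) (p2 i) (p3 i).
Hypothesis hQQ : forall i, su11_coord (QQ i) (q1 i) (q2 i) (q3 i).
Hypothesis hp1 : O 0 (fun i => cR (p1 i)).
Hypothesis hp2 : O 0 (fun i => cR (p2 i)).
Hypothesis hp3 : O 0 (fun i => cR (p3 i)).
Hypothesis hq1 : O 0 (fun i => cR (q1 i)).
Hypothesis hq2 : O 0 (fun i => cR (q2 i)).
Hypothesis hq3 : O 0 (fun i => cR (q3 i)).
Hypothesis hP' : forall j k, O 0 (fun i => P' i j k).
Hypothesis hP'11 : forall i, reC (P' i i1 i1) = 0.
Hypothesis hEr : forall j k, O 3 (fun i => Er i j k).

Definition generator (i : I) : M2 :=
  cR (e i) *: PP i + cR (e i ^+ 2) *: P' i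
  + (cI * cR (dl i)) *: QQ i + Er i.

Let X := generator.
Let cIO : O 0 (fun=> cI). Proof. exact: wO_cst. Qed.
Let eO : O 1 (fun i => cR (e i)). Proof. exact: wO_e. Qed.
Let dlO : O 2 (fun i => cR (dl i)). Proof. exact: wO_dl. Qed.
Let e2O : O 2 (fun i => cR (e i ^+ 2)).
Proof.
by apply: wO_eq (wOM small (isT : (2 <= 1 + 1)%N) eO eO) => i _; rewrite expr2 cRM.
Qed.

Let coordO (A : I -> M2) (x y z : I -> R) :
  (forall i, su11_coord (A i) (x i) (y i) (z i)) ->
  O 0 (fun i => cR (x i)) -> O 0 (fun i => cR (y i)) ->
  O 0 (fun i => cR (z i)) -> forall j k, O 0 (fun i => A i j k).
Proof.
move=> hA hx hy hz; have M0 := wOM small (isT : (0 <= 0 + 0)%N).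
apply: ord2P; apply: ord2P.
- by apply: wO_eq (M0 _ _ cIO hz) => i _; case: (hA i).
- by apply: wO_eq (wOD hx (M0 _ _ cIO hy)) => i _; case: (hA i).
- by apply: wO_eq (wOB hx (M0 _ _ cIO hy)) => i _; case: (hA i).
- by apply: wO_eq (wON (M0 _ _ cIO hz)) => i _; case: (hA i).
Qed.

Let U i : M2 := cR (e i ^+ 2) *: P' i + (cI * cR (dl i)) *: QQ i + Er i.

Let UO j k : O 2 (fun i => U i j k).
Proof.
have h1 := wOM small (isT : (2 <= 2 + 0)%N) e2O (hP' j k).
have h2 := wOM small (isT : (2 <= 0 + 2)%N) cIO dlO.
have h3 := wOM small (isT : (2 <= 2 + 0)%N) h2 (coordO hQQ hq1 hq2 hq3 j k).
have h4 := wO_weaken small (isT : (2 <= 3)%N) (hEr j k).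
by apply: wO_eq (wOD (wOD h1 h3) h4) => i _; rewrite /U !mxDE !mxZE.
Qed.

Let pO := coordO hPP hp1 hp2 hp3.
Let XE i j k : X i j k = cR (e i) * PP i j k + U i j k.
Proof. by rewrite /X /generator /U !mxDE !mxZE !addrA. Qed.

Lemma generatorO j k : O 1 (fun i => X i j k).
Proof.
have h1 := wOM small (isT : (1 <= 1 + 0)%N) eO (pO j k).
have h2 := wO_weaken small (isT : (1 <= 2)%N) (UO j k).
by apply: wO_eq (wOD h1 h2) => i _; rewrite XE.
Qed.

Lemma generator_mxnorm : exists K : R, 0 <= K /\
  forall i, D i -> mxnorm (X i) <= K * weight (e i) (dl i) 1.
Proof.
have [K0 [K00 h0]] := generatorO i0 i0; have [K1 [K10 h1]] := generatorO i0 i1.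
have [K2 [K20 h2]] := generatorO i1 i0; have [K3 [K30 h3]] := generatorO i1 i1.
exists (K0 + K1 + K2 + K3); split; first by rewrite !addr_ge0.
move=> i Di; have w0 := weight_ge0 (small Di) 1; apply: mxnorm_le.
by apply: ord2P; apply: ord2P;
  [move: (h0 i Di)|move: (h1 i Di)|move: (h2 i Di)|move: (h3 i Di)];
  move=> /le_trans; apply; rewrite ler_wpM2r//; lra.
Qed.

Hypothesis X1 : forall i, D i -> 2 * mxnorm (X i) <= 1.
Let E i : M2 := mexp (X i).

Let remO j k : O 3 (fun i => E i j k - (1%:M j k + X i j k + 2^-1 * (X i *m X i) j k)).
Proof.
have [K [K0 hK]] := generator_mxnorm.
exists (8 * (K ^+ 3 * (32 * 32))); split; first by rewrite !mulr_ge0 ?exprn_ge0.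
move=> i Di; rewrite (le_trans (mexp_order2 j k (X1 Di)))//.
rewrite -[leRHS]mulrA ler_wpM2l//.
apply: (@le_trans _ _ ((K * weight (e i) (dl i) 1) ^+ 3)).
  by rewrite lerXn2r ?nnegrE ?mxnorm_ge0 ?mulr_ge0 ?(weight_ge0 (small Di))// hK.
rewrite exprMn -mulrA ler_wpM2l ?exprn_ge0//.
have h1 := weightM (small Di) (isT : (2 <= 1 + 1)%N).
have h2 := weightM (small Di) (isT : (3 <= 1 + 2)%N).
have w0 := weight_ge0 (small Di) 1.
rewrite exprS expr2 (le_trans (ler_wpM2l w0 h1))//.
by rewrite mulrCA; lra.
Qed.

Let XXO j k : O 2 (fun i => (X i *m X i) j k).
Proof.
have M2 := wOM small (isT : (2 <= 1 + 1)%N).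
apply: wO_eq (wOD (M2 _ _ (generatorO j i0) (generatorO i0 k))
                 (M2 _ _ (generatorO j i1) (generatorO i1 k))) => i _.
by rewrite mulmx2E.
Qed.

Lemma mexp_order1 j k :
  O 2 (fun i => E i j k - 1%:M j k - cR (e i) * PP i j k).
Proof.
have h1 := wO_weaken small (isT : (2 <= 3)%N) (remO j k).
have h2 := wOM small (isT : (2 <= 0 + 2)%N) (wO_cst D e dl 2^-1) (XXO j k).
apply: wO_eq (wOD (wOD h1 (UO j k)) h2) => i _ /=.
by rewrite XE; ring.
Qed.

(** Below weight 3 two real contributions remain: eps^2/2 times the lower right entry |beta|^2 -
    p3^2 of P^2, the off-diagonal entries of P being conjugate, and i delta times the entry -i q3 of
    Q, the origin of C. The rest is imaginary. *)
Lemma mexp_re_diag : O 3 (fun i => cR (reC (E i i1 i1 - 1)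
  - (e i ^+ 2 * (p1 i ^+ 2 + p2 i ^+ 2 - p3 i ^+ 2) / 2 + dl i * q3 i))).
Proof.
pose b := PP.
have M3 := wOM small (isT : (3 <= 1 + 2)%N).
have M3' := wOM small (isT : (3 <= 2 + 2)%N).
have ebO j k : O 1 (fun i => cR (e i) * b i j k).
  exact: (wOM small (isT : (1 <= 1 + 0)%N) eO (pO j k)).
have quad j : O 3 (fun i => X i i1 j * X i j i1 - cR (e i) ^+ 2 * (b i i1 j * b i j i1)).
  have h1 := M3 _ _ (ebO i1 j) (UO j i1).
  have h2 := M3 _ _ (ebO j i1) (UO i1 j).
  have h3 := M3' _ _ (UO i1 j) (UO j i1).
  apply: wO_eq (wOD (wOD h1 h2) h3) => i _ /=.
  by rewrite !XE /b; ring.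
have hh := wOM small (isT : (3 <= 0 + 3)%N) (wO_cst D e dl 2^-1) (wOD (quad i0) (quad i1)).
have := wOD (wOD (remO i1 i1) hh) (hEr i1 i1).
move=> /wO_le; apply=> i _; rewrite modC_cR.
apply: le_trans (re_le_modC _).
rewrite le_eqVlt; apply/orP; left; apply/eqP; congr (`|_|).
rewrite mulmx2E [1%:M _ _]mxE eqxx /b.
rewrite [in RHS](_ : _ + _ = E i i1 i1 - 1 - (cR (e i) * PP i i1 i1 +
    cR (e i ^+ 2) * P' i i1 i1 + cI * cR (dl i) * QQ i i1 i1) -
    2^-1 * (cR (e i) ^+ 2 * (PP i i1 i0 * PP i i0 i1 + PP i i1 i1 * PP i i1 i1))); last first.
  rewrite [X i i1 i1]XE /U !mxDE !mxZE (_ : true%:R = 1 :> C)//.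
  by move: (2^-1 : C) => h; ring.
have [_ -> -> ->] := hPP i; have [_ _ _ ->] := hQQ i.
rewrite (_ : 2^-1 = cR 2^-1); last first.
  apply: (@mulfI _ 2) => //; rewrite mulfV//.
  by apply: complex_ext; rewrite ?reCM ?imCM /=; field.
rewrite ?(expr2, reCD, reCN, reCM, imCD, imCN, imCM, reC_cR, imC_cR) /= hP'11.
by field.
Qed.

End generator_expansion.

(** * One step of the corrected logarithm *)

Section step_expansion.
Context {R : realType}.
Local Notation C := (Cx R).
Context {I : Type}.
Variables (D : set I) (e dl : I -> R).
Hypothesis small : forall i, D i -> unit_range (e i) (dl i).
Local Notation O := (wO D e dl).
Variables (a b c d z u beta betac p : I -> C) (rho : I -> R).
Hypothesis zO : O 0 z.
Hypothesis uO : O 0 u.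
Hypothesis betaO : O 0 beta.
Hypothesis betacO : O 0 betac.
Hypothesis pO : O 0 p.
Local Notation ce := (fun i => cR (e i)).
Hypothesis ha : O 2 (fun i => a i - 1 - ce i * (cI * p i)).
Hypothesis hb : O 2 (fun i => b i - ce i * betac i).
Hypothesis hc : O 2 (fun i => c i - ce i * beta i).
Hypothesis hd : O 2 (fun i => d i - 1 - ce i * - (cI * p i)).
(** Only Re (d - 1) enters the logarithm linearly, so weight 3 precision is asked of the real part
    alone; [hd] suffices inside the square. *)
Hypothesis hd3 : O 3 (fun i => cR (reC (d i - 1) - rho i)).
Let w i := c i * z i + d i - 1.
Hypothesis hw : forall i, D i -> modC (w i) <= 8^-1.

Let cIO : O 0 (fun=> cI). Proof. exact: wO_cst. Qed.
Let hO : O 0 (fun=> 2^-1). Proof. exact: wO_cst. Qed.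
Let eO : O 1 ce. Proof. exact: wO_e. Qed.
Let M0 f g := @wOM _ _ D e dl small 0 0 0 f g isT.
Let M01 f g := @wOM _ _ D e dl small 0 1 1 f g isT.
Let M10 f g := @wOM _ _ D e dl small 1 0 1 f g isT.
Let M20 f g := @wOM _ _ D e dl small 2 0 2 f g isT.
Let M02 f g := @wOM _ _ D e dl small 0 2 2 f g isT.
Let M11 f g := @wOM _ _ D e dl small 1 1 2 f g isT.
Let M12 f g := @wOM _ _ D e dl small 1 2 3 f g isT.
Let M21 f g := @wOM _ _ D e dl small 2 1 3 f g isT.
Let M03 f g := @wOM _ _ D e dl small 0 3 3 f g isT.
Let weak12 := fun f => @wO_weaken _ _ D e dl small 1 2 f isT.

Let ww i := beta i * z i - cI * p i.
Let wwO : O 0 ww. Proof. by apply: wOB; exact: M0. Qed.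

Let w2O : O 2 (fun i => w i - ce i * ww i).
Proof.
by apply: wO_eq (wOD (M20 hc zO) hd) => i _; rewrite /w /ww; ring.
Qed.

Let wO1 : O 1 w.
Proof.
by apply: wO_eq (wOD (weak12 w2O) (M10 eO wwO)) => i _; ring.
Qed.

Let re_O k f : O k f -> O k (fun i => cR (reC (f i))).
Proof. by move=> h; apply: wO_le h _ => i _; rewrite modC_cR re_le_modC. Qed.

(** The term c z is kept unexpanded, because [corr_A] later cancels its exact mean; the quadratic
    term is replaced by its leading part. *)
Lemma log_expansion : O 3 (fun i => cR (ln (modC (1 + w i)) -
  (reC (c i * z i) + rho i - reC (2^-1 * (ce i ^+ 2 * ww i ^+ 2))))).
Proof.
have [K [K0 hK]] := wO1.
have h1 : O 3 (fun i => w i * (w i * w i)) by exact: (M12 wO1 (M11 wO1 wO1)).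
have h2 : O 3 (fun i => cR (ln (modC (1 + w i)) - reC (w i - w i ^+ 2 / 2))).
  apply: wO_le (M03 (wO_cst D e dl (cR 30)) h1) _ => i Di.
  rewrite modC_cR (le_trans (ln_modC_order2 (hw Di)))// !modCM modC_cR ger0_norm//.
have h3 := M12 wO1 w2O; have h4 := M12 (M10 eO wwO) w2O.
have h5 := re_O (M03 hO (wOD h3 h4)).
apply: wO_eq (wOB (wOD h2 hd3) h5) => i _ /=.
rewrite -cRN -!cRD; congr cR.
have -> : w i - w i ^+ 2 / 2 = c i * z i + (d i - 1) - 2^-1 * (ce i ^+ 2 * ww i ^+ 2)
   - 2^-1 * (w i * (w i - ce i * ww i) + ce i * ww i * (w i - ce i * ww i)).
  by move: (2^-1 : C) => h; rewrite {1}/w; ring.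
by rewrite !(reCD, reCN) /=; ring.
Qed.

Let z' i := u i * (a i * z i + b i) / (c i * z i + d i).
(** The vector field of the Moebius action generated by P: P_01 + (P_00 - P_11) z - P_10 z^2. *)
Let Y i := betac i + 2 * (cI * p i * z i) - beta i * z i ^+ 2.
Let YO : O 0 Y.
Proof.
apply: wOB; first apply: wOD => //.
  by apply: (M0 (wO_cst D e dl 2)); apply: M0 => //; exact: M0.
by apply: wO_eq (M0 betaO (M0 zO zO)) => i _; rewrite expr2.
Qed.

Let denE i : c i * z i + d i = 1 + w i.
Proof. by rewrite /w; ring. Qed.

Let denO : O 0 (fun i => (1 + w i)^-1).
Proof.
apply: (@wO_bounded _ _ _ _ _ _ 2) => i Di; rewrite modCV.
have h1 : 1 <= modC (1 + w i) + modC (w i).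
  rewrite -{1}(@modC1 R) (le_trans _ (modCB _ _))//.
  by rewrite le_eqVlt; apply/orP; left; apply/eqP; congr modC; ring.
have := hw Di => h2.
have h3 : 2^-1 <= modC (1 + w i) by lra.
have -> : 2 = (2^-1)^-1 :> R by rewrite invrK.
by rewrite lef_pV2// ?posrE; lra.
Qed.

Lemma mobius_expansion : O 2 (fun i => z' i - u i * (z i + ce i * Y i)).
Proof.
have zd : O 2 (fun i => a i * z i + b i - (z i + ce i * (cI * p i * z i + betac i))).
  by apply: wO_eq (wOD (M20 ha zO) hb) => i _; ring.
have h1 := M02 denO zd.
have h2 := M02 denO (M20 w2O zO).
have h3 := M02 denO (M11 (M10 eO YO) wO1).
apply: wO_eq (M02 uO (wOB (wOB h1 h2) h3)) => i Di.
have hne : 1 + w i != 0.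
  apply/eqP => h0; have := hw Di; rewrite (_ : w i = -1) ?modCN ?modC1; first lra.
  by apply/eqP; rewrite -subr_eq0 opprK addrC h0.
have wE : w i = c i * z i + d i - 1 by [].
rewrite /z' denE /Y /ww in hne *.
move: hne wE; move: (w i) => W hne _; field; exact: hne.
Qed.

Let z'O : O 0 z'.
Proof.
have h : O 0 (fun i => u i * (z i + ce i * Y i)).
  apply: M0 => //; apply: wOD => //.
  exact: (wO_weaken small (isT : (0 <= 1)%N) (M10 eO YO)).
apply: wO_eq (wOD (wO_weaken small (isT : (0 <= 2)%N) mobius_expansion) h) => i _; ring.
Qed.

Variables (A Ab B G : I -> C).
Hypothesis AbO : O 0 Ab.
Hypothesis BO : O 0 B.
Hypothesis GO : O 0 G.
Hypothesis hA : O 2 (fun i => A i - ce i * Ab i).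

Let AO : O 1 A.
Proof. by apply: wO_eq (wOD (weak12 hA) (M10 eO AbO)) => i _; ring. Qed.

(** The corrected increment up to weight 3. As [A] has weight 1, its term needs the image point to
    first order, u (z + eps Y), with [A] replaced by eps [Ab] in front of [Y]; the eps^2 terms need
    only the rotated point u z. *)
Definition step_main (i : I) : C :=
  c i * z i + cR (rho i) - 2^-1 * (ce i ^+ 2 * (beta i * z i - cI * p i) ^+ 2)
  + A i * u i * z i
  + ce i ^+ 2 * (Ab i * u i * (betac i + 2 * (cI * p i * z i) - beta i * z i ^+ 2))
  + ce i ^+ 2 * (B i * u i * z i + G i * u i ^+ 2 * z i ^+ 2)
  - (A i * z i + ce i ^+ 2 * (B i * z i + G i * z i ^+ 2)).

Definition corrector (x : C) (i : I) : R :=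
  reC (A i * x + ce i ^+ 2 * (B i * x + G i * x ^+ 2)).

Lemma step_expansion : O 3 (fun i => cR (ln (modC (c i * z i + d i)) +
  corrector (u i * (a i * z i + b i) / (c i * z i + d i)) i - corrector (z i) i
  - reC (step_main i))).
Proof.
have dz := mobius_expansion.
have eeO : O 2 (fun i => ce i ^+ 2).
  by apply: wO_eq (M11 eO eO) => i _; rewrite expr2.
have dz1 : O 1 (fun i => z' i - u i * z i).
  apply: wO_eq (wOD (weak12 dz) (M01 uO (M10 eO YO))) => i _; ring.
(* Four errors: the image point beyond first order, [A] against eps [Ab], and the image point
   against u z in the linear and in the quadratic eps^2 term. *)
have h1 := M12 AO dz.
have h2 : O 3 (fun i => (A i - ce i * Ab i) * (ce i * (u i * Y i))).
  exact: (M21 hA (M10 eO (M0 uO YO))).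
have h3 := M21 (M20 eeO BO) dz1.
have h4 : O 3 (fun i => ce i ^+ 2 * G i * ((z' i - u i * z i) * (z' i + u i * z i))).
  exact: (M21 (M20 eeO GO) (M10 dz1 (wOD z'O (M0 uO zO)))).
apply: wO_eq (wOD log_expansion (re_O (wOD (wOD h1 h2) (wOD h3 h4)))) => i _ /=.
rewrite -!cRD; congr cR; rewrite denE /corrector.
have zE : u i * (a i * z i + b i) / (1 + w i) = z' i by rewrite /z' denE.
rewrite zE -/(z' i).
rewrite -[rho i]reC_cR -[X in _ = _ + _ - _ - reC X]/(step_main i).
move: (ln (modC (1 + w i))) => L.
rewrite -!reCD -!reCN -!reCD -!addrA; congr (_ + _).
rewrite -!reCD -?reCN -!reCD; congr reC.
rewrite /step_main /Y /ww; move: (2^-1 : C) => h; ring.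
Qed.

End step_expansion.

(** * Averaging one step *)

Section complex_expectation.
Context {R : realType} {d : measure_display} {X : measurableType d}.
Variable P : probability X R.
Local Notation C := (Cx R).
Implicit Types f g : X -> C.

Definition cbmeas f := bmeas (fun s => reC (f s)) /\ bmeas (fun s => imC (f s)).

Lemma cbmeas_cst (c : C) : cbmeas (fun=> c).
Proof. by split; exact: bmeas_cst. Qed.

Lemma cbmeasD f g : cbmeas f -> cbmeas g -> cbmeas (fun s => f s + g s).
Proof.
move=> [f1 f2] [g1 g2]; split.
  by under eq_fun do rewrite reCD; exact: bmeasD.
by under eq_fun do rewrite imCD; exact: bmeasD.
Qed.

Lemma cbmeasM f g : cbmeas f -> cbmeas g -> cbmeas (fun s => f s * g s).
Proof.
move=> [f1 f2] [g1 g2]; split.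
  by under eq_fun do rewrite reCM; apply: bmeasB; exact: bmeasM.
by under eq_fun do rewrite imCM; apply: bmeasD; exact: bmeasM.
Qed.

Lemma cbmeas_cR (f : X -> R) : bmeas f -> cbmeas (fun s => cR (f s)).
Proof. by move=> h; split => //; exact: bmeas_cst. Qed.

Lemma reC_ExpC f : reC (ExpC P f) = Exp P (fun s => reC (f s)).
Proof. by rewrite /ExpC reCD reCM /= mul0r mulr0 subr0 addr0. Qed.

Lemma imC_ExpC f : imC (ExpC P f) = Exp P (fun s => imC (f s)).
Proof. by rewrite /ExpC imCD imCM /= mulr0 mul1r !add0r. Qed.

Lemma eq_ExpC f g : (forall s, f s = g s) -> ExpC P f = ExpC P g.
Proof. by move=> /funext ->. Qed.

Lemma ExpC_cst (c : C) : ExpC P (fun=> c) = c.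
Proof. by apply: complex_ext; rewrite ?reC_ExpC ?imC_ExpC Exp_cst. Qed.

Lemma ExpC_cR (f : X -> R) : ExpC P (fun s => cR (f s)) = cR (Exp P f).
Proof. by apply: complex_ext; rewrite ?reC_ExpC ?imC_ExpC //= Exp_cst. Qed.

Lemma ExpCD f g : cbmeas f -> cbmeas g ->
  ExpC P (fun s => f s + g s) = ExpC P f + ExpC P g.
Proof.
move=> [f1 f2] [g1 g2]; apply: complex_ext.
  rewrite reC_ExpC reCD !reC_ExpC -ExpD//.
  by apply: eq_Exp => s; rewrite reCD.
rewrite imC_ExpC imCD !imC_ExpC -ExpD//; by apply: eq_Exp => s; rewrite imCD.
Qed.

Lemma ExpCZ (c : C) f : cbmeas f -> ExpC P (fun s => c * f s) = c * ExpC P f.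
Proof.
move=> [f1 f2]; apply: complex_ext.
  rewrite reC_ExpC reCM reC_ExpC imC_ExpC -!ExpZ// -ExpB; [|by apply: bmeasM => //; exact: bmeas_cst..].
  by apply: eq_Exp => s; rewrite reCM.
rewrite imC_ExpC imCM reC_ExpC imC_ExpC -!ExpZ// -ExpD; [|by apply: bmeasM => //; exact: bmeas_cst..].
by apply: eq_Exp => s; rewrite imCM.
Qed.

Lemma ExpC_lin (k : C) f g : cbmeas f -> cbmeas g ->
  ExpC P (fun s => k * f s + g s) = k * ExpC P f + ExpC P g.
Proof.
move=> hf hg; rewrite -ExpCZ// -ExpCD//.
by apply: cbmeasM => //; exact: cbmeas_cst.
Qed.

Section average.
Variables (c u beta betac p : X -> C) (rho : X -> R).
Hypothesis mc : cbmeas c.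
Hypothesis mu_ : cbmeas u.
Hypothesis mb : cbmeas beta.
Hypothesis mbc : cbmeas betac.
Hypothesis mp : cbmeas p.
Hypothesis mr : bmeas rho.
Let m1 : C := ExpC P u.
Let m2 : C := ExpC P (fun s => u s * u s).
Hypothesis m1_neq1 : m1 != 1.
Hypothesis m2_neq1 : m2 != 1.

(* [corr_A] is the exact mean of the lower left entry and not that of its
   expansion: P' and the error term are not measurable in general. *)
Definition corr_A : C := ExpC P c / (1 - m1).
Definition corr_Ab : C := ExpC P beta / (1 - m1).
(** The summands are the coefficients of eps^2 z in the mean: the cross term of -(beta z - i p)^2/2,
    and the linear part of the drift weighted by [corr_Ab] u. [corr_G] does the same for z^2. *)
Definition corr_B : C := (cI * ExpC P (fun s => beta s * p s)
  + 2 * cI * corr_Ab * ExpC P (fun s => u s * p s)) / (1 - m1).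
Definition corr_G : C := - (2^-1 * ExpC P (fun s => beta s * beta s)
  + corr_Ab * ExpC P (fun s => u s * beta s)) / (1 - m2).

(** The right-hand side is free of z. Its p^2/2, from (-i p)^2 = -p^2, will cancel the -p3^2/2 in
    [rho]. *)
Lemma step_average (e z : C) :
  ExpC P (fun s =>
    c s * z + cR (rho s) - 2^-1 * (e ^+ 2 * (beta s * z - cI * p s) ^+ 2)
  + corr_A * u s * z
  + e ^+ 2 * (corr_Ab * u s * (betac s + 2 * (cI * p s * z) - beta s * z ^+ 2))
  + e ^+ 2 * (corr_B * u s * z + corr_G * u s ^+ 2 * z ^+ 2)
  - (corr_A * z + e ^+ 2 * (corr_B * z + corr_G * z ^+ 2)))
  = cR (Exp P rho) + 2^-1 * e ^+ 2 * ExpC P (fun s => p s * p s)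
    + e ^+ 2 * corr_Ab * ExpC P (fun s => u s * betac s).
Proof.
have cI2 : cI * cI = -1 :> C.
  by apply: complex_ext; rewrite ?reCM ?imCM ?reCN ?imCN /=; ring.
have n1 : 1 - m1 != 0 by rewrite subr_eq0 eq_sym.
have n2 : 1 - m2 != 0 by rewrite subr_eq0 eq_sym.
have mr' := cbmeas_cR mr.
pose A := corr_A; pose Ab := corr_Ab; pose B := corr_B; pose G := corr_G.
pose k0 : C := - (A * z + e ^+ 2 * (B * z + G * z ^+ 2)).
(* Rearranged as a fixed linear combination of bounded measurable functions, so that the mean passes
   term by term. *)
transitivity (ExpC P (fun s => z * c s + (1 * cR (rho s) +
  (- (2^-1 * e ^+ 2 * z ^+ 2) * (beta s * beta s) +
  ((e ^+ 2 * cI * z) * (beta s * p s) + ((2^-1 * e ^+ 2) * (p s * p s) +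
  ((A * z + e ^+ 2 * B * z) * u s + ((e ^+ 2 * Ab) * (u s * betac s) +
  ((2 * e ^+ 2 * Ab * cI * z) * (u s * p s) +
  (- (e ^+ 2 * Ab * z ^+ 2) * (u s * beta s) +
  ((e ^+ 2 * G * z ^+ 2) * (u s * u s) + k0))))))))))).
  apply: eq_ExpC => s.
  have -> : (beta s * z - cI * p s) ^+ 2 = beta s * beta s * z ^+ 2
      - 2 * cI * (beta s * p s) * z + (cI * cI) * (p s * p s) by ring.
  have h2 : e ^+ 2 * cI * z * (beta s * p s) =
      2^-1 * (2 * (e ^+ 2 * cI * z * (beta s * p s))) by rewrite mulKf.
  rewrite cI2 h2 /k0 -/A -/Ab -/B -/G; move: (2^-1 : C) => h; ring.
have lin (k : C) f g v : cbmeas f -> cbmeas g /\ ExpC P g = v ->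
    cbmeas (fun s => k * f s + g s) /\ ExpC P (fun s => k * f s + g s) = k * ExpC P f + v.
  move=> hf [hg <-]; split; last exact: ExpC_lin.
  by apply: cbmeasD => //; apply: cbmeasM => //; exact: cbmeas_cst.
have := lin _ _ _ _ mc (lin 1 _ _ _ mr'
  (lin _ _ _ _ (cbmeasM mb mb) (lin _ _ _ _ (cbmeasM mb mp) (lin _ _ _ _ (cbmeasM mp mp)
  (lin _ _ _ _ mu_ (lin _ _ _ _ (cbmeasM mu_ mbc) (lin _ _ _ _ (cbmeasM mu_ mp)
  (lin _ _ _ _ (cbmeasM mu_ mb) (lin _ _ _ _ (cbmeasM mu_ mu_)
  (conj (cbmeas_cst k0) (ExpC_cst k0))))))))))).
move=> /(_ z (- (2^-1 * e ^+ 2 * z ^+ 2)) (e ^+ 2 * cI * z) (2^-1 * e ^+ 2)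
  (A * z + e ^+ 2 * B * z) (e ^+ 2 * Ab) (2 * e ^+ 2 * Ab * cI * z)
  (- (e ^+ 2 * Ab * z ^+ 2)) (e ^+ 2 * G * z ^+ 2)) [_ ->].
rewrite ExpC_cR -/m1 -/m2 /k0 mul1r.
have hA : A * (1 - m1) = ExpC P c by rewrite /A /corr_A divfK.
have hB : B * (1 - m1) = cI * ExpC P (fun s => beta s * p s)
  + 2 * cI * Ab * ExpC P (fun s => u s * p s) by rewrite /B /corr_B divfK.
have hG : G * (1 - m2) = - (2^-1 * ExpC P (fun s => beta s * beta s)
  + Ab * ExpC P (fun s => u s * beta s)) by rewrite /G /corr_G divfK.
rewrite -hA -/Ab.
set Ebb := ExpC P (fun s => beta s * beta s) in hG *.
set Ebp := ExpC P (fun s => beta s * p s) in hB *.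
set Eup := ExpC P (fun s => u s * p s) in hB *.
set Eub := ExpC P (fun s => u s * beta s) in hG *.
have hB' : cI * Ebp = B * (1 - m1) - 2 * cI * Ab * Eup by rewrite hB; ring.
have hG' : 2^-1 * Ebb = - (G * (1 - m2)) - Ab * Eub by rewrite hG; ring.
have -> : - (2^-1 * e ^+ 2 * z ^+ 2) * Ebb = - (e ^+ 2 * z ^+ 2) * (2^-1 * Ebb).
  by move: (2^-1 : C) => h; ring.
have -> : e ^+ 2 * cI * z * Ebp = e ^+ 2 * z * (cI * Ebp) by ring.
rewrite hB' hG'; move: (2^-1 : C) => h; ring.
Qed.

End average.
End complex_expectation.

(** * Contractions of the disc and the corner entry *)

Section disc_action.
Context {R : realType}.
Local Notation C := (Cx R).
Local Notation M2 := ('M[C]_2).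
Implicit Types (T S : M2) (x y z : C).

Definition den T z : C := T i1 i0 * z + T i1 i1.
Definition mob T z : C := (T i0 i0 * z + T i0 i1) / den T z.

(** The condition T^* J T <= J as a real inequality between Hermitian forms at (x, y); in this shape
    it passes to products by composition. *)
Definition disc_contraction T := \det T = 1 /\ forall x y,
  modC (T i0 i0 * x + T i0 i1 * y) ^+ 2 - modC (T i1 i0 * x + T i1 i1 * y) ^+ 2
    <= modC x ^+ 2 - modC y ^+ 2.

Lemma det_mx2 T : \det T = T i0 i0 * T i1 i1 - T i0 i1 * T i1 i0.
Proof.
rewrite (expand_det_row _ i0) !big_ord_recl big_ord0 addr0 /cofactor.
rewrite !det_mx11 !mxE /= expr0 mul1r expr1 mulN1r mulrN.
by congr (_ * T _ _ - T _ _ * T _ _); exact: val_inj.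
Qed.

Lemma conj_mul_modC z : Num.conj z * z = cR (modC z ^+ 2).
Proof.
apply: complex_ext; rewrite ?reCM ?imCM reC_conj imC_conj /= ?modC_sq; ring.
Qed.

Lemma mxstar_Jm (v : 'cV[C]_2) : (mxstar v *m Jm *m v) ord0 ord0 =
  cR (modC (v i0 ord0) ^+ 2 - modC (v i1 ord0) ^+ 2).
Proof.
rewrite cRD cRN -!conj_mul_modC -mulmxA mxE !big_ord_recl big_ord0 addr0.
rewrite !mxE !big_ord_recl !big_ord0 !addr0 !mxE /= mul1r mul0r addr0 mul0r add0r.
rewrite mulN1r mulrN; congr (_ * v _ _ - _ * v _ _); try exact: val_inj.
by congr (Num.conj (v _ _)); exact: val_inj.
Qed.

Lemma mxstarM m n p (A : 'M[C]_(m, n)) (B : 'M[C]_(n, p)) :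
  mxstar (A *m B) = mxstar B *m mxstar A.
Proof. by rewrite /mxstar map_mxM trmx_mul. Qed.

Lemma SU11le_disc_contraction T : SU11le T -> disc_contraction T.
Proof.
move=> [psd dT]; split => // x y.
pose v : 'cV[C]_2 := \col_i (if i == i0 then x else y).
have := psd v; rewrite mulmxBr mulmxBl mxE [X in _ + X]mxE.
have -> : mxstar v *m (mxstar T *m Jm *m T) *m v =
    mxstar (T *m v) *m Jm *m (T *m v) by rewrite mxstarM !mulmxA.
rewrite !mxstar_Jm -cRN -cRD lecE /= => /andP[_].
have e0 : (T *m v) i0 ord0 = T i0 i0 * x + T i0 i1 * y.
  by rewrite mulmx2E !mxE.
have e1 : (T *m v) i1 ord0 = T i1 i0 * x + T i1 i1 * y.
  by rewrite mulmx2E !mxE.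
by rewrite e0 e1 !mxE /= subr_ge0.
Qed.

Section one_contraction.
Variable T : M2.
Hypothesis cT : disc_contraction T.

Let detT : T i0 i0 * T i1 i1 - T i0 i1 * T i1 i0 = 1.
Proof. by rewrite -det_mx2; case: cT. Qed.

(** The form at (z, 1) gives |a z + b| <= |c z + d|, so a zero denominator would force a zero
    numerator, against a (c z + d) - c (a z + b) = det T = 1. *)
Lemma den_neq0 z : modC z <= 1 -> den T z != 0.
Proof.
move=> z1; apply/eqP => d0.
have := proj2 cT z 1; rewrite !mulr1 -/(den T z) d0 modC0 modC1 expr1n expr0n/= subr0.
have h : modC z ^+ 2 <= 1 by rewrite expr_le1 ?modC_ge0.
move=> h1; have n0 : T i0 i0 * z + T i0 i1 = 0.
  apply: modC_eq0; apply/eqP; rewrite -sqrf_eq0 eq_le sqr_ge0 andbT.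
  by move: h1; lra.
have : T i0 i0 * (T i1 i0 * z + T i1 i1) - T i1 i0 * (T i0 i0 * z + T i0 i1) = 1.
  by rewrite -detT; ring.
by rewrite n0 -/(den T z) d0 !mulr0 subr0 => /esym/eqP; rewrite oner_eq0.
Qed.

Lemma mob_disc z : modC z <= 1 -> modC (mob T z) <= 1.
Proof.
move=> z1; have d0 := den_neq0 z1; rewrite /mob modCM modCV.
rewrite ler_pdivrMr ?modC_gt0// mul1r -ler_sqr ?nnegrE ?modC_ge0//.
have := proj2 cT z 1; rewrite !mulr1 -/(den T z) modC1 expr1n.
have h : modC z ^+ 2 <= 1 by rewrite expr_le1 ?modC_ge0.
lra.
Qed.

Lemma corner_ge1 : 1 <= modC (T i1 i1).
Proof.
have := proj2 cT 0 1; rewrite !mulr0 !add0r !mulr1 modC0 modC1 expr1n expr0n/=.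
have := sqr_ge0 (modC (T i0 i1)) => h1 h2.
by rewrite -(@expr_ge1 _ 2)// ?modC_ge0//; lra.
Qed.

Lemma entry01_le : modC (T i0 i1) <= modC (T i1 i1).
Proof.
rewrite -ler_sqr ?nnegrE ?modC_ge0//.
have := proj2 cT 0 1; rewrite !mulr0 !add0r !mulr1 modC0 modC1 expr1n expr0n/=; lra.
Qed.

(** Otherwise the pole -d/c would lie in the closed disc. *)
Lemma entry10_le : modC (T i1 i0) <= modC (T i1 i1).
Proof.
rewrite leNgt; apply/negP => lt.
have c0 : 0 < modC (T i1 i0) by exact: le_lt_trans (modC_ge0 _) lt.
have cn0 : T i1 i0 != 0 by rewrite -modC_gt0.
have /den_neq0/eqP : modC (- (T i1 i1 / T i1 i0)) <= 1.
  by rewrite modCN modCM modCV ler_pdivrMr// mul1r ltW.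
by apply; rewrite /den; field.
Qed.

Lemma entry00_le : modC (T i0 i0) <= 2 * modC (T i1 i1).
Proof.
have d1 := corner_ge1; have c1 := entry10_le.
rewrite -ler_sqr ?nnegrE ?modC_ge0 ?mulr_ge0 ?modC_ge0//.
have := proj2 cT 1 0; rewrite !mulr0 !addr0 !mulr1 modC0 modC1 expr1n expr0n/=.
have h : modC (T i1 i0) ^+ 2 <= modC (T i1 i1) ^+ 2 by rewrite ler_sqr ?nnegrE ?modC_ge0.
have h2 : 1 <= modC (T i1 i1) ^+ 2 by rewrite expr_ge1 ?modC_ge0.
by rewrite exprMn; lra.
Qed.

Lemma mxnorm_corner : mxnorm T <= 2 * modC (T i1 i1).
Proof.
have d1 := corner_ge1; apply: mxnorm_le; apply: ord2P; apply: ord2P.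
- exact: entry00_le.
- by have := entry01_le; lra.
- by have := entry10_le; lra.
- by lra.
Qed.

End one_contraction.

Lemma disc_contraction1 : disc_contraction 1%:M.
Proof.
split; first exact: det1.
by move=> x y; rewrite !mxE /= !mul1r !mul0r addr0 add0r.
Qed.

Lemma disc_contractionM T S : disc_contraction T -> disc_contraction S ->
  disc_contraction (T *m S).
Proof.
move=> [dT cT] [dS cS]; split; first by rewrite det_mulmx dT dS mulr1.
move=> x y; apply: le_trans (cS x y); rewrite !mulmx2E.
have := cT (S i0 i0 * x + S i0 i1 * y) (S i1 i0 * x + S i1 i1 * y).
by rewrite !mulrDl !mulrDr !mulrA !addrA ![_ + _ * x + _]addrAC.
Qed.

Lemma prodmxD (X : nat -> M2) m n :
  prodmx X (m + n) = prodmx (fun i => X (m + i)%N) n *m prodmx X m.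
Proof.
elim: n => [|n IH]; first by rewrite addn0 mul1mx.
by rewrite addnS /= IH mulmxA.
Qed.

Lemma prodmx_contraction (X : nat -> M2) n :
  (forall i, disc_contraction (X i)) -> disc_contraction (prodmx X n).
Proof.
move=> h; elim: n => [|n IH]; first exact: disc_contraction1.
exact: disc_contractionM.
Qed.

Definition orbit0 (X : nat -> M2) n : C := mob (prodmx X n) 0.
Definition logcorner (X : nat -> M2) n : R := ln (modC (prodmx X n i1 i1)).

Section products.
Variable X : nat -> M2.
Hypothesis cX : forall i, disc_contraction (X i).

Let S n := prodmx X n.
Let corner_neq0 n : S n i1 i1 != 0.
Proof.
rewrite -modC_gt0; exact: lt_le_trans ltr01 (corner_ge1 (prodmx_contraction n cX)).
Qed.
Let corner_gt0 n : 0 < modC (S n i1 i1). Proof. by rewrite modC_gt0. Qed.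

Lemma orbit0_disc n : modC (orbit0 X n) <= 1.
Proof. by apply: mob_disc; [exact: prodmx_contraction|rewrite modC0]. Qed.

Lemma orbit0E n : orbit0 X n = S n i0 i1 / S n i1 i1.
Proof. by rewrite /orbit0 /mob /den !mulr0 !add0r. Qed.

(** The new corner is c b_N + d d_N, and the orbit point is b_N / d_N. *)
Lemma cornerS n : S n.+1 i1 i1 = den (X n) (orbit0 X n) * S n i1 i1.
Proof.
by rewrite orbit0E /den /S /= mulmx2E; field; exact: (corner_neq0 n).
Qed.

Lemma orbit0S n : orbit0 X n.+1 = mob (X n) (orbit0 X n).
Proof.
have hd := den_neq0 (cX n) (orbit0_disc n).
have h1 : S n.+1 i0 i1 = (X n i0 i0 * orbit0 X n + X n i0 i1) * S n i1 i1.
  by rewrite orbit0E /S /= mulmx2E; field; exact: (corner_neq0 n).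
by rewrite {1}orbit0E cornerS h1 /mob -mulf_div divff// mulr1.
Qed.

Lemma logcornerS n :
  logcorner X n.+1 = ln (modC (den (X n) (orbit0 X n))) + logcorner X n.
Proof.
rewrite /logcorner -/(S _) cornerS modCM lnM// posrE ?modC_gt0//.
exact: (den_neq0 (cX n) (orbit0_disc n)).
Qed.

Lemma logcorner0 : logcorner X 0 = 0.
Proof. by rewrite /logcorner /= mxE /= modC1 ln1. Qed.

Lemma logcorner_ge0 n : 0 <= logcorner X n.
Proof. by rewrite ln_ge0//; exact: corner_ge1 (prodmx_contraction n cX). Qed.

Lemma lyap_logcorner n :
  `|n%:R * lyap_seq X n - logcorner X n| <= ln 2 \/ n = 0%N.
Proof.
case: n => [|n]; [by right|left].
rewrite /lyap_seq mulrA mulfV ?pnatr_eq0// mul1r.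
have h1 : modC (S n.+1 i1 i1) <= mxnorm (S n.+1) by exact: mxnorm_entry.
have h2 := mxnorm_corner (prodmx_contraction n.+1 cX).
have p0 : 0 < mxnorm (S n.+1) by exact: lt_le_trans (corner_gt0 _) h1.
rewrite ger0_norm ?subr_ge0 ?ler_ln ?posrE//.
by rewrite lerBlDr /logcorner -lnM ?posrE// ler_ln// posrE mulr_gt0.
Qed.

(** The corner of a product is c_2 b_1 + d_2 d_1, both terms being at most |d_2 d_1|; this is the
    origin of ln 2. *)
Lemma logcornerD m n : logcorner X (m + n) <=
  logcorner X m + (logcorner (fun i => X (m + i)%N) n + ln 2).
Proof.
have cX' i : disc_contraction (X (m + i)%N) by [].
have c2 := prodmx_contraction n cX'.
have c1 := prodmx_contraction m cX.
have d2 := lt_le_trans ltr01 (corner_ge1 c2).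
rewrite /logcorner -!lnM ?posrE ?mulr_gt0//.
rewrite ler_ln ?posrE ?mulr_gt0// prodmxD mulmx2E.
rewrite (le_trans (modCD _ _))// !modCM.
have h1 := entry01_le c1; have h2 := entry10_le c2.
have h3 := ler_pM (modC_ge0 _) (modC_ge0 _) h2 h1.
rewrite -/(S m) in h3 *; lra.
Qed.

(** The shifted product is recovered by multiplying on the right with the inverse of the first
    factor, whose entries are those of the factor up to sign and order because its determinant is 1.
    This yields [v_shift]. *)
Lemma logcorner_shift (K : R) n : 1 <= K -> mxnorm (X 0%N) <= K ->
  logcorner (fun i => X (1 + i)%N) n <= logcorner X n.+1 + ln (2 * K).
Proof.
move=> K1 XK.
have cX' i : disc_contraction (X (1 + i)%N) by [].
have c2 := prodmx_contraction n cX'.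
have d2 := lt_le_trans ltr01 (corner_ge1 c2).
have c1 := prodmx_contraction n.+1 cX.
have K2 : 0 < 2 * K by lra.
rewrite /logcorner -lnM ?posrE//.
rewrite ler_ln ?posrE ?mulr_gt0//; last lra.
set A := prodmx _ n in c2 d2 *.
have e : prodmx X n.+1 = A *m X 0%N.
  by transitivity (prodmx X (1 + n)); rewrite // prodmxD /= mulmx1.
have -> : A i1 i1 = prodmx X n.+1 i1 i1 * X 0%N i0 i0 - prodmx X n.+1 i1 i0 * X 0%N i0 i1.
  have := proj1 (cX 0%N); rewrite det_mx2 e !mulmx2E => h.
  by rewrite -[LHS]mulr1 -h; ring.
rewrite (le_trans (modCB _ _))// !modCM.
have h0 := entry10_le c1.
have h1 := le_trans (mxnorm_entry (X 0%N) i0 i0) XK.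
have h2 := le_trans (mxnorm_entry (X 0%N) i0 i1) XK.
have g1 := ler_pM (modC_ge0 _) (modC_ge0 _) (lexx (modC (prodmx X n.+1 i1 i1))) h1.
have g2 := ler_pM (modC_ge0 _) (modC_ge0 _) h0 h2.
lra.
Qed.

End products.
End disc_action.

(** * Measurability of complex functions *)

Section complex_measurability.
Context {R : realType} {d : measure_display} {Y : measurableType d}.
Local Notation C := (Cx R).
Implicit Types f g : Y -> C.

Definition cmeas f := measurable_fun setT (fun y => reC (f y)) /\
  measurable_fun setT (fun y => imC (f y)).

Lemma cmeas_cst (c : C) : cmeas (fun=> c).
Proof. by split; exact: measurable_cst. Qed.

Lemma eq_cmeas f g : cmeas f -> (forall y, f y = g y) -> cmeas g.
Proof. by move=> + /funext <-. Qed.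

Lemma cmeasD f g : cmeas f -> cmeas g -> cmeas (fun y => f y + g y).
Proof.
move=> [f1 f2] [g1 g2]; split.
  by under eq_fun do rewrite reCD; exact: measurable_funD.
by under eq_fun do rewrite imCD; exact: measurable_funD.
Qed.

Lemma cmeasM f g : cmeas f -> cmeas g -> cmeas (fun y => f y * g y).
Proof.
move=> [f1 f2] [g1 g2]; split.
  by under eq_fun do rewrite reCM; apply: measurable_funB; exact: measurable_funM.
by under eq_fun do rewrite imCM; apply: measurable_funD; exact: measurable_funM.
Qed.

Lemma cmeas_cR (f : Y -> R) : measurable_fun setT f -> cmeas (fun y => cR (f y)).
Proof. by move=> h; split => //; exact: measurable_cst. Qed.

Lemma measurable_modC_sq f : cmeas f -> measurable_fun setT (fun y => modC (f y) ^+ 2).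
Proof.
move=> [f1 f2]; under eq_fun do rewrite modC_sq.
by apply: measurable_funD; exact: measurable_funX.
Qed.

Lemma measurable_ln_modC f : cmeas f -> (forall y, f y != 0) ->
  measurable_fun setT (fun y => ln (modC (f y))).
Proof.
move=> mf f0.
have -> : (fun y => ln (modC (f y))) = (fun y => 2^-1 * ln (modC (f y) ^+ 2)).
  apply/funext => y; rewrite lnXn ?modC_gt0//.
  by rewrite -[X in 2^-1 * X]mulr_natl mulrA mulVf ?mul1r.
apply: measurable_funM; first exact: measurable_cst.
by apply: (measurableT_comp (@measurable_ln R)); exact: measurable_modC_sq.
Qed.

Lemma cmeasV f : cmeas f -> (forall y, f y != 0) -> cmeas (fun y => (f y)^-1).
Proof.
move=> mf f0.
(* 1/f = conj f / |f|^2, and 1/|f|^2 = exp (- 2 ln |f|). *)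
have m1 : cmeas (fun y => cR (expR (- (2 * ln (modC (f y)))))).
  apply: cmeas_cR; apply: (measurableT_comp (@measurable_expR R)).
  apply: measurableT_comp => //; apply: measurable_funM; first exact: measurable_cst.
  exact: measurable_ln_modC.
have m2 : cmeas (fun y => Num.conj (f y)).
  case: mf => [f1 f2]; split.
    by under eq_fun do rewrite reC_conj.
  by under eq_fun do rewrite imC_conj; exact: measurableT_comp.
have -> : (fun y => (f y)^-1) =
    (fun y => Num.conj (f y) * cR (expR (- (2 * ln (modC (f y)))))).
  apply/funext => y; apply: (@mulfI _ (f y)) => //; rewrite mulfV//.
  rewrite mulrA [f y * _]mulrC conj_mul_modC -cRM expRN.
  have m0 : 0 < modC (f y) by rewrite modC_gt0.
  have -> : 2 * ln (modC (f y)) = ln (modC (f y) ^+ 2).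
    by rewrite lnXn// mulr_natl.
  by rewrite lnK ?posrE ?exprn_gt0// mulfV// gt_eqF// exprn_gt0.
exact: cmeasM.
Qed.

End complex_measurability.

Lemma cmeas_comp {R : realType} d1 d2 (Y : measurableType d1) (Z : measurableType d2)
    (g : Y -> Z) (f : Z -> Cx R) :
  measurable_fun setT g -> cmeas f -> cmeas (fun y => f (g y)).
Proof.
move=> mg [f1 f2]; split.
  exact: (measurableT_comp f1 mg).
exact: (measurableT_comp f2 mg).
Qed.

(** * Lyapunov exponent of a random product of contractions *)

Section random_product.
Context {R : realType} {d : measure_display} {Sig : measurableType d}.
Variable P : probability Sig R.
Local Notation C := (Cx R).
Variable M : Sig -> 'M[C]_2.
Hypothesis mM : forall i j, cmeas (fun s => M s i j).
Hypothesis cM : forall s, disc_contraction (M s).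
Variable K : R.
Hypothesis K1 : 1 <= K.
Hypothesis MK : forall s, mxnorm (M s) <= K.
Variables al be : C.
Let h (z : C) : R := reC (al * z + be * z ^+ 2).
Let H : R := modC al + modC be.

Let hH z : modC z <= 1 -> `|h z| <= H.
Proof.
move=> z1; apply: le_trans (re_le_modC _) _.
rewrite (le_trans (modCD _ _))// lerD// !modCM ?ler_piMr ?modC_ge0//.
by rewrite -[leRHS]mulr1 ler_pM ?modC_ge0.
Qed.

Let step s z : R := ln (modC (den (M s) z)) + h (mob (M s) z) - h z.

Variables (target err : R).
Hypothesis mean_step : forall z, modC z <= 1 ->
  `|Exp P (fun s => step s z) - target| <= err.

Let path (x : seqs Sig) : nat -> 'M[C]_2 := fun n => M (x n).
Let cpath x i : disc_contraction (path x i). Proof. exact: cM. Qed.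

Let path_past n i j : past_fun n (fun x => prodmx (path x) n i j).
Proof.
move=> x y xy; suff -> : prodmx (path x) n = prodmx (path y) n by [].
elim: n xy => [|n IH] xy //=; rewrite IH; last by move=> l ln; rewrite xy// ltnW.
by rewrite /path xy.
Qed.

Let mprod n i j : cmeas (fun x => prodmx (path x) n i j).
Proof.
elim: n i j => [|n IH] i j; first exact: cmeas_cst.
have mc k l : cmeas (fun x : seqs Sig => M (x n) k l).
  exact: (cmeas_comp (measurable_coord n) (mM _ _)).
apply: (eq_cmeas (cmeasD (cmeasM (mc i i0) (IH i0 j)) (cmeasM (mc i i1) (IH i1 j)))) => x.
by rewrite /= mulmx2E.
Qed.

Let corner_neq0 x n : prodmx (path x) n i1 i1 != 0.
Proof.
rewrite -modC_gt0; apply: lt_le_trans ltr01 _; apply: corner_ge1.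
exact: prodmx_contraction.
Qed.

Let morbit n : cmeas (fun x => orbit0 (path x) n).
Proof.
apply: (eq_cmeas (cmeasM (mprod n i0 i1) (cmeasV (mprod n i1 i1) (corner_neq0 ^~ n)))) => x.
by rewrite orbit0E.
Qed.

Let mstep n : measurable_fun setT (fun xs : seqs Sig * Sig =>
  step xs.2 (orbit0 (path xs.1) n)).
Proof.
have mz : cmeas (fun xs : seqs Sig * Sig => orbit0 (path xs.1) n).
  exact: (cmeas_comp measurable_fst (morbit n)).
have mE i j : cmeas (fun xs : seqs Sig * Sig => M xs.2 i j).
  exact: (cmeas_comp measurable_snd (mM i j)).
have d0 (xs : seqs Sig * Sig) : den (M xs.2) (orbit0 (path xs.1) n) != 0.
  by apply: den_neq0 => //; exact: orbit0_disc.
have md : cmeas (fun xs : seqs Sig * Sig => den (M xs.2) (orbit0 (path xs.1) n)).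
  by apply: cmeasD => //; exact: cmeasM.
have mm : cmeas (fun xs : seqs Sig * Sig => mob (M xs.2) (orbit0 (path xs.1) n)).
  apply: cmeasM; last exact: cmeasV.
  by apply: cmeasD => //; exact: cmeasM.
have mh (f : seqs Sig * Sig -> C) : cmeas f -> measurable_fun setT (fun xs => h (f xs)).
  move=> mf; have [] // : cmeas (fun xs => al * f xs + be * f xs ^+ 2).
  apply: cmeasD; apply: cmeasM => //; try exact: cmeas_cst.
  by apply: eq_cmeas (cmeasM mf mf) _ => y; rewrite expr2.
apply: measurable_funB; last exact: mh.
apply: measurable_funD; last exact: mh.
exact: measurable_ln_modC.
Qed.

Let K0 : 0 < K. Proof. exact: lt_le_trans ltr01 K1. Qed.
Let K30 : 0 < 3 * K. Proof. by rewrite mulr_gt0. Qed.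

(** The denominator stays away from 0: with |a z + b| <= |c z + d| the identity a (c z + d) - c (a z
    + b) = 1 gives 1 <= 2 K |c z + d|. *)
Let step_bounded : exists B : R, forall s z, modC z <= 1 -> `|step s z| <= B.
Proof.
have dlow s z : modC z <= 1 -> (3 * K)^-1 <= modC (den (M s) z).
  move=> z1; have d0 := den_neq0 (cM s) z1.
  have dz : modC (M s i0 i0 * z + M s i0 i1) <= modC (den (M s) z).
    have := mob_disc (cM s) z1; rewrite /mob modCM modCV ler_pdivrMr ?modC_gt0//.
    by rewrite mul1r.
  have e1 : M s i0 i0 * den (M s) z - M s i1 i0 * (M s i0 i0 * z + M s i0 i1) = 1.
    by have := proj1 (cM s); rewrite det_mx2 => <-; rewrite /den; ring.
  have h0 := le_trans (mxnorm_entry (M s) i0 i0) (MK s).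
  have h1 := le_trans (mxnorm_entry (M s) i1 i0) (MK s).
  have : 1 <= K * modC (den (M s) z) + K * modC (den (M s) z).
    rewrite -(@modC1 R) -e1 (le_trans (modCB _ _))// !modCM lerD//.
      by rewrite ler_wpM2r ?modC_ge0.
    by rewrite ler_pM ?modC_ge0.
  have dg : 0 < modC (den (M s) z) by rewrite modC_gt0.
  by move=> h2; rewrite -div1r ler_pdivrMr//; have := mulr_gt0 K0 dg; lra.
have dup s z : modC z <= 1 -> modC (den (M s) z) <= 3 * K.
  move=> z1; rewrite (le_trans (modCD _ _))// modCM.
  have h0 := le_trans (mxnorm_entry (M s) i1 i0) (MK s).
  have h1 := le_trans (mxnorm_entry (M s) i1 i1) (MK s).
  have := K1; have := ler_pM (modC_ge0 _) (modC_ge0 _) h0 z1; lra.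
exists (ln (3 * K) + H + H) => s z z1.
have dg : 0 < modC (den (M s) z) by rewrite modC_gt0; exact: (den_neq0 (cM s) z1).
rewrite (le_trans (ler_normB _ _))// lerD ?hH// (le_trans (ler_normD _ _))//.
apply: lerD; last by apply: hH; exact: (mob_disc (cM s) z1).
rewrite ler_norml; apply/andP; split.
  by rewrite -lnV ?posrE// ler_ln ?posrE ?invr_gt0// dlow.
by rewrite ler_ln ?posrE// dup.
Qed.

(** The corrector leaves boundary terms only, so it changes the mean of a step but not the growth
    rate. *)
Let telescope (x : seqs Sig) N :
  \sum_(i < N) step (x i) (orbit0 (path x) i) =
  logcorner (path x) N + h (orbit0 (path x) N) - h (orbit0 (path x) 0).
Proof.
elim: N => [|N IH]; first by rewrite big_ord0 logcorner0; ring.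
rewrite big_ord_recr /= IH /step.
rewrite (logcornerS (cpath x)) (orbit0S (cpath x)) -[M (x N)]/(path x N); ring.
Qed.

(** Subadditivity gives the existence of the limit [g] without its value; the martingale law locates
    averages within [err] of [target] without convergence. *)
Lemma random_product_law (mu : probability (seqs Sig) R) :
  (forall A n, (forall i, measurable (A i)) ->
     mu (cyl A n) = (\prod_(i < n) P (A i))%E) ->
  {ae mu, forall x : seqs Sig, exists g : R,
    lyap_seq (fun n => M (x n)) @ \oo --> g /\ `|g - target| <= err}.
Proof.
move=> hmu.
have [B0 hB0] := step_bounded.
have pastz n x y : (forall i, (i < n)%N -> x i = y i) ->
    orbit0 (path x) n = orbit0 (path y) n.
  by move=> xy; rewrite !orbit0E !(path_past _ _ xy).
have SL := strong_law_martingale hmu (phi := fun n xs => step xs.2 (orbit0 (path xs.1) n))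
  (M := B0) mstep (fun n xs => hB0 xs.2 _ (orbit0_disc (cpath xs.1) n))
  (fun n s x y xy => congr1 (step s) (pastz n x y xy)).
(* Adding ln 2 turns the near subadditivity of [logcornerD] into an exact one. *)
pose v n (x : seqs Sig) := logcorner (path x) n + ln 2.
have ln20 : 0 <= ln 2 :> R by rewrite ln_ge0// ler1n.
have lnK0 : 0 <= ln K by rewrite ln_ge0.
have [g KG] : exists t : R, {ae mu, forall x, v n x / n%:R @[n --> \oo] --> t}.
  apply: (@kingman _ _ _ P mu hmu v (ln (2 * K))).
  - move=> n; apply: measurable_funD; last exact: measurable_cst.
    by apply: measurable_ln_modC; [exact: mprod|].
  - by move=> n x y xy; rewrite /v /logcorner (path_past _ _ xy).
  - by move=> n x; rewrite addr_ge0// logcorner_ge0.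
  - by move=> x; rewrite /v logcorner0 add0r lnM ?posrE// lerDl.
  - move=> x; rewrite /v lnM ?posrE// addrC lerD2l /logcorner.
    have := mxnorm_entry (prodmx (path x) 1) i1 i1; rewrite /= mulmx1.
    move=> /le_trans /(_ (MK (x 0%N))) hK; rewrite ler_ln ?posrE//.
    by apply: lt_le_trans ltr01 _; exact: corner_ge1 (cM _).
  - move=> m n x; rewrite /v; have := logcornerD (cpath x) m n; rewrite /path /shift; lra.
  - move=> n x; rewrite /v -addrA [ln 2 + _]addrC addrA lerD2r.
    exact: (logcorner_shift (cpath x) n K1 (MK _)).
apply: filterS2 SL KG => x SL KG; exists g.
have lyapv : tends0 (fun n => lyap_seq (path x) n - v n x / n%:R).
  move=> e e0; have [N hN] := tends0_inv (2 * ln 2) e0.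
  exists N.+1 => -[//|n] Nn; apply: le_trans (hN n Nn).
  have n0 : 0 < n.+1%:R :> R by rewrite ltr0n.
  have [hl|//] := lyap_logcorner (cpath x) n.+1.
  have -> : lyap_seq (path x) n.+1 - v n.+1 x / n.+1%:R =
     (n.+1%:R * lyap_seq (path x) n.+1 - logcorner (path x) n.+1 - ln 2) / n.+1%:R.
    by rewrite /v; field; rewrite gt_eqF.
  rewrite !normrM normfV ler_wpM2r ?invr_ge0//.
  rewrite (le_trans (ler_normB _ _))// [`|ln 2|]ger0_norm//.
  by rewrite [`|2|]ger0_norm//; lra.
have vg : tends0 (fun n => v n x / n%:R - g).
  by apply: tends0_cvg; rewrite -(subrr g); apply: cvgB => //; exact: cvg_cst.
split.
  apply: cvg_tends0 => e e0.
  have [N1 h1] := lyapv (e / 2) ltac:(lra); have [N2 h2] := vg (e / 2) ltac:(lra).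
  exists (maxn N1 N2) => n; rewrite geq_max => /andP[/h1 {}h1 /h2 {}h2].
  rewrite -(subrKA (v n x / n%:R)) (le_trans (ler_normD _ _))//.
  by rewrite [e]splitr lerD.
apply/ler_addgt0Pr => e e0.
have [N1 h1] := vg (e / 3) ltac:(lra).
have [N2 h2] := SL (e / 3) ltac:(lra).
have [N3 h3] := tends0_inv (ln 2 + H + H) (ltac:(lra) : 0 < e / 3).
(* As convergence to [g] is known, a single n at which all three errors are at most e/3 suffices. *)
pose n := (maxn N1 (maxn N2 N3)).+1.
have n0 : 0 < n%:R :> R by rewrite ltr0n.
have {}h1 := h1 n (leq_trans (leq_maxl _ _) (leqnSn _)).
have {}h2 := h2 n (leq_trans (leq_trans (leq_maxl _ _) (leq_maxr _ _)) (leqnSn _)).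
have {}h3 := h3 n.-1 (leq_trans (leq_maxr _ _) (leq_maxr _ _)).
rewrite sumrB telescope /= in h2.
set T := \sum_(i < n) _ in h2.
have hT : `|T - n%:R * target| <= n%:R * err.
  have -> : n%:R * target = \sum_(i < n) target by rewrite sumr_const card_ord mulr_natl.
  have -> : n%:R * err = \sum_(i < n) err by rewrite sumr_const card_ord mulr_natl.
  rewrite /T -sumrB (le_trans (ler_norm_sum _ _ _))//; apply: ler_sum => i _.
  by apply: mean_step; exact: orbit0_disc.
have {}h1 : `|v n x - n%:R * g| <= n%:R * (e / 3).
  rewrite -[leRHS]mulrC -ler_pdivrMr// -[X in _ / X]ger0_norm; last exact: ltW.
  by rewrite -normf_div mulrBl mulrAC mulfV ?mul1r// gt_eqF.
have hz n' := hH (orbit0_disc (cpath x) n').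
rewrite normf_div (ger0_norm (ltW n0)) ler_pdivrMr// in h2.
have {}h3 : ln 2 + H + H <= e / 3 * n%:R.
  by move: h3 => /(le_trans (ler_norm _)); rewrite ler_pdivrMr//.
have : n%:R * `|g - target| <= n%:R * (err + e).
  rewrite -[X in X * _]ger0_norm; last exact: ltW.
  rewrite -normrM.
  have -> : n%:R * (g - target) = - (v n x - n%:R * g) +
     ((logcorner (path x) n + h (orbit0 (path x) n) - h (orbit0 (path x) 0) - T) +
     (T - n%:R * target) + (ln 2 - h (orbit0 (path x) n) + h (orbit0 (path x) 0))).
    by rewrite /v; ring.
  rewrite (le_trans (ler_normD _ _))// normrN (le_trans (lerD (lexx _) (ler_normD _ _)))//.
  have q1 := ler_normD (logcorner (path x) n + h (orbit0 (path x) n) - h (orbit0 (path x) 0) - T) (T - n%:R * target).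
  have q2 : `|ln 2 - h (orbit0 (path x) n) + h (orbit0 (path x) 0)| <= ln 2 + H + H.
    rewrite (le_trans (ler_normD _ _))// lerD ?hz//.
    by rewrite (le_trans (ler_normB _ _))// lerD ?hz// ger0_norm.
  by lra.
by rewrite ler_pM2l.
Qed.

(** The claim depends on the sample path only, so it is proved for the image of [Qm] on sequences
    and the exceptional set is pulled back. *)
Lemma random_product_iid d' (Om : measurableType d') (Qm : probability Om R)
    (sq : nat -> Om -> Sig) : iid_seq P Qm sq ->
  {ae Qm, forall w, exists g : R,
    lyap_seq (fun n => M (sq n w)) @ \oo --> g /\ `|g - target| <= err}.
Proof.
move=> [msq law indep].
pose F (w : Om) : seqs Sig := fun n => sq n w.
have mF : measurable_fun setT F by exact: measurable_fun_seqs.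
pose Fm := @MeasurableFun.Pack _ _ Om (seqs Sig) F
  (MeasurableFun.Class (isMeasurableFun.Build _ _ Om (seqs Sig) F mF)).
pose mu : probability (seqs Sig) R := [the probability _ _ of distribution Qm Fm].
have hmu A n : (forall i, measurable (A i)) -> mu (cyl A n) = (\prod_(i < n) P (A i))%E.
  move=> mA; transitivity (Qm (\bigcap_(i in [set` iota 0 n]) (sq i @^-1` A i))).
    rewrite /= /distribution /pushforward; congr (Qm _).
    apply/seteqP; split=> w /= hw i.
      move=> hi; have : i \in iota 0 n by exact: hi.
      by rewrite mem_iota add0n => /andP[_ /hw].
    by move=> ni; apply: hw => /=; rewrite mem_iota.
  rewrite indep ?iota_uniq//.
  rewrite (_ : iota 0 n = index_iota 0 n) ?big_mkord; last by rewrite /index_iota subn0.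
  by apply: eq_bigr => i _; rewrite law.
have [N [mN N0 hN]] := random_product_law hmu.
exists (F @^-1` N); split => //.
  by have := mF measurableT N mN; rewrite setTI.
by move=> w /= nw; apply: (hN (F w)).
Qed.

End random_product.

(** * Uniform expansion for the small noise family *)

Lemma su11_coord_bound {R : realType} (A : 'M[Cx R]_2) (x y z : R) :
  su11_coord A x y z -> [/\ `|x| <= mxnorm A, `|y| <= mxnorm A & `|z| <= mxnorm A].
Proof.
move=> [h00 _ h10 _]; have e0 := mxnorm_entry A i0 i0; have e1 := mxnorm_entry A i1 i0.
have hr := le_trans (re_le_modC _) e1; have hi := le_trans (im_le_modC _) e1.
move: hr hi e0; rewrite h10 h00 modCM modC_cI mul1r modC_cR.
rewrite reCD imCD reCN imCN reCM imCM /= !(mul0r, mulr0, mul1r, subr0, addr0, add0r, oppr0).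
by rewrite normrN.
Qed.

Lemma modC_ExpC_le {R : realType} d (X : measurableType d) (P : probability X R)
    (f : X -> Cx R) (K : R) :
  cbmeas f -> (forall s, modC (f s) <= K) -> modC (ExpC P f) <= 2 * K.
Proof.
move=> [f1 f2] fK; rewrite (le_trans (modC_le_reim _))// reC_ExpC imC_ExpC.
rewrite mulr_natl mulr2n lerD//; apply: Exp_le_norm => // s.
  exact: le_trans (re_le_modC _) (fK s).
exact: le_trans (im_le_modC _) (fK s).
Qed.

Lemma cbmeas_of {R : realType} d (X : measurableType d) (f : X -> Cx R) (K : R) :
  cmeas f -> (forall s, modC (f s) <= K) -> cbmeas f.
Proof.
move=> [f1 f2] fK; split; split => //; exists K => s.
  exact: le_trans (re_le_modC _) (fK s).
exact: le_trans (im_le_modC _) (fK s).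
Qed.

Section small_noise.
Context {R : realType} {d : measure_display} {Sig : measurableType d}.
Variable P : probability Sig R.
Local Notation C := (Cx R).
Local Notation M2 := ('M[C]_2).
Variables (T : R -> C -> Sig -> M2) (eta : Sig -> R) (PP PP' Q : Sig -> M2)
  (p1 p2 p3 q1 q2 q3 : Sig -> R) (r0 : R).
Hypothesis r00 : 0 < r0.
Hypothesis hPP : forall s, su11_coord (PP s) (p1 s) (p2 s) (p3 s).
Hypothesis hQ : forall s, su11_coord (Q s) (q1 s) (q2 s) (q3 s).
Hypothesis hPP' : forall s, su11 (PP' s).
Variable Kb : R.
Hypothesis hKb : forall s,
  [/\ mxnorm (PP s) <= Kb, mxnorm (PP' s) <= Kb & mxnorm (Q s) <= Kb].
Variable Ke : R.
Hypothesis hexp : forall (e dl : R) s, `|e| < r0 -> 0 <= dl < r0 ->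
  exists Er : M2, mxnorm Er <= Ke * (`|e| ^+ 3 + `|e| * dl + dl ^+ 2) /\
  T e (cR dl) s = Rot (eta s) *m
    mexp (cR e *: PP s + cR (e ^+ 2) *: PP' s + (cI * cR dl) *: Q s + Er).

(* An index of the asymptotic estimates is a tuple (eps, delta, sigma, z). *)
Let I := (R * R * Sig * C)%type.
Let e_ (i : I) : R := i.1.1.1.
Let dl_ (i : I) : R := i.1.1.2.
Let s_ (i : I) : Sig := i.1.2.
Let z_ (i : I) : C := i.2.
Let Dr (r : R) : set I := [set i | [/\ `|e_ i| < r, 0 <= dl_ i < r & modC (z_ i) <= 1]].

Let uF s : C := expi (2 * eta s).
Let betaF s : C := cR (p1 s) - cI * cR (p2 s).
Let betacF s : C := Num.conj (betaF s).
Let pF s : C := cR (p3 s).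
(** Entries of R_{-eta} T, that is of the exponential factor. Removing the rotation multiplies the
    denominator by a phase, invisible to the modulus, and leaves the factor [uF] in front of the
    Moebius image. *)
Let aF e dl s : C := expi (- eta s) * T e (cR dl) s i0 i0.
Let bF e dl s : C := expi (- eta s) * T e (cR dl) s i0 i1.
Let cF e dl s : C := expi (eta s) * T e (cR dl) s i1 i0.
Let dF e dl s : C := expi (eta s) * T e (cR dl) s i1 i1.
Let rhoF e dl s : R := e ^+ 2 * (p1 s ^+ 2 + p2 s ^+ 2 - p3 s ^+ 2) / 2 + dl * q3 s.

Let a_ i := aF (e_ i) (dl_ i) (s_ i).
Let b_ i := bF (e_ i) (dl_ i) (s_ i).
Let c_ i := cF (e_ i) (dl_ i) (s_ i).
Let d_ i := dF (e_ i) (dl_ i) (s_ i).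
Let rho_ i := rhoF (e_ i) (dl_ i) (s_ i).
Let O r := wO (Dr r) e_ dl_.

Let betacE s : betacF s = cR (p1 s) + cI * cR (p2 s).
Proof.
apply: complex_ext; rewrite /betacF /betaF ?reC_conj ?imC_conj ?(reCD, imCD, reCN, imCN, reCM, imCM) /=; ring.
Qed.

Let Dr_small r i : r <= 1 -> Dr r i -> unit_range (e_ i) (dl_ i).
Proof.
move=> r1 [h1 /andP[h2 h3] _]; split; first by rewrite ltW// (lt_le_trans h1).
by rewrite h2 ltW// (lt_le_trans h3).
Qed.

Let Dr_mono r r' : r <= r' -> Dr r `<=` Dr r'.
Proof.
move=> rr i [h1 /andP[h2 h3] h4]; split=> //; first exact: lt_le_trans h1 rr.
by rewrite h2 (lt_le_trans h3).
Qed.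

Let real_bounded (f : Sig -> R) : (forall s, `|f s| <= Kb) ->
  forall r, O r 0 (fun i => cR (f (s_ i))).
Proof. by move=> h r; apply: (@wO_bounded _ _ _ _ _ _ Kb) => i _; rewrite modC_cR. Qed.

Let p_bound s : [/\ `|p1 s| <= Kb, `|p2 s| <= Kb & `|p3 s| <= Kb].
Proof.
have [h _ _] := hKb s; have [h1 h2 h3] := su11_coord_bound (hPP s).
by split; [exact: le_trans h1 h|exact: le_trans h2 h|exact: le_trans h3 h].
Qed.

Let q_bound s : [/\ `|q1 s| <= Kb, `|q2 s| <= Kb & `|q3 s| <= Kb].
Proof.
have [_ _ h] := hKb s; have [h1 h2 h3] := su11_coord_bound (hQ s).
by split; [exact: le_trans h1 h|exact: le_trans h2 h|exact: le_trans h3 h].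
Qed.

Let p1O := real_bounded (fun s => let: And3 h _ _ := p_bound s in h).
Let p2O := real_bounded (fun s => let: And3 _ h _ := p_bound s in h).
Let p3O := real_bounded (fun s => let: And3 _ _ h := p_bound s in h).
Let q1O := real_bounded (fun s => let: And3 h _ _ := q_bound s in h).
Let q2O := real_bounded (fun s => let: And3 _ h _ := q_bound s in h).
Let q3O := real_bounded (fun s => let: And3 _ _ h := q_bound s in h).

Let zO r : O r 0 z_.
Proof. by apply: (@wO_bounded _ _ _ _ _ _ 1) => i [_ _]. Qed.

Let uO r : O r 0 (fun i => uF (s_ i)).
Proof. by apply: (@wO_bounded _ _ _ _ _ _ 1) => i _; rewrite modC_expi. Qed.

Let betaO r : O r 0 (fun i => betaF (s_ i)).
Proof.
apply: (@wO_bounded _ _ _ _ _ _ (Kb + Kb)) => i _.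
have [h1 h2 _] := p_bound (s_ i).
by rewrite (le_trans (modCB _ _))// modCM modC_cI mul1r !modC_cR lerD.
Qed.

Let betacO r : O r 0 (fun i => betacF (s_ i)).
Proof. by apply: wO_le (betaO r) _ => i _; rewrite modC_conj. Qed.

Let expansions r := [/\
  O r 2 (fun i => a_ i - 1 - cR (e_ i) * (cI * pF (s_ i))),
  O r 2 (fun i => b_ i - cR (e_ i) * betacF (s_ i)),
  O r 2 (fun i => c_ i - cR (e_ i) * betaF (s_ i)),
  O r 2 (fun i => d_ i - 1 - cR (e_ i) * - (cI * pF (s_ i))) &
  O r 3 (fun i => cR (reC (d_ i - 1) - rho_ i))].

Let expansions_mono r r' : r <= r' -> expansions r' -> expansions r.
Proof.
by move=> rr [h1 h2 h3 h4 h5]; split; apply: wO_sub (Dr_mono rr) _.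
Qed.

(** As |e| + dl <= 2 r', taking r' <= 1/(16 (K+1)) gives 1/8, the range of [ln_modC_order2]; this
    also gives the 1/2 demanded by [mexp_order2]. *)
Let shrink (r K : R) : 0 < r -> 0 <= K -> exists2 r', 0 < r' <= r &
  forall i, Dr r' i -> K * weight (e_ i) (dl_ i) 1 <= 8^-1.
Proof.
move=> r_gt0 K0; exists (Num.min r (16 * (K + 1))^-1).
  by rewrite lt_min r_gt0 invr_gt0 ge_min lexx /= andbT; lra.
move=> i [h1 /andP[h2 h3] _]; rewrite /weight /=.
set r' := Num.min _ _ in h1 h3.
have h4 : r' <= (16 * (K + 1))^-1 by rewrite ge_min lexx orbT.
have K1 : 0 < 16 * (K + 1) by lra.
have : `|e_ i| + dl_ i <= 2 * (16 * (K + 1))^-1 by lra.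
move=> /(ler_wpM2l K0) /le_trans; apply.
by rewrite mulrCA mulrA ler_pdivrMr//; lra.
Qed.

Lemma expansions_near0 : exists r, [/\ 0 < r, r <= r0, r <= 1 & expansions r].
Proof.
pose r1 := Num.min r0 1.
have r10 : 0 < r1 by rewrite lt_min r00 ltr01.
have r1r0 : r1 <= r0 by rewrite ge_min lexx.
have r11 : r1 <= 1 by rewrite ge_min lexx orbT.
(* The error matrix is given separately for each parameter and sample; choice makes it a function of
   the index, so that it can enter [generator]. *)
have [Er hEr] : exists Er : I -> M2, forall i, Dr r1 i ->
    mxnorm (Er i) <= Ke * weight (e_ i) (dl_ i) 3 /\
    T (e_ i) (cR (dl_ i)) (s_ i) = Rot (eta (s_ i)) *m
    mexp (generator e_ dl_ (fun i => PP (s_ i)) (fun i => Q (s_ i)) (fun i => PP' (s_ i)) Er i).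
  have : forall i, exists E : M2, Dr r1 i ->
    mxnorm E <= Ke * weight (e_ i) (dl_ i) 3 /\
    T (e_ i) (cR (dl_ i)) (s_ i) = Rot (eta (s_ i)) *m
    mexp (cR (e_ i) *: PP (s_ i) + cR (e_ i ^+ 2) *: PP' (s_ i)
       + (cI * cR (dl_ i)) *: Q (s_ i) + E).
    move=> i; have [Di|nDi] := pselect (Dr r1 i); last by exists 0.
    have [h1 /andP[h2 h3] _] := Di.
    have hd : 0 <= dl_ i < r0 by rewrite h2 (lt_le_trans h3).
    by have [E hE] := hexp (s_ i) (lt_le_trans h1 r1r0) hd; exists E.
  by move=> /choice[Er hEr]; exists Er.
have small1 i : Dr r1 i -> unit_range (e_ i) (dl_ i) by exact: Dr_small.
have P'O j k : O r1 0 (fun i => PP' (s_ i) j k).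
  apply: (@wO_bounded _ _ _ _ _ _ Kb) => i _.
  by have [_ h _] := hKb (s_ i); apply: le_trans h; exact: mxnorm_entry.
have P'11 i : reC (PP' (s_ i) i1 i1) = 0 by exact: su11_re_diag.
have ErO j k : O r1 3 (fun i => Er i j k).
  exists `|Ke|; split=> // i Di; apply: le_trans (mxnorm_entry _ _ _) _.
  apply: le_trans (proj1 (hEr i Di)) _; rewrite ler_wpM2r ?ler_norm//.
  exact: weight_ge0 (small1 i Di) _.
have [K [K0 hK]] := generator_mxnorm small1 (fun i => hPP (s_ i)) (fun i => hQ (s_ i))
  (p1O r1) (p2O r1) (p3O r1) (q1O r1) (q2O r1) (q3O r1) P'O ErO.
have [r /andP[r_gt0 rr1] hr] := shrink r10 K0.
exists r; split => //; [exact: le_trans rr1 r1r0|exact: le_trans rr1 r11|].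
have sub := Dr_mono rr1.
have small i : Dr r i -> unit_range (e_ i) (dl_ i) by move=> /sub; exact: small1.
have X1 i : Dr r i -> 2 * mxnorm (generator e_ dl_ (fun i => PP (s_ i)) (fun i => Q (s_ i))
    (fun i => PP' (s_ i)) Er i) <= 1.
  by move=> Di; have := hK i (sub _ Di); have := hr i Di; lra.
have P'O2 j k := wO_sub sub (P'O j k); have ErO2 j k := wO_sub sub (ErO j k).
have o1 := mexp_order1 small (fun i => hPP (s_ i)) (fun i => hQ (s_ i))
  (p1O r) (p2O r) (p3O r) (q1O r) (q2O r) (q3O r) P'O2 ErO2 X1.
have o2 := mexp_re_diag small (fun i => hPP (s_ i)) (fun i => hQ (s_ i))
  (p1O r) (p2O r) (p3O r) (q1O r) (q2O r) (q3O r) P'O2 (fun i => P'11 i) ErO2 X1.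
have TE i : Dr r i -> forall k,
  expi (- eta (s_ i)) * T (e_ i) (cR (dl_ i)) (s_ i) i0 k =
  mexp (generator e_ dl_ (fun i => PP (s_ i)) (fun i => Q (s_ i)) (fun i => PP' (s_ i)) Er i) i0 k /\
  expi (eta (s_ i)) * T (e_ i) (cR (dl_ i)) (s_ i) i1 k =
  mexp (generator e_ dl_ (fun i => PP (s_ i)) (fun i => Q (s_ i)) (fun i => PP' (s_ i)) Er i) i1 k.
  move=> Di k; have [_ ->] := hEr i (sub _ Di).
  have n := expiN (eta (s_ i)).
  rewrite !mulmx2E !(_ : forall x p q, Rot x p q = if p == q then (if p == i0 then expi x else expi (- x)) else 0 :> C); try by move=> *; rewrite mxE.
  rewrite /= !mul0r addr0 add0r !mulrA n [expi (- _) * _]mulrC n !mul1r.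
  by [].
split.
- apply: wO_eq (o1 i0 i0) => i Di; have [<- _] := TE i Di i0.
  by have [-> _ _ _] := hPP (s_ i); rewrite mxE.
- apply: wO_eq (o1 i0 i1) => i Di; have [<- _] := TE i Di i1.
  by have [_ -> _ _] := hPP (s_ i); rewrite mxE subr0 -betacE.
- apply: wO_eq (o1 i1 i0) => i Di; have [_ <-] := TE i Di i0.
  by have [_ _ -> _] := hPP (s_ i); rewrite mxE subr0.
- apply: wO_eq (o1 i1 i1) => i Di; have [_ <-] := TE i Di i1.
  by have [_ _ _ ->] := hPP (s_ i); rewrite mxE.
by apply: wO_eq o2 => i Di; have [_ <-] := TE i Di i1.
Qed.

Let w_ i := c_ i * z_ i + d_ i - 1.

(** The first radius controls the exponential; a second one, chosen after the error constants are
    known, brings c z + d within 1/8 of 1. *)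
Lemma denominator_near1 : exists r, [/\ 0 < r, r <= r0, r <= 1, expansions r &
  forall i, Dr r i -> modC (w_ i) <= 8^-1].
Proof.
have [r [r_gt0 rr0 r1 hx]] := expansions_near0.
have small i : Dr r i -> unit_range (e_ i) (dl_ i) by exact: Dr_small.
have [_ _ hc hd _] := hx.
have eO : O r 1 (fun i => cR (e_ i)) by exact: wO_e.
have cIO : O r 0 (fun=> cI) by exact: wO_cst.
have h1 := wOM small (isT : (1 <= 2 + 0)%N) hc (zO r).
have h2 := wOM small (isT : (1 <= 1 + 0)%N) eO
  (wOM small (isT : (0 <= 0 + 0)%N) (betaO r) (zO r)).
have h3 := wO_weaken small (isT : (1 <= 2)%N) hd.
have h4 := wOM small (isT : (1 <= 1 + 0)%N) eO
  (wOM small (isT : (0 <= 0 + 0)%N) cIO (p3O r)).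
have wO1 : O r 1 w_.
  by apply: wO_eq (wOB (wOD (wOD h1 h2) h3) h4) => i _; rewrite /w_ /pF; ring.
have [K [K0 hK]] := wO1.
have [r' /andP[r'0 rr'] hr'] := shrink r_gt0 K0.
exists r'; split => //; [exact: le_trans rr' rr0|exact: le_trans rr' r1| |].
  exact: expansions_mono hx.
by move=> i Di; apply: le_trans (hK i (Dr_mono rr' Di)) (hr' i Di).
Qed.

Hypothesis mT : forall (e : R) (dl : C) i j, cmeas (fun s => T e dl s i j).
Hypothesis meta : measurable_fun setT eta.
Hypothesis mp1 : measurable_fun setT p1.
Hypothesis mp2 : measurable_fun setT p2.
Hypothesis mp3 : measurable_fun setT p3.
Hypothesis mq3 : measurable_fun setT q3.

Let cexpi (f : Sig -> R) : measurable_fun setT f -> cmeas (fun s => expi (f s)).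
Proof.
move=> mf; have mcos : measurable_fun setT (@cos R).
  by apply: continuous_measurable_fun; exact: continuous_cos.
have msin : measurable_fun setT (@sin R).
  by apply: continuous_measurable_fun; exact: continuous_sin.
apply: cmeasD; first by apply: cmeas_cR; exact: (measurableT_comp mcos mf).
by apply: cmeasM; [exact: cmeas_cst|apply: cmeas_cR; exact: (measurableT_comp msin mf)].
Qed.

Let mu_ : cbmeas uF.
Proof.
apply: (@cbmeas_of _ _ _ _ 1); last by move=> s; rewrite modC_expi.
by apply: cexpi; apply: measurable_funM => //; exact: measurable_cst.
Qed.
Let bp1 : bmeas p1. Proof. by split=> //; exists Kb => s; case: (p_bound s). Qed.
Let bp2 : bmeas p2. Proof. by split=> //; exists Kb => s; case: (p_bound s). Qed.
Let bp3 : bmeas p3. Proof. by split=> //; exists Kb => s; case: (p_bound s). Qed.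
Let bq3 : bmeas q3. Proof. by split=> //; exists Kb => s; case: (q_bound s). Qed.
Let mpF : cbmeas pF. Proof. exact: cbmeas_cR. Qed.
Let mbeta : cbmeas betaF.
Proof.
have -> : betaF = fun s => cR (p1 s) + - cI * cR (p2 s).
  by apply/funext => s; rewrite /betaF mulNr.
apply: cbmeasD; first exact: cbmeas_cR.
by apply: cbmeasM; [exact: cbmeas_cst|exact: cbmeas_cR].
Qed.
Let mbetac : cbmeas betacF.
Proof.
have -> : betacF = fun s => cR (p1 s) + cI * cR (p2 s) by apply/funext => s; exact: betacE.
apply: cbmeasD; first exact: cbmeas_cR.
by apply: cbmeasM; [exact: cbmeas_cst|exact: cbmeas_cR].
Qed.
Let sqE (f : Sig -> R) : bmeas f -> bmeas (fun s => f s ^+ 2).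
Proof. by move=> hf; under eq_fun do rewrite expr2; exact: bmeasM. Qed.
Let mrho e dl : bmeas (rhoF e dl).
Proof.
apply: bmeasD; last by apply: bmeasM => //; exact: bmeas_cst.
apply: bmeasM; last exact: bmeas_cst.
apply: bmeasM; first exact: bmeas_cst.
by apply: bmeasB; [apply: bmeasD|]; exact: sqE.
Qed.

Hypothesis cT : forall (e dl : R) s, `|e| < r0 -> 0 <= dl < r0 ->
  disc_contraction (T e (cR dl) s).
Hypothesis m1_neq1 : ExpC P uF != 1.
Hypothesis m2_neq1 : ExpC P (fun s => uF s * uF s) != 1.

Let entries_bounded r : r <= 1 -> expansions r -> exists K : R, 1 <= K /\
  forall e dl s, `|e| < r -> 0 <= dl < r -> mxnorm (T e (cR dl) s) <= K.
Proof.
move=> r1 [ha hb hc hd _].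
have small i : Dr r i -> unit_range (e_ i) (dl_ i) by exact: Dr_small.
have eO : O r 1 (fun i => cR (e_ i)) by exact: wO_e.
have cIO : O r 0 (fun=> cI) by exact: wO_cst.
have oneO : O r 0 (fun=> 1) by exact: wO_cst.
have wk f : O r 2 f -> O r 0 f by exact: (wO_weaken small).
have M10 f g : O r 1 f -> O r 0 g -> O r 0 (fun i => f i * g i) by exact: (wOM small).
have cp : O r 0 (fun i => cI * pF (s_ i)) by apply: (wOM small (j := 0) (k := 0)) => //; exact: p3O.
have aO : O r 0 a_.
  by apply: wO_eq (wOD (wOD (wk _ ha) oneO) (M10 _ _ eO cp)) => i _; ring.
have bO : O r 0 b_.
  by apply: wO_eq (wOD (wk _ hb) (M10 _ _ eO (betacO r))) => i _; ring.
have cO : O r 0 c_.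
  by apply: wO_eq (wOD (wk _ hc) (M10 _ _ eO (betaO r))) => i _; ring.
have dO : O r 0 d_.
  by apply: wO_eq (wOB (wOD (wk _ hd) oneO) (M10 _ _ eO cp)) => i _; ring.
have [Ka [Ka0 {}aO]] := aO; have [Kbb [Kb0 {}bO]] := bO.
have [Kc [Kc0 {}cO]] := cO; have [Kd [Kd0 {}dO]] := dO.
exists (1 + Ka + Kbb + Kc + Kd); split; first by lra.
move=> e dl s he hdl.
have Di : Dr r (e, dl, s, 0) by split=> //=; rewrite modC0.
have := aO _ Di; have := bO _ Di; have := cO _ Di; have := dO _ Di.
rewrite /a_ /b_ /c_ /d_ /aF /bF /cF /dF /= !modCM !modC_expi !mul1r !mulr1.
move=> h4 h3 h2 h1; apply: mxnorm_le; apply: ord2P; apply: ord2P; rewrite /e_ /dl_ /s_ /= in h1 h2 h3 h4 *; lra.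
Qed.

Let targetF e dl : R := Exp P q3 * dl + (2^-1 * Exp P (fun s => p1 s ^+ 2 + p2 s ^+ 2) +
  reC (ExpC P betaF * ExpC P (fun s => uF s * betacF s) / (1 - ExpC P uF))) * e ^+ 2.

Let main_average e dl z c :  cbmeas c ->
  reC (ExpC P (fun s =>
    c s * z + cR (rhoF e dl s) - 2^-1 * (cR e ^+ 2 * (betaF s * z - cI * pF s) ^+ 2)
  + corr_A P c uF * uF s * z
  + cR e ^+ 2 * (corr_Ab P uF betaF * uF s * (betacF s + 2 * (cI * pF s * z) - betaF s * z ^+ 2))
  + cR e ^+ 2 * (corr_B P uF betaF pF * uF s * z + corr_G P uF betaF * uF s ^+ 2 * z ^+ 2)
  - (corr_A P c uF * z + cR e ^+ 2 * (corr_B P uF betaF pF * z + corr_G P uF betaF * z ^+ 2))))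
  = targetF e dl.
Proof.
move=> mc; rewrite step_average//.
have -> : ExpC P (fun s => pF s * pF s) = cR (Exp P (fun s => p3 s ^+ 2)).
  by rewrite -ExpC_cR; apply: eq_ExpC => s; rewrite expr2 cRM.
have hp12 : bmeas (fun s => p1 s ^+ 2 + p2 s ^+ 2) by apply: bmeasD; exact: sqE.
have hp3 : bmeas (fun s => p3 s ^+ 2) by exact: sqE.
have -> : Exp P (rhoF e dl) = e ^+ 2 / 2 * (Exp P (fun s => p1 s ^+ 2 + p2 s ^+ 2)
    - Exp P (fun s => p3 s ^+ 2)) + dl * Exp P q3.
  rewrite -ExpB// -!ExpZ//; last exact: bmeasB.
  rewrite -ExpD; first by apply: eq_Exp => s; rewrite /rhoF; ring.
    by apply: bmeasM; [exact: bmeas_cst|exact: bmeasB].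
  by apply: bmeasM; [exact: bmeas_cst|].
rewrite (_ : 2^-1 = cR 2^-1); last first.
  apply: (@mulfI _ 2) => //; rewrite mulfV//.
  by apply: complex_ext; rewrite ?reCM ?imCM /=; field.
rewrite /corr_Ab /targetF.
have -> : cR e ^+ 2 * (ExpC P betaF / (1 - ExpC P uF)) * ExpC P (fun s => uF s * betacF s) =
  cR (e ^+ 2) * (ExpC P betaF * ExpC P (fun s => uF s * betacF s) / (1 - ExpC P uF)).
  by rewrite !expr2 cRM; move: (1 - ExpC P uF)^-1 => v; ring.
rewrite [cR e ^+ 2]expr2 -!cRM reCD reCD !reC_cR reCM reC_cR imC_cR mul0r subr0.
by field.
Qed.

Lemma mean_step_estimate : exists K r : R, 0 < r /\ r <= r0 /\
  forall e dl, `|e| < r -> 0 <= dl < r ->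
  (exists KT, 1 <= KT /\ forall s, mxnorm (T e (cR dl) s) <= KT) /\
  exists al be : C, forall z, modC z <= 1 ->
  `|Exp P (fun s => ln (modC (den (T e (cR dl) s) z))
      + reC (al * mob (T e (cR dl) s) z + be * mob (T e (cR dl) s) z ^+ 2)
      - reC (al * z + be * z ^+ 2)) - targetF e dl|
    <= K * (`|e| ^+ 3 + `|e| * dl + dl ^+ 2).
Proof.
have [r [r_gt0 rr0 r1 hx hw]] := denominator_near1.
have small i : Dr r i -> unit_range (e_ i) (dl_ i) by exact: Dr_small.
have [KT [KT1 hKT]] := entries_bounded r1 hx.
have [ha hb hc hd hd3] := hx.
have mcF e dl : `|e| < r -> 0 <= dl < r -> cbmeas (cF e dl).
  move=> he hdl; apply: (@cbmeas_of _ _ _ _ KT).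
    by apply: cmeasM; [exact: cexpi|exact: mT].
  move=> s; rewrite modCM modC_expi mul1r.
  exact: le_trans (mxnorm_entry _ _ _) (hKT e dl s he hdl).
pose A i := corr_A P (cF (e_ i) (dl_ i)) uF.
pose Ab := corr_Ab P uF betaF.
pose B := corr_B P uF betaF pF.
pose G := corr_G P uF betaF.
(* The mean of c - eps beta inherits weight 2 because the estimate on c is uniform in the sample. *)
have hA : O r 2 (fun i => A i - cR (e_ i) * Ab).
  have [Kc [Kc0 hKc]] := hc.
  have h : O r 2 (fun i => ExpC P (fun s => cF (e_ i) (dl_ i) s + - cR (e_ i) * betaF s)).
    exists (2 * Kc); split; first by rewrite mulr_ge0.
    move=> i [h1 h2 h3]; rewrite -mulrA; apply: modC_ExpC_le.
      apply: cbmeasD; first exact: mcF.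
      by apply: cbmeasM => //; exact: cbmeas_cst.
    move=> s; have Di : Dr r (e_ i, dl_ i, s, z_ i) by [].
    by have := hKc _ Di; rewrite /c_ /e_ /dl_ /s_ /= mulNr.
  apply: wO_eq (wOM small (isT : (2 <= 2 + 0)%N) h (wO_cst _ _ _ (1 - ExpC P uF)^-1)) => i [h1 h2 h3].
  rewrite ExpCD ?ExpCZ//; [|exact: mcF|by apply: cbmeasM => //; exact: cbmeas_cst].
  by rewrite /A /Ab /corr_A /corr_Ab; move: (_^-1) => v; ring.
have := step_expansion small (zO r) (uO r) (betaO r) (betacO r) (p3O r)
  ha hb hc hd hd3 hw (wO_cst _ _ _ Ab) (wO_cst _ _ _ B) (wO_cst _ _ _ G) hA.
move=> [K [K0 hK]].
exists K, r; split=> //; split=> // e dl he hdl; split.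
  by exists KT; split=> // s; exact: hKT.
pose A0 := corr_A P (cF e dl) uF.
(* The corrector regrouped by powers of z. *)
exists (A0 + cR e ^+ 2 * B), (cR e ^+ 2 * G) => z z1.
have hcT s : disc_contraction (T e (cR dl) s).
  by apply: cT; [exact: lt_le_trans he rr0|case/andP: hdl => -> h; exact: lt_le_trans h rr0].
rewrite -(main_average e dl z (mcF e dl he hdl)) reC_ExpC.
set F := (X in Exp P X - _); set F0 := (X in _ - Exp P X).
(* Here the phases are put back: |c z + d| is the modulus of the true denominator, and u (a z +
   b)/(c z + d) is the true Moebius image. *)
have pointwise s : `|F s - F0 s| <= K * weight e dl 3.
  have Di : Dr r (e, dl, s, z) by [].
  have := hK _ Di; rewrite modC_cR /=; apply: le_trans.
  rewrite le_eqVlt; apply/orP; left; apply/eqP; congr (`|_|); rewrite /F /F0.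
  have u1 : modC (expi (eta s)) = 1 by exact: modC_expi.
  have un0 : expi (eta s) != 0 by rewrite -modC_gt0 u1.
  have uE : uF s = expi (eta s) * expi (eta s).
    by rewrite /uF -expiD; congr expi; ring.
  have vE : expi (- eta s) = (expi (eta s))^-1.
    by apply: (mulfI un0); rewrite expiN mulfV.
  have d0 := den_neq0 (hcT s) z1.
  have denE : c_ (e, dl, s, z) * z_ (e, dl, s, z) + d_ (e, dl, s, z) =
     expi (eta s) * den (T e (cR dl) s) z.
    by rewrite /c_ /d_ /cF /dF /den /e_ /dl_ /s_ /z_ /=; ring.
  have mobE : uF s * (a_ (e, dl, s, z) * z_ (e, dl, s, z) + b_ (e, dl, s, z)) /
     (c_ (e, dl, s, z) * z_ (e, dl, s, z) + d_ (e, dl, s, z)) = mob (T e (cR dl) s) z.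
    rewrite denE /mob uE /a_ /b_ /aF /bF /e_ /dl_ /s_ /z_ /= vE.
    by field; rewrite un0 d0.
  rewrite /corrector /= mobE denE modCM u1 mul1r.
  congr (_ + reC _ - reC _ - reC _); rewrite /A /A0 /e_ /dl_ /z_ /=; ring.
have mF0 : bmeas F0.
  rewrite /F0; have [] // : cbmeas (fun s =>
    cF e dl s * z + cR (rhoF e dl s) - 2^-1 * (cR e ^+ 2 * (betaF s * z - cI * pF s) ^+ 2)
  + A0 * uF s * z
  + cR e ^+ 2 * (Ab * uF s * (betacF s + 2 * (cI * pF s * z) - betaF s * z ^+ 2))
  + cR e ^+ 2 * (B * uF s * z + G * uF s ^+ 2 * z ^+ 2)
  - (A0 * z + cR e ^+ 2 * (B * z + G * z ^+ 2))).
  have mN (f : Sig -> C) : cbmeas f -> cbmeas (fun s => - f s).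
    move=> hf; have -> : (fun s => - f s) = (fun s => -1 * f s).
      by apply/funext => s; rewrite mulN1r.
    by apply: cbmeasM => //; exact: cbmeas_cst.
  have mX (f : Sig -> C) : cbmeas f -> cbmeas (fun s => f s ^+ 2).
    by move=> hf; under eq_fun do rewrite expr2; exact: cbmeasM.
  have k (v : C) : cbmeas (fun _ : Sig => v) by exact: cbmeas_cst.
  have D := @cbmeasD R d Sig; have M := @cbmeasM R d Sig.
  have E1 := M _ _ (mcF e dl he hdl) (k z).
  have E2 := cbmeas_cR (mrho e dl).
  have E3 := mN _ (M _ _ (k 2^-1) (M _ _ (k (cR e ^+ 2))
    (mX _ (D _ _ (M _ _ mbeta (k z)) (mN _ (M _ _ (k cI) mpF)))))).
  have E4 := M _ _ (M _ _ (k A0) mu_) (k z).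
  have E5 := M _ _ (k (cR e ^+ 2)) (M _ _ (M _ _ (k Ab) mu_)
    (D _ _ (D _ _ mbetac (M _ _ (k 2) (M _ _ (M _ _ (k cI) mpF) (k z))))
      (mN _ (M _ _ mbeta (k (z ^+ 2)))))).
  have E6 := M _ _ (k (cR e ^+ 2)) (D _ _ (M _ _ (M _ _ (k B) mu_) (k z))
    (M _ _ (M _ _ (k G) (mX _ mu_)) (k (z ^+ 2)))).
  have E7 := k (- (A0 * z + cR e ^+ 2 * (B * z + G * z ^+ 2))).
  exact: (D _ _ (D _ _ (D _ _ (D _ _ (D _ _
    (D _ _ E1 E2) E3) E4) E5) E6) E7).
(* Boundedness of the true increment comes from that of its expansion and the pointwise estimate. *)
have mF : bmeas F.
  have [_ [C0 hC0]] := mF0; split; last first.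
    exists (C0 + K * weight e dl 3) => s; rewrite -(subrK (F0 s) (F s)) addrC.
    by rewrite (le_trans (ler_normD _ _))// lerD.
  have md : cmeas (fun s => den (T e (cR dl) s) z).
    by apply: cmeasD => //; apply: cmeasM => //; exact: cmeas_cst.
  have d0 s := den_neq0 (hcT s) z1.
  have mm : cmeas (fun s => mob (T e (cR dl) s) z).
    apply: cmeasM; last exact: cmeasV.
    by apply: cmeasD => //; apply: cmeasM => //; exact: cmeas_cst.
  apply: measurable_funB; last exact: measurable_cst.
  apply: measurable_funD; first exact: measurable_ln_modC.
  have [] // : cmeas (fun s => (A0 + cR e ^+ 2 * B) * mob (T e (cR dl) s) z
     + (cR e ^+ 2 * G) * mob (T e (cR dl) s) z ^+ 2).
  apply: cmeasD; apply: cmeasM => //; try exact: cmeas_cst.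
  by apply: eq_cmeas (cmeasM mm mm) _ => s; rewrite expr2.
by rewrite -ExpB//; apply: Exp_le_norm => //; exact: bmeasB.
Qed.

End small_noise.

Unset Implicit Arguments.

Theorem theorem2 (R : realType) (d : measure_display) (Sig : measurableType d)
  (P : probability Sig R)
  (T : R -> Cx R -> Sig -> 'M[Cx R]_2)
  (eta : Sig -> R) (PP PP' Q : Sig -> 'M[Cx R]_2)
  (p1 p2 p3 q1 q2 q3 : Sig -> R) (r0 : R) :
  0 < r0 ->
  (* measurability of the random data *)
  (forall (e : R) (dl : Cx R) (i j : 'I_2),
      measurable_fun setT (fun s => reC (T e dl s i j)) /\
      measurable_fun setT (fun s => imC (T e dl s i j))) ->
  measurable_fun setT eta ->
  [/\ measurable_fun setT p1, measurable_fun setT p2 & measurable_fun setT p3] ->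
  [/\ measurable_fun setT q1, measurable_fun setT q2 & measurable_fun setT q3] ->
  (* T takes values in SL(2,C) for real (eps, delta) near (0,0) *)
  (forall (e dl : R) s, `|e| < r0 -> `|dl| < r0 -> SL2 (T e (cR dl) s)) ->
  (* (i) C^2 in real (eps, delta) near (0,0) *)
  (forall s (i j : 'I_2),
      C2_near0 (fun x : R * R => reC (T x.1 (cR x.2) s i j)) /\
      C2_near0 (fun x : R * R => imC (T x.1 (cR x.2) s i j))) ->
  (* (ii) *)
  (forall s, T 0 0 s = Rot (eta s) /\ 0 <= eta s < 2 * pi) ->
  (* (iii) *)
  (forall (e : R) s, `|e| < r0 -> SU11 (T e 0 s)) ->
  (* (iv) *)
  (forall (dl : R) s, `|dl| < r0 -> SU11 (T 0 (cI * cR dl) s)) ->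
  (* (v) *)
  (forall (e dl : R) s, `|e| < r0 -> 0 <= dl < r0 -> SU11le (T e (cR dl) s)) ->
  (* P, P', Q in su(1,1), with the coefficients of P and Q *)
  (forall s, PP s = cR (p1 s) *: B1 + cR (p2 s) *: B2 + cR (p3 s) *: B3) ->
  (forall s, Q s = cR (q1 s) *: B1 + cR (q2 s) *: B2 + cR (q3 s) *: B3) ->
  (forall s, su11 (PP' s)) ->
  (* (vi) uniform boundedness *)
  (exists Kb : R, forall s,
      [/\ mxnorm (PP s) <= Kb, mxnorm (PP' s) <= Kb & mxnorm (Q s) <= Kb]) ->
  (* expansion (v) with (vii) uniform error bound *)
  (exists Ke : R, forall (e dl : R) s, `|e| < r0 -> 0 <= dl < r0 ->
      exists Er : 'M[Cx R]_2,
        mxnorm Er <= Ke * (`|e| ^+ 3 + `|e| * dl + dl ^+ 2) /\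
        T e (cR dl) s = Rot (eta s) *m
          mexp (cR e *: PP s + cR (e ^+ 2) *: PP' s + (cI * cR dl) *: Q s + Er)) ->
  (* (viii) *)
  (forall (e dl : R), `|e| < r0 -> `|dl| < r0 -> (e, dl) != (0, 0) ->
      forall F : seq (option (Cx R)), F != [::] ->
      exists M z, [/\ mx_supp P (fun s => T e (cR dl) s) M, z \in F & mobius M z \notin F]) ->
  (* (ix) *)
  (forall (e dl : R), `|e| < r0 -> `|dl| < r0 -> (e, dl) != (0, 0) ->
      ~ compact (closure (semigen (mx_supp P (fun s => T e (cR dl) s))))) ->
  (* E(e^{2 i j eta}) <> 1 for j = 1, 2 *)
  ExpC P (fun s => expi (2 * eta s)) != 1 ->
  ExpC P (fun s => expi (4 * eta s)) != 1 ->
  let beta := fun s => cR (p1 s) - cI * cR (p2 s) in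
  let CC := Exp P q3 in
  let DD := 2^-1 * Exp P (fun s => p1 s ^+ 2 + p2 s ^+ 2)
            + reC (ExpC P beta * ExpC P (fun s => expi (2 * eta s) * Num.conj (beta s))
                   / (1 - ExpC P (fun s => expi (2 * eta s)))) in
  exists K r : R, 0 < r /\
    forall e dl : R, `|e| < r -> 0 <= dl < r ->
    forall (d' : measure_display) (Om : measurableType d') (Qm : probability Om R)
           (sq : nat -> Om -> Sig),
      iid_seq P Qm sq ->
      {ae Qm, forall w, exists g : R,
          lyap_seq (fun n => T e (cR dl) (sq n w)) @ \oo --> g /\
          `|g - (CC * dl + DD * e ^+ 2)| <= K * (`|e| ^+ 3 + `|e| * dl + dl ^+ 2)}.
Proof.
move=> r00 mT meta [mp1 mp2 mp3] [mq1 mq2 mq3] _ _ _ _ _ hcontr hPP hQ hPP'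
  [Kb hKb] [Ke hexp] _ _ m1_neq1 m4_neq1 beta CC DD.
(* The hypothesis on 4 eta is the one on the mean of u^2, the multiplier of z^2. *)
have m2_neq1 : ExpC P (fun s => expi (2 * eta s) * expi (2 * eta s)) != 1.
  rewrite (_ : (fun _ => _) = fun s => expi (4 * eta s))//.
  by apply/funext => s; rewrite -expiD; congr expi; ring.
have cPP s : su11_coord (PP s) (p1 s) (p2 s) (p3 s) by rewrite hPP; exact: su11_coordP.
have cQ s : su11_coord (Q s) (q1 s) (q2 s) (q3 s) by rewrite hQ; exact: su11_coordP.
have cT (e dl : R) s : `|e| < r0 -> 0 <= dl < r0 -> disc_contraction (T e (cR dl) s).
  by move=> he hdl; apply: SU11le_disc_contraction; exact: hcontr.
have [K [r [r_gt0 [rr0 main]]]] := mean_step_estimate r00 cPP cQ hPP' hKb hexp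
  mT meta mp1 mp2 mp3 mq3 cT m1_neq1 m2_neq1.
exists K, r; split=> // e dl he hdl d' Om Qm sq iid.
have [[KT [KT1 hKT]] [al [be hstep]]] := main e dl he hdl.
have cM s : disc_contraction (T e (cR dl) s).
  apply: cT; first exact: lt_le_trans he rr0.
  by case/andP: hdl => -> h; exact: lt_le_trans h rr0.
exact: (random_product_iid (mT e (cR dl)) cM KT1 hKT hstep iid).
Qed.
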